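(* Let $k\ge 4$ and $n\ge 3k+3$ be integers, and let $G_0$ be a graph with minimum $AZI$ among all graphs in $\mathbb{T}^k_n$. Then, up to isomorphism, $$G_0=\begin{cases}A_{k,\lfloor\frac{n-k}{2}\rfloor,\lceil\frac{n-k}{2}\rceil} & \text{if } k\ge 7,\\[1mm] B_{6,\lceil\frac{n}{2}\rceil-3,\lfloor\frac{n}{2}\rfloor-3} & \text{if } k=6,\\[1mm] C_{k,k,n-2k} & \text{if } 4\le k\le 5.\end{cases}$$
   Context: Graphs are finite, simple and connected; $d(v)$ is the degree of $v$. An $r$-vertex is a vertex of degree $r$; a pendant vertex is a $1$-vertex. For a connected graph $G$ on at least three vertices, $AZI(G)=\sum_{uv\in E(G)}\left(\frac{d(u)d(v)}{d(u)+d(v)-2}\right)^3$. For $k\ge1$, a $k$-apex tree is a connected graph $G$ for which there is a $k$-element set $V_k\subset V(G)$ such that $G-V_k$ is a tree, while $G-X$ is not a tree for every $X\subset V(G)$ with $|X|<k$. $\mathbb{T}^k_n$ is the class of $k$-apex trees on $n$ vertices. Trees: $K_{1,m}$ is the star with $m+1$ vertices. For $q\ge5$, $Z_q$ is the unique tree on $q$ vertices with $q-2$ pendant vertices, one $2$-vertex and one $(q-2)$-vertex; its special pendant vertex is the unique pendant vertex adjacent to the $2$-vertex. $Z_4=P_4$ (path on 4 vertices), and either of its two pendant vertices is a special pendant vertex. Each graph below is unicyclic with unique cycle a triangle $u_1u_2u_3u_1$, and is obtained from the triangle by attaching rooted trees $T_{u_1},T_{u_2},T_{u_3}$, identifying the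 root of $T_{u_i}$ with $u_i$ ($u_i$ is counted as a vertex of $T_{u_i}$). - $A_{s_1,s_2,s_3}$ ($s_i\ge4$): $T_{u_i}=Z_{s_i}$ with $u_i$ the special pendant vertex, for $i=1,2,3$. - $B_{s_1,s_2,s_3}$ ($s_1\ge2$, $s_2,s_3\ge4$): $T_{u_1}=K_{1,s_1-1}$ with $u_1$ its center; $T_{u_i}=Z_{s_i}$ with $u_i$ the special pendant vertex for $i=2,3$. - $C_{s_1,s_2,s_3}$ ($s_1\ge2$, $s_2\ge3$, $s_3\ge4$): $T_{u_1}=K_{1,s_1-1}$ with $u_1$ its center; $T_{u_2}=K_{1,s_2-1}$ with $u_2$ a pendant vertex of it; $T_{u_3}=Z_{s_3}$ with $u_3$ the special pendant vertex. *)

(* Defs.v *)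
From HB Require Import structures.
From mathcomp Require Import all_boot all_order all_algebra.
Import Order.TTheory GRing.Theory Num.Theory.

Set Implicit Arguments.
Unset Strict Implicit.
Unset Printing Implicit Defensive.

Record sgraph := SGraph {
  vertex :> finType;
  adj : rel vertex;
  adj_sym : symmetric adj;
  adj_irrefl : irreflexive adj
}.

Definition iso (G H : sgraph) : Prop :=
  exists f : G -> H, bijective f /\ forall x y, adj (f x) (f y) = adj x y.

Definition deg (G : sgraph) (v : G) : nat := #|[set w | adj v w]|.

Definition edges (G : sgraph) : {set {set G}} :=
  [set [set p.1; p.2] | p : G * G & adj p.1 p.2].

(* For an edge e = [set u; v], the product and the sum over e are
   d(u) d(v) and d(u) + d(v).  All values are rational, so that comparing AZI
   in [rat] is the same as comparing it in the reals.  The denominator vanishes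
   only on a component K_2, hence never for a connected graph with at least
   three vertices. *)
Definition AZI (G : sgraph) : rat :=
  (\sum_(e in edges G)
     ((\prod_(v in e) deg v)%N%:R / ((\sum_(v in e) deg v)%N%:R - 2%:R)) ^+ 3)%R.

Definition connected (G : sgraph) : Prop :=
  0 < #|G| /\ forall x y : G, connect (@adj G) x y.

(* [ucycle] admits closed walks with at most two vertices: the empty one and
   an edge traversed back and forth. *)
Definition acyclic (G : sgraph) : Prop :=
  forall c : seq G, ucycle (@adj G) c -> size c < 3.

Definition tree (G : sgraph) : Prop := connected G /\ acyclic G.

Section DelVertices.
Variables (G : sgraph) (X : {set G}).

Let T : finType := {x : G | x \notin X}.
Let del_adj : rel T := fun x y => adj (val x) (val y).

Fact del_adj_sym : symmetric del_adj.
Proof. by move=> x y; apply: adj_sym. Qed.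

Fact del_adj_irrefl : irreflexive del_adj.
Proof. by move=> x; apply: adj_irrefl. Qed.

Definition del_vertices : sgraph := SGraph del_adj_sym del_adj_irrefl.

End DelVertices.

Definition apex_tree (k : nat) (G : sgraph) : Prop :=
  [/\ connected G,
      exists X : {set G}, #|X| = k /\ tree (del_vertices X)
    & forall X : {set G}, #|X| < k -> ~ tree (del_vertices X)].

Definition in_apex_class (k n : nat) (G : sgraph) : Prop :=
  apex_tree k G /\ #|G| = n.

Definition min_AZI (k n : nat) (G : sgraph) : Prop :=
  in_apex_class k n G /\
  forall H : sgraph, in_apex_class k n H -> (AZI G <= AZI H)%R.

Section Path.
Variable n : nat.

Let path_adj : rel 'I_n := fun i j => (i.+1 == j) || (j.+1 == i).

Fact path_adj_sym : symmetric path_adj.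
Proof. by move=> i j; rewrite /path_adj orbC. Qed.

Fact path_adj_irrefl : irreflexive path_adj.
Proof. by move=> i; rewrite /path_adj orbb gtn_eqF. Qed.

Definition path_graph : sgraph := SGraph path_adj_sym path_adj_irrefl.

End Path.

(* K_{1,m}, with center [None]. *)
Section Star.
Variable m : nat.

Let star_adj : rel (option 'I_m) := fun x y => isSome x != isSome y.

Fact star_adj_sym : symmetric star_adj.
Proof. by move=> x y; rewrite /star_adj eq_sym. Qed.

Fact star_adj_irrefl : irreflexive star_adj.
Proof. by move=> x; rewrite /star_adj eqxx. Qed.

Definition star : sgraph := SGraph star_adj_sym star_adj_irrefl.
Definition star_center : star := None.

End Star.

Definition pendant (G : sgraph) (v : G) : Prop := deg v = 1.

(* T is a copy of Z_q.  For q >= 5 the conditions determine T up to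
   isomorphism, the number q - 2 being different from 1 and 2. *)
Definition is_Z (q : nat) (T : sgraph) : Prop :=
  (q = 4 /\ iso T (path_graph 4)) \/
  [/\ 5 <= q, tree T, #|T| = q
    & [/\ #|[set v : T | deg v == 1]| = q - 2,
          #|[set v : T | deg v == 2]| = 1
        & #|[set v : T | deg v == q - 2]| = 1]].

(* In Z_4 = P_4 both pendant vertices qualify; in Z_q with q >= 5 exactly one
   does. *)
Definition special_pendant (T : sgraph) (v : T) : Prop :=
  pendant v /\ exists w : T, adj v w /\ deg w = 2.

Definition is_rooted_Z (q : nat) (T : sgraph) (r : T) : Prop :=
  is_Z q T /\ special_pendant r.

(* The disjoint union of three rooted graphs whose roots are joined into a
   triangle; equivalently, the roots are identified with the vertices of a
   triangle. *)
Section TriangleAttach.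
Variables (T1 T2 T3 : sgraph) (r1 : T1) (r2 : T2) (r3 : T3).

Let V : finType := (T1 + T2 + T3)%type.

Let is_root (x : V) : bool :=
  match x with
  | inl (inl a) => a == r1
  | inl (inr a) => a == r2
  | inr a => a == r3
  end.

Let tri_adj : rel V := fun x y =>
  match x, y with
  | inl (inl a), inl (inl b) => adj a b
  | inl (inr a), inl (inr b) => adj a b
  | inr a, inr b => adj a b
  | _, _ => is_root x && is_root y
  end.

Fact tri_adj_sym : symmetric tri_adj.
Proof.
by move=> [[a|a]|a] [[b|b]|b] //=; rewrite /tri_adj /= 1?andbC // adj_sym.
Qed.

Fact tri_adj_irrefl : irreflexive tri_adj.
Proof. by move=> [[a|a]|a]; apply: adj_irrefl. Qed.

Definition triangle_attach : sgraph := SGraph tri_adj_sym tri_adj_irrefl.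

End TriangleAttach.

(* "G is isomorphic to A_{s1,s2,s3}", and similarly for B and C; the graphs
   are determined up to isomorphism by their parameters. *)
Definition is_A (s1 s2 s3 : nat) (G : sgraph) : Prop :=
  exists (T1 T2 T3 : sgraph) (r1 : T1) (r2 : T2) (r3 : T3),
    [/\ is_rooted_Z s1 r1, is_rooted_Z s2 r2, is_rooted_Z s3 r3
      & iso G (triangle_attach r1 r2 r3)].

Definition is_B (s1 s2 s3 : nat) (G : sgraph) : Prop :=
  2 <= s1 /\
  exists (T2 T3 : sgraph) (r2 : T2) (r3 : T3),
    [/\ is_rooted_Z s2 r2, is_rooted_Z s3 r3
      & iso G (triangle_attach (star_center (s1 - 1)) r2 r3)].

Definition is_C (s1 s2 s3 : nat) (G : sgraph) : Prop :=
  [/\ 2 <= s1, 3 <= s2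
    & exists (r2 : star (s2 - 1)) (T3 : sgraph) (r3 : T3),
        [/\ pendant r2, is_rooted_Z s3 r3
          & iso G (triangle_attach (star_center (s1 - 1)) r2 r3)]].

(* Main.v *)
(* Write w(a,b) = (ab/(a+b-2))^3 and charge 1 to every vertex, so that
   AZI(G) - n is the sum of w - 1 over the edges plus the cyclomatic number
   minus 1; this excess is monotone for connected induced subgraphs. A vertex
   with two neighbours whose removal keeps the graph connected contributes at
   least 15 and lowers the apex number by at most one, so the excess can be
   bounded by induction on k as long as such a light vertex exists. In a
   graph without light vertices each vertex of a cycle carries a further branch,
   and two independent cycles then already exceed the bound.
   There remain the unicyclic graphs, where the apex condition says that each
   tree attached to the cycle has at least k vertices, with equality for one of
   them. The cycle must be a triangle, and the contributions of the attached
   trees, computed from their shapes (star rooted at its center, star rooted at a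
   leaf, Z_s, or something worse), are compared one by one; for two copies of Z
   the convexity of 3/t + 1/t^2 makes the sizes balanced. *)
Require Import Defs.
From HB Require Import structures.
From mathcomp Require Import all_boot all_order all_algebra.
From mathcomp Require Import ring lra zify.
Import Order.TTheory GRing.Theory Num.Theory.

Set Implicit Arguments.
Unset Strict Implicit.
Unset Printing Implicit Defensive.

Local Open Scope ring_scope.

(** * The weight of an edge *)

(** Every edge without a pendant end weighs at least 8, with equality if one end has degree 2; hence
    15 = 8 + 8 - 1 for a light vertex. The targets are tight: the excess of the claimed minimum is
    below 84.2 for k >= 6, below 80 for k = 5 and below 75.46 for k = 4, and all three are nearly
    reached. Almost every constant below is a value rounded just finely enough for these. Gaining 15
    per light vertex is enough for k >= 5, but for k = 4 it yields only 66; there n >= 15 and a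
    count of the nonpendant vertices are used as well. The case distinction in k comes from single
    attached trees: a star rooted at its center is cheaper than Z_s up to s = 6 and dearer from s =
    7 on; a star rooted at a leaf is cheaper than Z_s up to s = 5 only. Two stars rooted at their
    centers never occur together, since the edge joining two roots of large degree is too heavy. *)

Definition hw (a b : nat) : rat := (a * b)%N%:R / ((a + b)%N%:R - 2%:R).

(* Locked, since tactics would otherwise evaluate closed instances. *)
HB.lock Definition fw (a b : nat) : rat := hw a b ^+ 3.

Lemma hwC a b : hw a b = hw b a.
Proof. by rewrite /hw mulnC addnC. Qed.

Lemma fwC a b : fw a b = fw b a.
Proof. by rewrite unlock hwC. Qed.

Lemma hwE a b : hw a b = a%:R * b%:R / (a%:R + b%:R - 2).
Proof. by rewrite /hw natrM natrD. Qed.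

Lemma hw_ge1 a b : (0 < a)%N -> (0 < b)%N -> (2 < a + b)%N -> 1 <= hw a b.
Proof.
move=> a0 b0 ab; rewrite hwE.
have A : 1 <= a%:R :> rat by rewrite ler1n.
have B : 1 <= b%:R :> rat by rewrite ler1n.
have AB : 3 <= a%:R + b%:R :> rat by rewrite -natrD (ler_nat _ 3).
rewrite ler_pdivlMr; first nra.
lra.
Qed.

(** Cross multiplication leaves b (b - 2) (c - a), which is why b >= 2 is required. For b = 1 the
    weight decreases in the other degree, so pendant edges are always estimated separately. *)
Lemma hw_mono a b c : (2 <= b)%N -> (2 <= a <= c)%N -> hw a b <= hw c b.
Proof.
move=> b2 /andP[a2 ac]; rewrite !hwE.
have B : 2 <= b%:R :> rat by rewrite (ler_nat _ 2).
have A : 2 <= a%:R :> rat by rewrite (ler_nat _ 2).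
have C : a%:R <= c%:R :> rat by rewrite ler_nat.
rewrite ler_pdivrMr; last lra.
rewrite mulrAC ler_pdivlMr; last lra.
have h : 0 <= b%:R * (b%:R - 2) * (c%:R - a%:R) :> rat.
  by rewrite !mulr_ge0 // ?subr_ge0 // ler0n.
nra.
Qed.

Lemma hw2 b : (0 < b)%N -> hw 2 b = 2.
Proof.
move=> b0; rewrite hwE.
have B : b%:R != 0 :> rat by rewrite pnatr_eq0 -lt0n.
have -> : 2%:R + b%:R - 2 = b%:R :> rat by lra.
by rewrite mulfK.
Qed.

(** The independence of [b] makes 2-vertices cheap, and it is the source of the constants 14 = 8 + 8
    - 2 and 15 = 8 + 8 - 1 below. *)
Lemma fw2 b : (0 < b)%N -> fw 2 b = 8.
Proof. by move=> b0; rewrite unlock hw2 //; lra. Qed.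

Lemma hw_ge2 a b : (2 <= a)%N -> (2 <= b)%N -> 2 <= hw a b.
Proof.
move=> a2 b2; have <- := hw2 (ltnW b2).
by apply: hw_mono; rewrite ?a2.
Qed.

Lemma fw_ge1 a b : (0 < a)%N -> (0 < b)%N -> (2 < a + b)%N -> 1 <= fw a b.
Proof. by move=> a0 b0 ab; rewrite unlock exprn_ege1 // hw_ge1. Qed.

Lemma fw_monol a b c : (2 <= b)%N -> (2 <= a <= c)%N -> fw a b <= fw c b.
Proof.
move=> b2 /andP[a2 ac].
have h : hw a b <= hw c b by apply: hw_mono; rewrite // a2.
have p := hw_ge2 a2 b2.
by rewrite unlock; apply: lerXn2r => //; rewrite nnegrE; lra.
Qed.

Lemma fw_mono a b c d :
  (2 <= a <= c)%N -> (2 <= b <= d)%N -> fw a b <= fw c d.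
Proof.
move=> /andP[a2 ac] /andP[b2 bd].
apply: le_trans (_ : fw c b <= _); first by apply: fw_monol; rewrite // a2.
by rewrite fwC (fwC c); apply: fw_monol; rewrite ?b2 // (leq_trans a2).
Qed.

Lemma fw_ge8 a b : (2 <= a)%N -> (2 <= b)%N -> 8 <= fw a b.
Proof.
move=> a2 b2; have <- := fw2 (ltnW b2).
by apply: fw_mono; rewrite ?a2 ?b2 /=.
Qed.

(** Over a common positive denominator the difference is (a - 3)(b - 3)(4ab + a + b - 2). *)
Lemma hw_super a b : (3 <= a)%N -> (3 <= b)%N ->
  hw a 3 + hw 3 b <= hw a b + hw 3 3.
Proof.
move=> a3 b3; rewrite !hwE.
have A : 3 <= a%:R :> rat by rewrite (ler_nat _ 3).
have B : 3 <= b%:R :> rat by rewrite (ler_nat _ 3).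
move: a%:R b%:R A B => x y X Y; rewrite -subr_ge0.
have -> : x * y / (x + y - 2) + 3%:R * 3%:R / (3%:R + 3%:R - 2) -
  (x * 3%:R / (x + 3%:R - 2) + 3%:R * y / (3%:R + y - 2)) =
  (x - 3) * (y - 3) * (4 * x * y + x + y - 2) /
    (4 * (x + y - 2) * (x + 1) * (y + 1)) :> rat.
  field.
  rewrite !lt0r_neq0 //; lra.
apply: divr_ge0.
  apply: mulr_ge0; last nra.
  by apply: mulr_ge0; rewrite subr_ge0.
by rewrite !mulr_ge0 //; lra.
Qed.

(** Transfers supermodularity through the cube: at p = q + r - s the difference factors as 3 (q -
    s)(r - s)(q + r), and the left out part of p only helps. *)
Lemma cube_super (p q r s : rat) :
  0 <= s -> s <= q -> s <= r -> q + r <= p + s ->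
  q ^+ 3 + r ^+ 3 <= p ^+ 3 + s ^+ 3.
Proof.
move=> s0 sq sr h.
have P : (q + r - s) ^+ 3 <= p ^+ 3.
  by apply: lerXn2r; rewrite ?nnegrE; lra.
apply: le_trans (_ : (q + r - s) ^+ 3 + s ^+ 3 <= _); last by rewrite lerD2r.
rewrite -subr_ge0.
have -> : (q + r - s) ^+ 3 + s ^+ 3 - (q ^+ 3 + r ^+ 3) =
  3 * (q - s) * (r - s) * (q + r) by ring.
by rewrite !mulr_ge0 //; lra.
Qed.

Lemma fw_super a b : (3 <= a)%N -> (3 <= b)%N ->
  fw a 3 + fw 3 b <= fw a b + fw 3 3.
Proof.
rewrite unlock => a3 b3; apply: cube_super.
- by apply: le_trans (hw_ge2 _ _).
- by apply: hw_mono.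
- by rewrite (hwC _ b); apply: hw_mono.
exact: hw_super.
Qed.

Lemma fw33 : fw 3 3 = 729 / 64.
Proof. by rewrite unlock hwE; field. Qed.
Lemma fw34 : fw 3 4 = 1728 / 125.
Proof. by rewrite unlock hwE; field. Qed.
Lemma fw35 : fw 3 5 = 125 / 8.
Proof. by rewrite unlock hwE; field. Qed.
Lemma fw36 : fw 3 6 = 5832 / 343.
Proof. by rewrite unlock hwE; field. Qed.
Lemma fw37 : fw 3 7 = 9261 / 512.
Proof. by rewrite unlock hwE; field. Qed.
Lemma fw38 : fw 3 8 = 512 / 27.
Proof. by rewrite unlock hwE; field. Qed.
Lemma fw44 : fw 4 4 = 512 / 27.
Proof. by rewrite unlock hwE; field. Qed.
Lemma fw55 : fw 5 5 = 15625 / 512.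
Proof. by rewrite unlock hwE; field. Qed.
Lemma fw66 : fw 6 6 = 5832 / 125.
Proof. by rewrite unlock hwE; field. Qed.

(** The net contribution of t pendant vertices at a vertex of degree t + 1: it stays slightly above
    3 and decreases in t, so large stars cost hardly more than small ones. *)
Lemma fw1 t : (0 < t)%N ->
  t%:R * (fw 1 t.+1 - 1) = 3 + 3 / t%:R + 1 / t%:R ^+ 2.
Proof.
move=> t0; have T : t%:R != 0 :> rat by rewrite pnatr_eq0 -lt0n.
rewrite unlock hwE -(natr1 t); have -> : 1 + (t%:R + 1) - 2 = t%:R :> rat by ring.
by field.
Qed.

(** * Connected vertex sets *)

Section Graph.
Variable G : sgraph.
Implicit Types (A B C D F H T Z : {set G}) (u v w x y z : G).

Definition nb A x : {set G} := [set y in A | adj x y].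

Definition closed_in H A := forall x y, x \in A -> y \in H -> adj x y -> y \in A.

(* Connectedness of the induced subgraph, as the absence of a cut. *)
Definition conn H :=
  H != set0 /\
  forall A, A \subset H -> A != set0 -> closed_in H A -> A = H.

Lemma in_nb A x y : (y \in nb A x) = (y \in A) && adj x y.
Proof. by rewrite inE. Qed.

Lemma adjC x y : adj x y = adj y x.
Proof. exact: adj_sym. Qed.

Lemma adj_neq x y : adj x y -> x != y.
Proof. by apply: contraTneq => ->; rewrite adj_irrefl. Qed.

Lemma nb_sub A x : nb A x \subset A.
Proof. by apply/subsetP => y; rewrite inE => /andP[]. Qed.

Lemma nbS A B x : A \subset B -> nb A x \subset nb B x.
Proof.
move=> AB; apply/subsetP => y; rewrite !inE => /andP[yA ->].
by rewrite (subsetP AB).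
Qed.

Lemma degE x : deg x = #|nb setT x|.
Proof. by rewrite /deg; congr #|pred_of_set _|; apply/setP => y; rewrite !inE. Qed.

Lemma nb_leq_deg A x : (#|nb A x| <= deg x)%N.
Proof. by rewrite degE subset_leq_card // nbS // subsetT. Qed.

Lemma conn_exit H A : conn H -> A \subset H -> A != set0 -> A != H ->
  exists x y, [/\ x \in A, y \in H, y \notin A & adj x y].
Proof.
move=> [_ cH] AH A0 AnH.
case: (boolP [exists x in A, exists y in H, (y \notin A) && adj x y]).
  case/exists_inP => x xA /exists_inP[y yH /andP[yA xy]].
  by exists x, y.
rewrite negb_exists_in => /forall_inP nex.
case/eqP: AnH; apply: cH => // x y xA yH xy.
apply/negPn/negP => yA; have := nex x xA; rewrite negb_exists_in.
by move/forall_inP/(_ y yH); rewrite yA xy.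
Qed.

Lemma conn1 x : conn [set x].
Proof.
split; first by apply/set0Pn; exists x; rewrite inE.
move=> A; rewrite subset1 => /orP[/eqP->//|/eqP->]; by rewrite eqxx.
Qed.

(** Connectedness always supplies a vertex of H outside B with a neighbour in B, so H is reached
    from A by absorbing one such vertex at a time. *)
Lemma grow (P : {set G} -> Prop) H A : conn H -> A \subset H -> A != set0 ->
  P A ->
  (forall B u w, A \subset B -> B \subset H -> u \in H -> u \notin B ->
     w \in B -> adj u w -> P B -> P (u |: B)) -> P H.
Proof.
move=> cH AH A0 PA step.
suff: forall m B, (#|H| <= #|B| + m)%N -> A \subset B -> B \subset H ->
    P B -> P H.
  by move=> /(_ #|H| A); apply => //; rewrite leq_addl.
elim=> [|m IH] B hm AB BH PB.
  by rewrite addn0 in hm; have /eqP <- : B == H by rewrite eqEcard BH.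
case: (eqVneq B H) => [<-//|BnH].
have B0 : B != set0.
  by case/set0Pn: A0 => a aA; apply/set0Pn; exists a; rewrite (subsetP AB).
have [w [u [wB uH uB wu]]] := conn_exit cH BH B0 BnH.
apply: (IH (u |: B)).
- by rewrite cardsU1 uB /=; lia.
- by rewrite (subset_trans AB) // subsetUr.
- by rewrite subUset sub1set uH.
by apply: (step B u w) => //; rewrite adjC.
Qed.

Lemma conn_union A B x y : conn A -> conn B -> x \in A -> y \in B ->
  (x == y) || adj x y -> conn (A :|: B).
Proof.
move=> cA cB xA yB xy; split.
  by apply/set0Pn; exists x; rewrite inE xA.
move=> C CAB /set0Pn[c cC] clC.
have hinA : forall a, a \in A -> a \in C -> A \subset C.
  move=> a aA aC; have [_ h] := cA.
  have -> : A = A :&: C; last by rewrite subsetIr.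
  apply/esym/h; first by rewrite subsetIl.
    by apply/set0Pn; exists a; rewrite inE aA.
  move=> p q; rewrite !inE => /andP[pA pC] qA pq; rewrite qA /=.
  by apply: clC pq => //; rewrite inE qA.
have hinB : forall a, a \in B -> a \in C -> B \subset C.
  move=> a aA aC; have [_ h] := cB.
  have -> : B = B :&: C; last by rewrite subsetIr.
  apply/esym/h; first by rewrite subsetIl.
    by apply/set0Pn; exists a; rewrite inE aA.
  move=> p q; rewrite !inE => /andP[pA pC] qA pq; rewrite qA /=.
  by apply: clC pq => //; rewrite inE qA orbT.
apply/eqP; rewrite eqEsubset CAB subUset /=.
have [cA'|cB'] : c \in A \/ c \in B.
  by have := subsetP CAB c cC; rewrite inE => /orP[]; [left|right].
- have sAC := hinA _ cA' cC; rewrite sAC /=.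
  have xC := subsetP sAC x xA.
  apply: (hinB y) => //.
  case/orP: xy => [/eqP<-//|xy]; apply: clC xy => //.
  by rewrite inE yB orbT.
have BC := hinB _ cB' cC; rewrite BC andbT.
have yC := subsetP BC y yB.
apply: (hinA x) => //.
case/orP: xy => [/eqP->//|xy]; apply: (clC y) => //; last by rewrite adjC.
by rewrite inE xA.
Qed.

Lemma conn_add H u w : conn H -> w \in H -> adj u w -> conn (u |: H).
Proof.
move=> cH wH uw; apply: (conn_union (conn1 u) cH (set11 u) wH).
by rewrite uw orbT.
Qed.

Definition radj H : rel G := fun a b => [&& a \in H, b \in H & adj a b].
Definition gcomp H x : {set G} := [set y | connect (radj H) x y].

Lemma radj_sym H : symmetric (radj H).
Proof. by move=> a b; rewrite /radj adjC andbCA. Qed.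

Lemma radj_connC H x y : connect (radj H) x y = connect (radj H) y x.
Proof. exact: (sym_connect_sym (@radj_sym H)). Qed.

Lemma gcomp_id H x : x \in gcomp H x.
Proof. by rewrite inE connect0. Qed.

Lemma connect_inv (e : rel G) (A : pred G) x y : connect e x y ->
  (forall p q, A p -> e p q -> A q) -> A x -> A y.
Proof.
move=> /connectP[p pp ->] h; elim: p x pp => //= z p IH x /andP[xz pz] Ax.
by apply: IH pz _; apply: h xz.
Qed.

Lemma gcomp_sub H x : x \in H -> gcomp H x \subset H.
Proof.
move=> xH; apply/subsetP => y; rewrite inE => c.
by apply: (connect_inv (A := mem H) c) => // p q _ /and3P[].
Qed.

Lemma gcomp_closed H x : x \in H -> closed_in H (gcomp H x).
Proof.
move=> xH p q; rewrite !inE => cp qH pq; apply: (connect_trans cp).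
apply: connect1; rewrite /radj qH pq !andbT.
by apply: (subsetP (gcomp_sub xH)); rewrite inE.
Qed.

Lemma conn_gcomp H x : x \in H -> conn (gcomp H x).
Proof.
move=> xH; split; first by apply/set0Pn; exists x; apply: gcomp_id.
move=> A sAC /set0Pn[a aA] clA; apply/eqP; rewrite eqEsubset sAC /=.
apply/subsetP => y yc.
have ay : connect (radj H) a y.
  rewrite inE in yc; apply: connect_trans yc.
  by rewrite radj_connC; have := subsetP sAC a aA; rewrite inE.
apply: (connect_inv (A := mem A) ay) => // p q pA /and3P[pH qH pq].
apply: (clA p) => //; apply: (@gcomp_closed H x xH p q) => //.
exact: (subsetP sAC).
Qed.

Lemma conn_sub_gcomp H x A : conn A -> A \subset H -> x \in A ->
  A \subset gcomp H x.
Proof.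
move=> [_ cA] AH xA.
have -> : A = A :&: gcomp H x; last by rewrite subsetIr.
apply/esym/cA; first by rewrite subsetIl.
  by apply/set0Pn; exists x; rewrite inE xA gcomp_id.
move=> p q; rewrite !inE => /andP[pA pc] qA pq; rewrite qA /=.
apply: connect_trans pc _; apply: connect1.
by rewrite /radj !(subsetP AH).
Qed.

Lemma gcomp_eq H x y : y \in gcomp H x -> gcomp H y = gcomp H x.
Proof.
rewrite inE => xy; apply/setP => z; rewrite !inE.
apply/idP/idP => [|c]; first exact: connect_trans.
by rewrite radj_connC in xy; apply: connect_trans xy c.
Qed.

Lemma conn_nb H x : conn H -> (1 < #|H|)%N -> x \in H ->
  exists2 y, y \in H & adj x y.
Proof.
move=> cH h xH.
have [|||a [b [/set1P -> bH _ ab]]] := @conn_exit H [set x] cH.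
- by rewrite sub1set.
- by apply/set0Pn; exists x; rewrite inE.
- by apply: contraTneq h => <-; rewrite cards1.
by exists b.
Qed.

(* en H is the number of edges of the subgraph induced by H. *)
Definition e2 H : nat := (\sum_(x in H) #|nb H x|)%N.
Definition en H : nat := (e2 H)./2.
Definition cross A B : nat := (\sum_(x in A) #|nb B x|)%N.

Variable f : G -> G -> rat.
Hypothesis fC : forall x y, f x y = f y x.

(** Ordered pairs are summed, so [W H H] counts every edge of H twice. The weight [f] stays
    abstract: the constant 1 turns [ex] into edges minus vertices, and [ff] gives the excess of the
    index. *)
Definition W A B : rat := \sum_(x in A) \sum_(y in nb B x) f x y.
Definition ex H : rat := W H H / 2 - #|H|%:R.

Lemma WE A B :
  W A B = \sum_(x in A) \sum_(y in B) if adj x y then f x y else 0.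
Proof.
apply: eq_bigr => x _; rewrite -big_mkcondr /=; apply: eq_bigl => y.
by rewrite inE.
Qed.

Lemma W_sym A B : W A B = W B A.
Proof.
rewrite !WE exchange_big /=; apply: eq_bigr => y _; apply: eq_bigr => x _.
by rewrite adjC fC.
Qed.

Lemma W_Ul A B C : [disjoint A & B] -> W (A :|: B) C = W A C + W B C.
Proof. by move=> d; rewrite /W -bigU //; apply: eq_bigl => x; rewrite inE. Qed.

Lemma W_Ur A B C : [disjoint A & B] -> W C (A :|: B) = W C A + W C B.
Proof. by move=> d; rewrite W_sym W_Ul // !(W_sym C). Qed.

Lemma ex_U A B : [disjoint A & B] -> ex (A :|: B) = ex A + ex B + W A B.
Proof.
move=> d; rewrite /ex W_Ul // !W_Ur // (W_sym B A) cardsU.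
by rewrite (disjoint_setI0 d) cards0 subn0 natrD; field.
Qed.

Lemma W1 u H : W [set u] H = \sum_(y in nb H u) f u y.
Proof. by rewrite /W big_set1. Qed.

Lemma ex1 u : ex [set u] = -1.
Proof.
rewrite /ex W1 big_pred0 ?cards1; first by lra.
by move=> y; rewrite !inE; case: eqP => //= ->; rewrite adj_irrefl.
Qed.

Lemma ex_add u H : u \notin H ->
  ex (u |: H) = ex H + \sum_(y in nb H u) f u y - 1.
Proof.
move=> uH; rewrite ex_U ?disjoints1 // ex1 W1; lra.
Qed.

Hypothesis f1 : forall x y, adj x y -> 1 <= f x y.

Lemma W_ge0 A B : 0 <= W A B.
Proof.
apply: sumr_ge0 => x _; apply: sumr_ge0 => y; rewrite inE => /andP[_ xy].
exact: le_trans (f1 xy).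
Qed.

Lemma sum_nb_ge1 H u v : v \in H -> adj u v ->
  f u v <= \sum_(y in nb H u) f u y.
Proof.
move=> vH uv; rewrite (bigD1 v) ?inE ?vH //= lerDl.
apply: sumr_ge0 => y; rewrite inE => /andP[/andP[_ xy] _].
exact: le_trans (f1 xy).
Qed.

Lemma sum_nb_ge2 H u v w : v \in H -> w \in H -> v != w -> adj u v ->
  adj u w -> f u v + f u w <= \sum_(y in nb H u) f u y.
Proof.
move=> vH wH vw uv uw; rewrite (bigD1 v) ?inE ?vH //= lerD2l.
rewrite (bigD1 w) /= ?lerDl; last by rewrite inE wH uw eq_sym.
apply: sumr_ge0 => y; rewrite inE => /andP[/andP[/andP[_ xy] _] _].
exact: le_trans (f1 xy).
Qed.

Lemma ex_add1 u v H : u \notin H -> v \in H -> adj u v ->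
  ex H + (f u v - 1) <= ex (u |: H).
Proof.
move=> uH vH uv; rewrite ex_add //; have := sum_nb_ge1 vH uv; lra.
Qed.

Lemma ex_add2 u v w H : u \notin H -> v \in H -> w \in H -> v != w ->
  adj u v -> adj u w -> ex H + (f u v + f u w - 1) <= ex (u |: H).
Proof.
move=> uH vH wH vw uv uw; rewrite ex_add //; have := sum_nb_ge2 vH wH vw uv uw; lra.
Qed.

(** Each vertex absorbed by [grow] brings an edge of weight at least 1, which pays its charge of
    1. *)
Lemma ex_mono H A : conn H -> A \subset H -> A != set0 -> ex A <= ex H.
Proof.
move=> cH AH A0; apply: (grow (P := fun B => ex A <= ex B) cH AH A0 (lexx _)).
move=> B u w AB BH uH uB wB uw le; apply: le_trans le _.
have := ex_add1 uB wB uw; have := f1 uw; lra.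
Qed.

End Graph.

(** * Cycles and trees *)

Section Edges.
Variable G : sgraph.
Implicit Types (A B C D F H T X Z : {set G}) (u v w x y z : G) (c : seq G).

Let one : G -> G -> rat := fun _ _ => 1.
Let oneC x y : one x y = one y x. Proof. by []. Qed.
Let one1 x y : adj x y -> 1 <= one x y. Proof. by []. Qed.

Lemma W_one A B : W one A B = (cross A B)%:R.
Proof.
rewrite /W /cross natr_sum; apply: eq_bigr => x _.
by rewrite sumr_const.
Qed.

(** Edge counts are read off from [ex] with unit weights, and then carried back from the
    rationals. *)
Lemma e2_add u H : u \notin H -> e2 (u |: H) = (e2 H + (#|nb H u|).*2)%N.
Proof.
move=> uH; have := ex_add oneC uH.
rewrite /ex !W_one cardsU1 uH sumr_const natrD.
rewrite -[cross H H]/(e2 H) -[cross (u |: H) _]/(e2 (u |: H)) => h.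
apply/eqP; rewrite -(eqr_nat rat) natrD -muln2 natrM; apply/eqP.
by move: h; have -> : (true : nat)%:R = 1 :> rat by []; lra.
Qed.

Lemma e2_double H : e2 H = (en H).*2.
Proof.
have e0 : ~~ odd (e2 H).
  elim: {H}#|H| {-2}H (leqnn #|H|) => [|m IH] H hm.
    by move: hm; rewrite leqn0 cards_eq0 => /eqP ->; rewrite /e2 big_set0.
  case: (set_0Vmem H) => [->|[u uH]]; first by rewrite /e2 big_set0.
  rewrite -(setD1K uH) e2_add ?setD11 // oddD odd_double addbF.
  by apply: IH; move: hm; rewrite (cardsD1 u H) uH.
by rewrite /en -[LHS]odd_double_half (negbTE e0).
Qed.

Lemma exE H : ex one H = (en H)%:R - #|H|%:R.
Proof.
rewrite /ex W_one -[cross H H]/(e2 H) e2_double -muln2 natrM; congr (_ - _); lra.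
Qed.

Lemma en_U A B : [disjoint A & B] -> en (A :|: B) = (en A + en B + cross A B)%N.
Proof.
move=> d; have := ex_U oneC d; rewrite !exE W_one cardsU (disjoint_setI0 d).
rewrite cards0 subn0 natrD => h.
by apply/eqP; rewrite -(eqr_nat rat) !natrD; apply/eqP; move: h; lra.
Qed.

Lemma en_add u H : u \notin H -> en (u |: H) = (en H + #|nb H u|)%N.
Proof.
by move=> uH; apply: double_inj; rewrite doubleD -!e2_double e2_add.
Qed.

Lemma nbD1 H u : nb (H :\ u) u = nb H u.
Proof.
apply/setP => y; rewrite !inE; case: (eqVneq y u) => //= ->.
by rewrite adj_irrefl andbF.
Qed.

Lemma en_D1 u H : u \in H -> en H = (en (H :\ u) + #|nb H u|)%N.
Proof. by move=> uH; rewrite -{1}(setD1K uH) en_add ?setD11 // nbD1. Qed.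

Lemma en_mono H A : conn H -> A \subset H -> A != set0 ->
  (en A + #|H| <= en H + #|A|)%N.
Proof.
move=> cH AH A0; have := ex_mono oneC one1 cH AH A0; rewrite !exE => h.
by rewrite -(ler_nat rat) !natrD; move: h; lra.
Qed.

Lemma en1 u : en [set u] = 0%N.
Proof.
rewrite -[[set u]]setU0 en_add ?inE // [en set0]/en /e2 big_set0.
by rewrite (_ : nb _ _ = set0) ?cards0 //; apply/setP => y; rewrite !inE.
Qed.

Lemma conn_en H : conn H -> (#|H| <= (en H).+1)%N.
Proof.
move=> cH; have [/set0Pn[u uH] _] := cH.
have := @en_mono H [set u] cH; rewrite sub1set uH cards1 en1 => h.
rewrite -addn1; apply: h => //.
by apply/set0Pn; exists u; rewrite inE.
Qed.

Lemma cross_ge2r A B x y y' : x \in A -> y \in B -> adj x y ->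
  y' \in B -> adj x y' -> y != y' -> (1 < cross A B)%N.
Proof.
move=> xA yB xy yB' xy' yy; rewrite /cross (bigD1 x) //=.
have a : (1 < #|nb B x|)%N.
  apply: (@leq_trans #|[set y; y']|); first by rewrite cards2 yy.
  apply/subset_leq_card/subsetP => z; rewrite !inE.
  by case/orP => /eqP ->; rewrite ?yB ?yB'.
lia.
Qed.

Definition cyc c := [&& (2 < size c)%N, cycle (@adj G) c & uniq c].
Definition cset c : {set G} := [set x in c].

Lemma cycP c : reflect (ucycle (@adj G) c /\ (2 < size c)%N) (cyc c).
Proof.
apply: (iffP and3P) => [[h a b]|[/andP[a b] h]] //; split=> //.
by rewrite /ucycle a.
Qed.

Lemma in_cset c x : (x \in cset c) = (x \in c).
Proof. by rewrite /cset inE. Qed.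

Lemma card_cset c : cyc c -> #|cset c| = size c.
Proof. by case/and3P => _ _ u; rewrite cardsE; apply/card_uniqP. Qed.

Lemma cyc_rot i c : cyc (rot i c) = cyc c.
Proof. by rewrite /cyc size_rot rot_cycle rot_uniq. Qed.

Lemma cset_rot i c : cset (rot i c) = cset c.
Proof. by apply/setP => x; rewrite !inE mem_rot. Qed.

Lemma conn_path x (p : seq G) : path (@adj G) x p -> conn (cset (x :: p)).
Proof.
elim: p x => [|y p IH] x /=.
  move=> _; rewrite (_ : cset _ = [set x]); first exact: conn1.
  by apply/setP => z; rewrite !inE.
case/andP => xy /IH c.
rewrite (_ : cset _ = x |: cset (y :: p)).
  by apply: (conn_add c _ xy); rewrite !inE eqxx.
by apply/setP => z; rewrite !inE.
Qed.

Lemma cyc_split c u : cyc c -> u \in c -> exists a b (p : seq G),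
  [/\ path (@adj G) a p, uniq (u :: a :: p), cset c = u |: cset (a :: p),
      (0 < size p)%N & [/\ last a p = b, adj u a, adj u b, next c u = a & prev c u = b]].
Proof.
move=> cc uc; have [i q e] := rot_to uc.
have := cc; rewrite -(cyc_rot i) e => /and3P[].
have nx : next c u = next (u :: q) u by rewrite -e next_rot //; case/and3P: cc.
have px : prev c u = prev (u :: q) u by rewrite -e prev_rot //; case/and3P: cc.
case: q e nx px => [//|a p] e nx px sz /= /andP[ua pp] un.
rewrite rcons_path in pp; case/andP: pp => pp lu.
exists a, (last a p), p; split => //.
- rewrite -(cset_rot i c) e; apply/setP => z; by rewrite !inE.
split=> //; first by rewrite adjC.
  by rewrite nx /= eqxx.
have h q d : u \notin q -> prev_at u u d q = last d q.
  elim: q d => [|z q IH] d /=; first by rewrite eqxx.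
  by rewrite inE negb_or; case: eqP => //= _; apply: IH.
by rewrite px -[last a p]/(last u (a :: p)) -h //; case/and3P: un.
Qed.

Lemma cyc_next c u : cyc c -> u \in c ->
  [/\ next c u \in c, prev c u \in c, adj u (next c u), adj u (prev c u) &
      [/\ next c u != prev c u, next c u != u & prev c u != u]].
Proof.
move=> cc uc; have [a [b [p [_ un _ p0 [ba ua ub nx px]]]]] := cyc_split cc uc.
rewrite mem_next mem_prev nx px uc; split=> //.
case: p p0 un ba => [//|z p] _ /= /and3P[+ + _] <-.
have := mem_last z p; move: (last z p) => w wz.
rewrite !inE !negb_or => /and3P[ua' uz up] /andP[az ap].
split; last first.
- by apply: contraTneq wz => ->; rewrite inE negb_or uz.
- by rewrite eq_sym.
by apply: contraTneq wz => <-; rewrite inE negb_or az.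
Qed.

Lemma conn_cset c : cyc c -> conn (cset c).
Proof.
case: c => [|x p]; rewrite /cyc //= rcons_path.
by case/and3P => _ /andP[pp _] _; apply: conn_path.
Qed.

Lemma cyc_conn_D1 c u : cyc c -> u \in c -> conn (cset c :\ u).
Proof.
move=> cc uc; have [a [b [p [pp un e _ _]]]] := cyc_split cc uc.
rewrite e setU1K; first exact: conn_path.
by rewrite in_cset; case/andP: un.
Qed.

Lemma cyc_nb c u A : cyc c -> u \in c -> cset c \subset A ->
  (1 < #|nb A u|)%N.
Proof.
move=> cc uc cA; have [nc pc an ap [np _ _]] := cyc_next cc uc.
apply: (@leq_trans #|[set next c u; prev c u]|); first by rewrite cards2 np.
apply/subset_leq_card/subsetP => z; rewrite !inE.
by case/orP => /eqP ->; rewrite (subsetP cA) ?in_cset.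
Qed.

Lemma cset_en c : cyc c -> (#|cset c| <= en (cset c))%N.
Proof.
move=> cc; rewrite -leq_double -e2_double /e2 -muln2 -sum_nat_const.
by apply: leq_sum => u; rewrite in_cset => uc; apply: (cyc_nb cc uc).
Qed.

Lemma cset0 c : cyc c -> cset c != set0.
Proof. by move=> cc; rewrite -card_gt0 card_cset //; case/and3P: cc => h _ _; apply: ltn_trans h. Qed.

(** The path is extended at its head [x] until all neighbours of [x] in A lie on it; one of them
    other than the second vertex then closes a cycle. [m] measures the room left in A. *)
Lemma cycle_exists_path A x (p : seq G) : (forall u, u \in A -> (1 < #|nb A u|)%N) ->
  path (@adj G) x p -> uniq (x :: p) -> {subset x :: p <= A} ->
  exists2 c, cyc c & cset c \subset A.
Proof.
move=> dA; have : (#|A| <= size p + #|A|)%N by rewrite leq_addl.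
move: {2}#|A| => m; elim: m x p => [|m IH] x p hm pp un sA.
  have : (size (x :: p) <= #|A|)%N.
    by rewrite -(card_uniqP un); apply: subset_leq_card; apply/subsetP.
  by move=> /=; lia.
case: (boolP (nb A x \subset x :: p)) => [sub|/subsetPn[y]]; last first.
  rewrite inE => /andP[yA xy] yp; apply: (IH y (x :: p)) => //=.
  - by rewrite addSn -addnS.
  - by rewrite adjC xy.
  - by rewrite yp.
  by move=> z; rewrite inE => /orP[/eqP ->|/sA].
have [y yN yh] : exists2 y, y \in nb A x & y != head x p.
  have := dA x (sA x (mem_head _ _)); case/card_gt1P => y [z [yN zN yz]].
  case: (eqVneq y (head x p)) => [e|]; last by exists y.
  by exists z => //; rewrite -e eq_sym.
have := yN; rewrite inE => /andP[yA xy].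
have yp : y \in p.
  by have := subsetP sub y yN; rewrite inE eq_sym (negbTE (adj_neq xy)).
(* The piece of the path from [x] to [y] is the cycle; as [y] is not the second vertex, it has at
   least three vertices. *)
case/splitPr: p / yp pp un sA yh {hm sub} => p1 p2 pp un sA yh.
have p10 : (0 < size p1)%N by case: p1 yh {pp un sA} => //=; rewrite eqxx.
exists (x :: rcons p1 y); last first.
  apply/subsetP => z; rewrite in_cset => zp; apply: sA; move: zp.
  rewrite !inE mem_rcons mem_cat !inE.
  by case/or3P => ->; rewrite ?orbT.
apply/and3P; split.
- by rewrite /= size_rcons !ltnS.
- rewrite /= rcons_path last_rcons adjC xy andbT.
  by move: pp; rewrite -cat_rcons cat_path => /andP[].
by move: un; rewrite -cat_rcons -cat_cons cat_uniq => /andP[].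
Qed.

(** Dropping a vertex with at most one neighbour preserves the inequality; once no such vertex is
    left, a maximal path closes up. *)
Lemma en_cycle A : A != set0 -> (#|A| <= en A)%N ->
  exists2 c, cyc c & cset c \subset A.
Proof.
elim: {A}#|A| {-2}A (leqnn #|A|) => [|m IH] A hm A0 eA.
  by move: A0; rewrite -card_gt0; lia.
case: (boolP [forall u in A, (1 < #|nb A u|)%N]) => [/forall_inP h|].
  have [x xA] := set0Pn _ A0.
  by apply: (@cycle_exists_path A x [::]) => // z; rewrite inE => /eqP ->.
rewrite negb_forall_in => /exists_inP[u uA]; rewrite -leqNgt => hu.
have cA := cardsD1 u A; rewrite uA in cA.
have eD := en_D1 uA.
have [|||c cc cs] := IH (A :\ u).
- lia.
- apply: contraTneq eA => A1; rewrite (_ : A = [set u]) ?en1 ?cards1 //.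
  by rewrite -(setD1K uA) A1 setU0.
- lia.
by exists c => //; apply: subset_trans cs _; apply: subD1set.
Qed.

(** Trees by their edge count, so that later arguments only add numbers; [tree_del] relates this to
    the absence of cycles. *)
Definition tset F := conn F /\ (en F).+1 = #|F|.

Lemma conn_nontree H : conn H -> ~ tset H -> (#|H| <= en H)%N.
Proof.
move=> cH nt; have := conn_en cH; rewrite leq_eqVlt => /orP[/eqP e|//].
by case: nt.
Qed.

Lemma tset_acyclic F c : tset F -> cyc c -> ~ (cset c \subset F).
Proof.
move=> [cF eF] cc cs; have := en_mono cF cs (cset0 cc); have := cset_en cc; lia.
Qed.

End Edges.

(** * The connected graphs and trees of the statement as vertex sets *)

Section Transfer.
Variable G : sgraph.
Implicit Types (X F : {set G}).

Lemma connected_conn : connected G <-> conn [set: G].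
Proof.
split=> [[c0 cG]|[n0 cG]].
  split; first by rewrite -card_gt0 cardsT.
  move=> A _ /set0Pn[a aA] clA; apply/setP => y; rewrite inE.
  apply: (connect_inv (A := mem A) (cG a y)) => // p q pA pq.
  by apply: clA pq => //; rewrite inE.
split; first by rewrite -cardsT card_gt0.
move=> x y; have : [set z | connect (@adj G) x z] = [set: G].
  apply: cG; first exact: subsetT.
    by apply/set0Pn; exists x; rewrite inE connect0.
  move=> p q; rewrite !inE => xp _ pq; apply: connect_trans xp _.
  exact: connect1.
by move/setP/(_ y); rewrite !inE.
Qed.

End Transfer.

Section Transfer.
Variable G : sgraph.
Implicit Types (X F : {set G}).

Lemma connected_del X : connected (del_vertices X) <-> conn (~: X).
Proof.
rewrite connected_conn; split=> [[n0 h]|[n0 h]].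
  split.
    have [t _] := set0Pn _ n0; apply/set0Pn; exists (val t).
    by rewrite inE (valP t).
  move=> A AF /set0Pn[a aA] clA; apply/eqP; rewrite eqEsubset AF /=.
  have e : [set t : del_vertices X | val t \in A] = [set: del_vertices X].
    apply: h; first exact: subsetT.
      have aX : a \notin X by have := subsetP AF a aA; rewrite inE.
      by apply/set0Pn; exists (Sub a aX : del_vertices X); rewrite inE.
    move=> p q; rewrite !inE => pA _ pq; apply: (clA (val p)) => //.
    by rewrite inE (valP q).
  apply/subsetP => y; rewrite inE => yX.
  by move/setP/(_ (Sub y yX : del_vertices X)): e; rewrite !inE.
split.
  have [x] := set0Pn _ n0; rewrite inE => xX.
  by apply/set0Pn; exists (Sub x xX : del_vertices X).
move=> A _ /set0Pn[a aA] clA; apply/setP => t; rewrite inE.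
have e : [set val a | a in A] = ~: X.
  apply: h.
  - by apply/subsetP => _ /imsetP[b _ ->]; rewrite inE (valP b).
  - by apply/set0Pn; exists (val a); apply: imset_f.
  move=> _ q /imsetP[b bA ->]; rewrite inE => qX bq.
  apply/imsetP; exists (Sub q qX : del_vertices X); rewrite ?SubK //.
  by apply: (clA b); rewrite ?inE // /adj /= SubK.
move/setP/(_ (val t)): e; rewrite inE (valP t) => /imsetP[b bA /val_inj ->].
by [].
Qed.

Lemma cyc_del X (c : seq (del_vertices X)) : cyc [seq val x | x <- c] = cyc c.
Proof.
rewrite /cyc size_map (map_inj_uniq val_inj); congr (_ && (_ && _)).
case: c => [//|x p] /=; rewrite -map_rcons path_map.
by apply: eq_path.
Qed.

Lemma lift_del X (c : seq G) : {subset c <= ~: X} ->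
  exists c' : seq (del_vertices X), c = [seq val x | x <- c'].
Proof.
elim: c => [|x c IH] h; first by exists [::].
have [|c' e] := IH; first by move=> z zc; apply: h; rewrite inE zc orbT.
have xX : x \notin X by have := h x (mem_head _ _); rewrite inE.
by exists ((Sub x xX : del_vertices X) :: c'); rewrite /= e.
Qed.

Lemma tree_del X : tree (del_vertices X) <-> tset (~: X).
Proof.
rewrite /tree /tset connected_del; split=> [[cF ac]|[cF eF]]; split=> //.
  apply/eqP; rewrite eqn_leq conn_en // andbT ltnNge; apply/negP => le.
  have [c cc cs] := en_cycle (proj1 cF) le.
  have [|c' e] := @lift_del X c.
    by move=> z zc; apply: (subsetP cs); rewrite in_cset.
  move: cc; rewrite e cyc_del => /cycP[/ac].
  by rewrite ltnNge => /negP.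
move=> c uc; rewrite ltnNge; apply/negP => sz.
have cc : cyc [seq val x | x <- c] by rewrite cyc_del; apply/cycP.
apply: (tset_acyclic (conj cF eF) cc).
by apply/subsetP => z; rewrite in_cset => /mapP[t _ ->]; rewrite inE (valP t).
Qed.

End Transfer.

(** * Light vertices and branches at a cycle *)

Section Conn.
Variable G : sgraph.
Implicit Types (A B C D F H K T X Z : {set G}) (u v w x y z : G) (c : seq G).

Definition connb H : bool :=
  (H != set0) && [forall x in H, forall y in H, connect (radj H) x y].

Lemma connP H : reflect (conn H) (connb H).
Proof.
apply: (iffP andP) => [[h0 h]|cH].
  have [x xH] := set0Pn _ h0; rewrite (_ : H = gcomp H x); last first.
    apply/eqP; rewrite eqEsubset gcomp_sub // andbT; apply/subsetP => y yH.
    have /forall_inP h' := forall_inP h x xH.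
  by rewrite inE; apply: h'.
  by apply: conn_gcomp.
split; first by case: cH.
apply/forall_inP => x xH; apply/forall_inP => y yH.
by have /subsetP/(_ y yH) := conn_sub_gcomp cH (subxx H) xH; rewrite inE.
Qed.

(** A closed part of H minus u either misses Z, and is then closed in H although it omits u, or
    contains Z, and then becomes closed in H once u is added. *)
Lemma conn_del H Z u : conn H -> u \in H -> conn Z -> Z \subset H :\ u ->
  nb H u \subset Z -> conn (H :\ u).
Proof.
move=> cH uH cZ ZH nZ; split.
  have [/set0Pn[z zZ] _] := cZ; apply/set0Pn; exists z; exact: (subsetP ZH).
move=> A AH /set0Pn[a aA] clA.
have AH' : A \subset H by apply: subset_trans AH (subD1set _ _).
have uA : u \notin A.
  by apply/negP => /(subsetP AH); rewrite !inE eqxx.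
case: (boolP [disjoint A & Z]) => [d|].
  have [_ h] := cH; suff e : A = H by rewrite e uH in uA.
  apply: h => //; first by apply/set0Pn; exists a.
  move=> p q pA qH pq; apply: (clA p) => //; rewrite !inE qH andbT.
  apply: contraTneq pq => ->; apply/negP => pu.
  have pZ : p \in Z by rewrite (subsetP nZ) // inE (subsetP AH') // adjC.
  by move: d; rewrite disjoint_subset => /subsetP/(_ p pA); rewrite inE pZ.
case/pred0Pn => b /andP[/= bA bZ].
have ZA : Z \subset A.
  have [_ h] := cZ; rewrite (_ : Z = Z :&: A) ?subsetIr //; apply/esym/h.
  - exact: subsetIl.
  - by apply/set0Pn; exists b; rewrite inE bZ.
  move=> p q; rewrite !inE => /andP[pZ pA] qZ pq; rewrite qZ /=.
  by apply: (clA p) => //; apply: (subsetP ZH).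
have [_ h] := cH.
have e : u |: A = H.
  apply: h.
  - by rewrite subUset sub1set uH.
  - by apply/set0Pn; exists u; rewrite !inE eqxx.
  move=> p q pA qH pq; rewrite !inE; case: (eqVneq q u) => //= qu.
  move: pA; rewrite !inE => /orP[/eqP e|pA].
    by rewrite e in pq; apply/(subsetP ZA)/(subsetP nZ); rewrite inE qH.
  by apply: (clA p); rewrite // !inE qu.
by rewrite -e setU1K.
Qed.

Lemma conn_del_pendant H u z : conn H -> u \in H -> z \in H -> z != u ->
  nb H z \subset [set u] -> conn (H :\ z).
Proof.
move=> cH uH zH zu nz; apply: (conn_del cH zH (conn1 u)) => //.
by rewrite sub1set !inE eq_sym zu.
Qed.

(* A vertex is light in H if it has two neighbours in H and its removal leaves
   H connected; it then contributes at least 15, and its removal lowers the apex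
   number by at most one. *)
Definition heavy H := forall y, y \in H -> (1 < #|nb H y|)%N -> ~ conn (H :\ y).

Lemma heavy_or_light H : heavy H \/
  exists y, [/\ y \in H, (1 < #|nb H y|)%N & conn (H :\ y)].
Proof.
case: (boolP [exists y in H, (1 < #|nb H y|)%N && connb (H :\ y)]).
  by case/exists_inP => y yH /andP[h1 /connP h2]; right; exists y.
rewrite negb_exists_in => /forall_inP h; left=> y yH h1 /connP h2.
by have := h y yH; rewrite h1 h2.
Qed.

(** Otherwise [conn_del] would make u light. The neighbours found in this way, with suitable choices
    of Z, are the further branches on which all bounds for heavy sets rest. *)
Lemma heavy_private H Z u : conn H -> heavy H -> u \in H ->
  (1 < #|nb H u|)%N -> conn Z -> Z \subset H :\ u ->
  exists z, [/\ z \in H, z \notin Z, adj u z & z != u].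
Proof.
move=> cH hH uH nu cZ ZH.
case: (boolP (nb H u \subset Z)) => [nZ|].
  by case: (hH u uH nu); apply: conn_del nZ.
case/subsetPn => z; rewrite inE => /andP[zH uz] zZ; exists z; split=> //.
by rewrite eq_sym adj_neq.
Qed.

(** The bound on the apex number in terms of the tree that is kept instead of the set that is
    deleted; in this form it passes to subsets, with k lowered by the number of vertices lost. *)
Definition apexk k H := forall F, F \subset H -> tset F -> (#|F| + k <= #|H|)%N.

Lemma apexk_nontree k H : (0 < k)%N -> conn H -> apexk k H -> (#|H| <= en H)%N.
Proof.
move=> k0 cH aH; apply: conn_nontree => // tH.
by have := aH H (subxx _) tH; lia.
Qed.

(* The part of H hanging at v, for v on the cycle c, and its complement. *)
Definition hcomp H c v : {set G} := gcomp (H :\ v) (next c v).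
Definition branch H c v : {set G} := H :\: hcomp H c v.

Section Branch.
Variables (H : {set G}) (c : seq G).
Hypotheses (cH : conn H) (cc : cyc c) (cs : cset c \subset H).

Lemma cyc_in u : u \in c -> u \in H.
Proof. by move=> uc; rewrite (subsetP cs) // in_cset. Qed.

Lemma next_D1 v : v \in c -> next c v \in H :\ v.
Proof.
move=> vc; have [nc _ _ _ [_ nv _]] := cyc_next cc vc.
by rewrite !inE nv cyc_in.
Qed.

Lemma hcomp_sub v : v \in c -> hcomp H c v \subset H :\ v.
Proof. by move=> vc; apply: gcomp_sub (next_D1 vc). Qed.

Lemma conn_hcomp v : v \in c -> conn (hcomp H c v).
Proof. by move=> vc; apply: conn_gcomp (next_D1 vc). Qed.

Lemma cyc_hcomp v : v \in c -> cset c :\ v \subset hcomp H c v.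
Proof.
move=> vc; apply: conn_sub_gcomp.
- exact: cyc_conn_D1.
- exact: setSD.
have [nc _ _ _ [_ nv _]] := cyc_next cc vc.
by rewrite in_setD1 nv in_cset.
Qed.

Lemma branch_sub v : branch H c v \subset H.
Proof. exact: subsetDl. Qed.

Lemma branch_self v : v \in c -> v \in branch H c v.
Proof.
move=> vc; rewrite in_setD cyc_in // andbT; apply/negP => /(subsetP (hcomp_sub vc)).
by rewrite !inE eqxx.
Qed.

Lemma branch_closed v x y : v \in c -> x \in branch H c v -> x != v ->
  y \in H -> adj x y -> y \in branch H c v.
Proof.
move=> vc; rewrite !in_setD => /andP[xC xH] xv yH xy; rewrite yH andbT.
apply: contra xC => yC; apply: (gcomp_closed (next_D1 vc) yC).
  by rewrite in_setD1 xv.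
by rewrite adjC.
Qed.

Lemma hcomp_closed v x y : v \in c -> x \in hcomp H c v ->
  y \in H -> y != v -> adj x y -> y \in hcomp H c v.
Proof.
move=> vc xC yH yv xy; apply: (gcomp_closed (next_D1 vc) xC) => //.
by rewrite in_setD1 yv.
Qed.

(** Edges leave the branch only at v. Hence a closed part without v is closed in H, and for a closed
    part containing v the rest of the branch is closed in H; both contradict connectedness of H. *)
Lemma conn_branch v : v \in c -> conn (branch H c v).
Proof.
move=> vc; split; first by apply/set0Pn; exists v; apply: branch_self.
move=> A AT /set0Pn[a aA] clA; have AH := subset_trans AT (branch_sub v).
case: (boolP (v \in A)) => vA; last first.
  have [_ h] := cH; have e : A = H.
    apply: h => //; first by apply/set0Pn; exists a.
    move=> p q pA qH pq; apply: (clA p) => //.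
    apply: (branch_closed vc _ _ qH pq); first exact: (subsetP AT).
    by apply: contraNneq vA => <-.
  by rewrite e (cyc_in vc) in vA.
apply/eqP; rewrite eqEsubset AT /= -setD_eq0; apply/negPn/negP => n0.
have [_ h] := cH.
have e : branch H c v :\: A = H.
  apply: h => //; first by rewrite subDset (subset_trans (branch_sub v)) ?subsetUr.
  move=> p q; rewrite in_setD => /andP[pA pT] qH pq; rewrite in_setD.
  have pv : p != v by apply: contraNneq pA => ->.
  have qT := branch_closed vc pT pv qH pq; rewrite qT andbT.
  by apply: contra pA => qA; apply: (clA q) => //; rewrite adjC.
by have := cyc_in vc; rewrite -e in_setD vA.
Qed.

(** The branch at v is connected, contains v and avoids u, so it lies in the component of H minus u
    that contains the rest of the cycle. *)
Lemma branch_disj u v : u \in c -> v \in c -> u != v ->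
  [disjoint branch H c u & branch H c v].
Proof.
move=> uc vc uv.
have uT : u \notin branch H c v.
  rewrite in_setD negb_and negbK; apply/orP; left.
  by apply: (subsetP (cyc_hcomp vc)); rewrite in_setD1 uv in_cset.
have sub : branch H c v \subset hcomp H c u.
  have vC : v \in hcomp H c u.
    by apply: (subsetP (cyc_hcomp uc)); rewrite in_setD1 eq_sym uv in_cset.
  rewrite /hcomp -(gcomp_eq vC); apply: conn_sub_gcomp.
  - exact: conn_branch.
  - apply/subsetP => x xT; rewrite !inE (subsetP (branch_sub v)) // andbT.
    by apply: contraNneq uT => <-.
  exact: branch_self.
rewrite disjoint_sym disjoint_subset; apply/subsetP => x /(subsetP sub) xC.
by rewrite inE in_setD xC.
Qed.

Lemma cross_branch v : v \in c ->
  (1 < cross (branch H c v) (hcomp H c v))%N.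
Proof.
move=> vc; have [nc pc an ap [np nv pv]] := cyc_next cc vc.
have s := subsetP (cyc_hcomp vc).
apply: (cross_ge2r (branch_self vc) _ an _ ap np).
  by apply: s; rewrite in_setD1 nv in_cset.
by apply: s; rewrite in_setD1 pv in_cset.
Qed.

Lemma branch_U v : v \in c -> branch H c v :|: hcomp H c v = H.
Proof.
move=> vc; apply/setP => x; rewrite in_setU in_setD.
case: (boolP (x \in hcomp H c v)) => [/(subsetP (hcomp_sub vc))|_] //=.
  by rewrite !inE => /andP[_ ->].
by rewrite orbF.
Qed.

Lemma branch_hcomp_disj v : [disjoint branch H c v & hcomp H c v].
Proof.
by rewrite disjoint_subset; apply/subsetP => x; rewrite in_setD => /andP[].
Qed.

Lemma card_branch_hcomp v : v \in c ->
  (#|branch H c v| + #|hcomp H c v|)%N = #|H|.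
Proof.
move=> vc; rewrite -{3}(branch_U vc) cardsU.
by rewrite (disjoint_setI0 (branch_hcomp_disj v)) cards0 subn0.
Qed.

(** At least two edges join the two sides, and each side has at least its number of vertices minus
    one; a total of [#|H|] edges forces equality everywhere. *)
Lemma uni_trees v : v \in c -> en H = #|H| ->
  tset (hcomp H c v) /\ tset (branch H c v).
Proof.
move=> vc e; have := en_U (branch_hcomp_disj v).
rewrite branch_U // e -(card_branch_hcomp vc).
have := cross_branch vc; have := conn_en (conn_branch vc).
have := conn_en (conn_hcomp vc).
by split; (split; [by [apply: conn_hcomp|apply: conn_branch]|lia]).
Qed.

(** [hcomp H c v] is an induced tree that misses exactly the branch. *)
Lemma uni_branch_card k v : v \in c -> en H = #|H| -> apexk k H ->
  (k <= #|branch H c v|)%N.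
Proof.
move=> vc e aH; have [tC _] := uni_trees vc e.
have := aH _ (subset_trans (hcomp_sub vc) (subD1set _ _)) tC.
by rewrite -(card_branch_hcomp vc); lia.
Qed.

End Branch.
End Conn.

(** * Excess of a vertex set *)

(* By supermodularity of fw, fw a b >= psi a + psi b for a, b >= 3, with equality
   if a = 3 or b = 3. Hence a vertex of degree d on a cycle accounts for
   fw 3 3 + delta d. *)
HB.lock Definition psi d : rat := fw 3 d - fw 3 3 / 2.
HB.lock Definition delta d : rat := 2 * (fw 3 d - fw 3 3).

Lemma psiE d : psi d = fw 3 d - fw 3 3 / 2.
Proof. by rewrite psi.unlock. Qed.

Lemma deltaE d : delta d = 2 * (fw 3 d - fw 3 3).
Proof. by rewrite delta.unlock. Qed.

(* The degrees are those of G, also inside an induced subgraph; charging 1 to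
   each vertex makes exf monotone, and AZI G = #|G| + exf [set: G]. *)
Definition ff (G : sgraph) (x y : G) : rat := fw (deg x) (deg y).
HB.lock Definition exf (G : sgraph) (H : {set G}) : rat := ex (@ff G) H.
(* The contribution of a tree T attached at the vertex v of a cycle. *)
HB.lock Definition kap (G : sgraph) (T : {set G}) (v : G) : rat :=
  exf T + 1 + delta (deg v).

Lemma exfE (G : sgraph) (H : {set G}) : exf H = ex (@ff G) H.
Proof. by rewrite exf.unlock. Qed.

Lemma kapE (G : sgraph) (T : {set G}) (v : G) :
  kap T v = exf T + 1 + delta (deg v).
Proof. by rewrite kap.unlock. Qed.

Lemma fw_psi a b : (3 <= a)%N -> (3 <= b)%N -> psi a + psi b <= fw a b.
Proof. by move=> a3 b3; have := fw_super a3 b3; rewrite !psiE (fwC a 3); lra. Qed.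

Lemma fw3_mono a b : (2 <= a <= b)%N -> fw 3 a <= fw 3 b.
Proof. by move=> h; apply: fw_mono. Qed.

Lemma psi_mono a b : (2 <= a <= b)%N -> psi a <= psi b.
Proof. by move=> h; rewrite !psiE lerB // fw3_mono. Qed.

Lemma delta_mono a b : (2 <= a <= b)%N -> delta a <= delta b.
Proof. by move=> h; have := fw3_mono h; rewrite !deltaE; lra. Qed.

Lemma delta3 : delta 3 = 0.
Proof. by rewrite !deltaE subrr mulr0. Qed.

Lemma delta_ge0 d : (3 <= d)%N -> 0 <= delta d.
Proof. by move=> h; rewrite -delta3; apply: delta_mono. Qed.

Section Weight.
Variable G : sgraph.
Implicit Types (A B C D F H K T X Z : {set G}) (u v w x y z : G) (c : seq G).
Hypotheses (cG : conn [set: G]) (G3 : (2 < #|G|)%N).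

Lemma ffC x y : ff x y = ff y x.
Proof. exact: fwC. Qed.

Lemma adj_deg x y : adj x y -> (0 < deg x)%N.
Proof. by move=> xy; rewrite card_gt0; apply/set0Pn; exists y; rewrite inE. Qed.

Lemma deg1_nb x y z : deg x = 1%N -> adj x y -> adj x z -> y = z.
Proof.
move=> d1 xy xz; apply/eqP; apply: contraT => yz.
have : (#|[set y; z]| <= deg x)%N.
  by apply/subset_leq_card/subsetP => t; rewrite !inE => /orP[] /eqP ->.
by rewrite cards2 yz d1.
Qed.

Lemma adj_deg2 x y : adj x y -> (2 < deg x + deg y)%N.
Proof.
move=> xy; have := adj_deg xy; have : (0 < deg y)%N by apply: (@adj_deg y x); rewrite adjC.
move=> dy dx; rewrite ltnNge; apply/negP => le.
have dx1 : deg x = 1%N by lia.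
have dy1 : deg y = 1%N by lia.
have [_ h] := cG; have e : [set x; y] = [set: G].
  apply: h; first exact: subsetT.
    by apply/set0Pn; exists x; rewrite !inE eqxx.
  move=> p q; rewrite !inE => /orP[]/eqP -> _ pq.
    by rewrite (deg1_nb dx1 pq xy) eqxx orbT.
  by rewrite adjC in xy; rewrite (deg1_nb dy1 pq xy) eqxx.
move: G3; rewrite -cardsT -e cards2; by case: (_ != _).
Qed.

Lemma ff1 x y : adj x y -> 1 <= ff x y.
Proof.
move=> xy; apply: fw_ge1; rewrite ?(adj_deg xy) ?(adj_deg2 xy) //.
by rewrite adjC in xy; apply: adj_deg xy.
Qed.

Lemma ff8 x y : (1 < deg x)%N -> (1 < deg y)%N -> 8 <= ff x y.
Proof. exact: fw_ge8. Qed.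

Lemma exf_mono H A : conn H -> A \subset H -> A != set0 -> exf A <= exf H.
Proof. by rewrite !exfE; apply: (ex_mono ffC ff1). Qed.

Lemma exf_add1 u v H : u \notin H -> v \in H -> adj u v ->
  exf H + (ff u v - 1) <= exf (u |: H).
Proof. by rewrite !exfE; apply: (ex_add1 ffC ff1). Qed.

Lemma exf_add2 u v w H : u \notin H -> v \in H -> w \in H -> v != w ->
  adj u v -> adj u w -> exf H + (ff u v + ff u w - 1) <= exf (u |: H).
Proof. by rewrite !exfE; apply: (ex_add2 ffC ff1). Qed.

Lemma exf1 u : exf [set u] = -1.
Proof. by rewrite exfE ex1. Qed.

Lemma deg_ge2 x y z : adj x y -> adj x z -> y != z -> (1 < deg x)%N.
Proof.
move=> xy xz yz; have := nb_leq_deg [set y; z] x.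
suff -> : nb [set y; z] x = [set y; z] by rewrite cards2 yz.
by apply/setP => t; rewrite !inE; case: eqP => [->|_]; rewrite ?xy //=; case: eqP => [->|].
Qed.

Lemma deg_ge2_nb A x : (1 < #|nb A x|)%N -> (1 < deg x)%N.
Proof. by move=> h; apply: leq_trans (nb_leq_deg A x). Qed.

Lemma light_exf H y : conn H -> y \in H -> (1 < #|nb H y|)%N ->
  conn (H :\ y) -> exf (H :\ y) + 15 <= exf H.
Proof.
move=> cH yH ny cHy; have := ny; rewrite -nbD1.
case/card_gt1P => p [q [pN qN pq]].
move: pN qN; rewrite !in_nb => /andP[pH yp] /andP[qH yq].
have dy : (1 < deg y)%N by apply: deg_ge2_nb ny.
have h1 : (1 < #|H :\ y|)%N by apply/card_gt1P; exists p, q.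
(* A neighbour of y keeps a neighbour in the connected set H minus y, so its degree is at least 2
   and its edge to y weighs at least 8. *)
have dn t : t \in H :\ y -> adj y t -> (1 < deg t)%N.
  move=> tH yt; have [s sH ts] := conn_nb cHy h1 tH.
  apply: (@deg_ge2 t s y ts); first by rewrite adjC.
  by apply: contraTneq sH => ->; rewrite !inE eqxx.
have := exf_add2 (negbT (setD11 y H)) pH qH pq yp yq.
rewrite setD1K //.
by have := ff8 dy (dn p pH yp); have := ff8 dy (dn q qH yq); lra.
Qed.

(** * The excess in terms of the branches at a cycle *)

Section Assembly.
Variables (H : {set G}) (c : seq G).
Hypotheses (cH : conn H) (cc : cyc c) (cs : cset c \subset H).
(** On the right every cycle edge occurs twice, and by [fw_psi] each occurrence gives [psi] to both
    ends; every vertex lies on two cycle edges, hence the factor 4. *)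
Lemma cyc_psi (d3 : forall v, v \in c -> (2 < deg v)%N) :
  4 * \sum_(v in cset c) psi (deg v) <=
  \sum_(v in cset c) (ff v (next c v) + ff v (prev c v)).
Proof.
have uc : uniq c by case/and3P: cc.
have re (f : G -> rat) :
    \sum_(v in cset c) f (next c v) = \sum_(v in cset c) f v.
  rewrite [RHS](reindex_inj (can_inj (prev_next uc))) /=.
  by apply: eq_bigl => v; rewrite !in_cset mem_next.
have e : \sum_(v in cset c) ff v (prev c v) = \sum_(v in cset c) ff v (next c v).
  rewrite -(re (fun v => ff v (prev c v))); apply: eq_bigr => v _.
  by rewrite (prev_next uc) ffC.
have sp (f g : G -> rat) : \sum_(v in cset c) (f v + g v) =
  \sum_(v in cset c) f v + \sum_(v in cset c) g v by rewrite big_split.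
rewrite (sp (fun v => ff v (next c v))) e.
have h : \sum_(v in cset c) (psi (deg v) + psi (deg (next c v))) <=
    \sum_(v in cset c) ff v (next c v).
  apply: ler_sum => v; rewrite in_cset => vc; apply: fw_psi; apply: d3 => //.
  by rewrite mem_next.
move: h; rewrite (sp (fun v => psi (deg v))) (re (fun v => psi (deg v))); lra.
Qed.

(** The branches are disjoint and monotonicity discards what lies outside them. A cycle edge is met
    from both of its ends, hence the halves. *)
Lemma branch_sum :
  \sum_(v in cset c) (exf (branch H c v) + (ff v (next c v) + ff v (prev c v)) / 2)
    <= exf H.
Proof.
(* Extended by the empty set off the cycle, the branches form a disjoint family over all
   vertices. *)
pose F v := if v \in c then branch H c v else set0.
pose U := \bigcup_v F v.
have FU v : v \in c -> branch H c v \subset U.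
  by move=> vc; apply: (bigcup_max v) => //; rewrite /F vc.
have UH : U \subset H.
  apply/bigcupsP => v _; rewrite /F; case: ifP => _; last exact: sub0set.
  exact: branch_sub.
have dF u v : u != v -> [disjoint F u & F v].
  move=> uv; rewrite /F; case: ifP => uc; last by rewrite disjoints_subset sub0set.
  case: ifP => vc; first exact: (branch_disj cH cc cs).
  by rewrite disjoint_sym disjoints_subset sub0set.
have U0 : U != set0.
  have [v vc] := set0Pn _ (cset0 cc); rewrite in_cset in vc.
  apply/set0Pn; exists v; apply: (subsetP (FU v vc)).
  exact: (branch_self cc cs).
apply: le_trans (exf_mono cH UH U0).
have toc (f : G -> {set G} -> rat) : (forall v, f v set0 = 0) ->
    \sum_v f v (F v) = \sum_(v in cset c) f v (branch H c v).
  move=> f0; rewrite [RHS]big_mkcond; apply: eq_bigr => v _.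
  by rewrite in_cset /F; case: ifP.
have cU : #|U|%:R = \sum_(v in cset c) #|branch H c v|%:R :> rat.
  rewrite -(toc (fun _ B => #|B|%:R)); last by move=> _; rewrite cards0.
  rewrite -sum1_card (partition_disjoint_bigcup _ _ dF) natr_sum.
  by apply: eq_bigr => v _; rewrite sum1_card.
have wU : \sum_(v in cset c) (W (@ff G) (branch H c v) (branch H c v) +
      (ff v (next c v) + ff v (prev c v))) <= W (@ff G) U U.
  have -> : W (@ff G) U U = \sum_v \sum_(x in F v) \sum_(y in nb U x) ff x y.
    exact: (partition_disjoint_bigcup _ _ dF).
  rewrite (toc (fun _ B => \sum_(x in B) \sum_(y in nb U x) ff x y)); last first.
    by move=> _; rewrite big_set0.
  apply: ler_sum => v; rewrite in_cset => vc.
  have vB := branch_self cc cs vc; have BU := FU v vc.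
  have nI x : nb U x :&: branch H c v = nb (branch H c v) x.
    apply/setP => y; rewrite in_setI !in_nb.
    by case: (boolP (y \in branch H c v)) => [/(subsetP BU) ->|]; rewrite ?andbT ?andbF.
  have ho : \sum_(x in branch H c v | x != v) \sum_(y in nb (branch H c v) x) ff x y
      <= \sum_(x in branch H c v | x != v) \sum_(y in nb U x) ff x y.
    apply: ler_sum => x _; rewrite [leRHS](big_setID (branch H c v)) /= nI.
    rewrite lerDl; apply: sumr_ge0 => y; rewrite in_setD in_nb => /and3P[_ _ xy].
    by apply: le_trans (ff1 xy).
  have hv : \sum_(y in nb (branch H c v) v) ff v y + (ff v (next c v) + ff v (prev c v))
      <= \sum_(y in nb U v) ff v y.
    rewrite [leRHS](big_setID (branch H c v)) /= nI lerD2l.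
    have [nc pc an ap [np nv pv]] := cyc_next cc vc.
    have nin u : u \in c -> u != v -> adj v u -> u \in nb U v :\: branch H c v.
      move=> uc uv vu; rewrite in_setD in_nb vu andbT.
      rewrite (subsetP (FU u uc)) ?(branch_self cc cs) // andbT.
      have := branch_disj cH cc cs uc vc uv; rewrite disjoint_subset.
      by move/subsetP/(_ u (branch_self cc cs uc)).
    rewrite (bigD1 _ (nin _ nc nv an)) /= lerD2l.
    have pN : (prev c v \in nb U v :\: branch H c v) && (prev c v != next c v).
      by rewrite (nin _ pc pv ap) eq_sym.
    rewrite (bigD1 (prev c v) pN) /= lerDl; apply: sumr_ge0 => y.
    case/andP => /andP[yN _] _.
    have : y \in nb U v :\: branch H c v by [].
    by rewrite in_setD in_nb => /and3P[_ _ xy]; apply: le_trans (ff1 xy).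
  rewrite {1}/W !(bigD1 v vB) /=; lra.
rewrite (eq_bigr (fun v => (W (@ff G) (branch H c v) (branch H c v) +
    (ff v (next c v) + ff v (prev c v))) / 2 - #|branch H c v|%:R)); last first.
  by move=> v _; rewrite exfE /ex; lra.
by rewrite big_split sumrN -mulr_suml -cU exfE /ex lerD2r; move: wU; lra.
Qed.

(** By [cyc_psi] the cycle edges give each vertex at least 2 psi = fw 3 3 + delta, so that the
    interaction of neighbouring roots disappears and the branches can be estimated one at a time. *)
Lemma branch_bound (d3 : forall v, v \in c -> (2 < deg v)%N) :
  \sum_(v in cset c) (fw 3 3 - 1 + kap (branch H c v) v) <= exf H.
Proof.
apply: le_trans branch_sum; move: (cyc_psi d3).
rewrite !big_split /= -mulr_suml => h.
have -> : \sum_(v in cset c) kap (branch H c v) v = \sum_(v in cset c) exf (branch H c v) +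
    \sum_(v in cset c) (1 + delta (deg v)).
  by rewrite -big_split; apply: eq_bigr => v _; rewrite /= kapE; lra.
have e : \sum_(v in cset c) (fw 3 3 - 1) + \sum_(v in cset c) (1 + delta (deg v)) =
    2 * \sum_(v in cset c) psi (deg v).
  rewrite -big_split mulr_sumr; apply: eq_bigr => v _; rewrite /= !deltaE !psiE. lra.
rewrite !big_split /= in h e *.
lra.
Qed.

End Assembly.
End Weight.

(** * Trees attached to a cycle *)

Lemma fw13 : fw 1 3 = 27 / 8.
Proof. by rewrite unlock hwE; field. Qed.
Lemma fw14 : fw 1 4 = 64 / 27.
Proof. by rewrite unlock hwE; field. Qed.
Lemma fw15 : fw 1 5 = 125 / 64.
Proof. by rewrite unlock hwE; field. Qed.
Lemma fw16 : fw 1 6 = 216 / 125.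
Proof. by rewrite unlock hwE; field. Qed.
Lemma fw17 : fw 1 7 = 343 / 216.
Proof. by rewrite unlock hwE; field. Qed.
Lemma fw18 : fw 1 8 = 512 / 343.
Proof. by rewrite unlock hwE; field. Qed.

Lemma fw1_ge1 d : (2 <= d)%N -> 1 <= fw 1 d.
Proof. by move=> h; apply: fw_ge1; lia. Qed.

Lemma delta4 d : (4 <= d)%N -> 243 / 50 <= delta d.
Proof.
move=> h; apply: le_trans (@delta_mono 4 d _); last by rewrite h.
by rewrite !deltaE fw33 fw34; lra.
Qed.

Lemma delta5 d : (5 <= d)%N -> 423 / 50 <= delta d.
Proof.
move=> h; apply: le_trans (@delta_mono 5 d _); last by rewrite h.
by rewrite !deltaE fw33 fw35; lra.
Qed.

Lemma delta7 d : (7 <= d)%N -> 133 / 10 <= delta d.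
Proof.
move=> h; apply: le_trans (@delta_mono 7 d _); last by rewrite h.
by rewrite !deltaE fw33 fw37; lra.
Qed.

(** As d grows the pendant edge gets lighter, but [delta] grows faster; the minimum is 27/8 - 1, at
    d = 3. *)
Lemma pendant_delta d : (3 <= d)%N -> 19 / 8 <= fw 1 d - 1 + delta d.
Proof.
rewrite leq_eqVlt => /orP[/eqP <-|h]; first by rewrite fw13 delta3; lra.
by have := delta4 h; have : 1 <= fw 1 d by [apply: fw1_ge1; lia]; lra.
Qed.

Lemma pendant_delta4 d : (4 <= d)%N -> 31 / 5 <= fw 1 d - 1 + delta d.
Proof.
rewrite leq_eqVlt => /orP[/eqP <-|h].
  by rewrite fw14 !deltaE fw33 fw34; lra.
by have := delta5 h; have : 1 <= fw 1 d by [apply: fw1_ge1; lia]; lra.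
Qed.

Section Shape.
Variable G : sgraph.
Implicit Types (A B C D F H K T X Z : {set G}) (u v w x y z : G) (c : seq G).
Hypotheses (cG : conn [set: G]) (G3 : (2 < #|G|)%N).

(** The cases that the bounds distinguish. Degrees are taken in G while T may be a branch of a
    proper subset, so [ShFlat] allows a tree of depth one in which some leaf has neighbours outside
    T. In [ShTwo] the tree continues along a 2-vertex, and in [ShP] it is a star with v as a
    leaf. *)
Variant shape T v : Prop :=
| ShStar of (forall z, z \in T -> z != v -> deg z = 1%N /\ adj v z)
| ShFlat z of z \in T & adj v z & (1 < deg z)%N & (#|T| < deg v)%N
| ShHigh z x of (3 < deg v)%N & z \in T & x \in T & adj v z & adj z x & x != v
| ShTwo z x of deg v = 3 & nb T v = [set z] & x \in T & adj z x & x != v &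
    deg z = 2
| ShDeep z x of deg v = 3 & z \in T & x \in T & adj v z & adj z x & x != v &
    (2 < deg z)%N & (1 < deg x)%N
| ShP z of deg v = 3 & nb T v = [set z] & (2 < deg z)%N &
    (forall x, x \in T -> x != v -> x != z -> deg x = 1%N /\ adj z x).

Lemma shapeP T v : conn T -> v \in T -> (2 < #|T|)%N ->
  (#|nb T v| + 2 <= deg v)%N -> shape T v.
Proof.
move=> cT vT T3 hd.
have nb0 : (0 < #|nb T v|)%N.
  have [z zT vz] := conn_nb cT (ltnW T3) vT.
  by apply/card_gt0P; exists z; rewrite in_nb zT.
case: (boolP [exists z in nb T v, exists x in nb T z, x != v]); last first.
  rewrite negb_exists_in => /forall_inP h.
  have eT : v |: nb T v = T.
    have [_ cl] := cT; apply: cl.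
    - by rewrite subUset sub1set vT nb_sub.
    - by apply/set0Pn; exists v; rewrite !inE eqxx.
    move=> p q; rewrite in_setU1 => /orP[/eqP ->|pN] qT pq.
      by rewrite in_setU1 in_nb qT pq orbT.
    have := h p pN; rewrite negb_exists_in => /forall_inP/(_ q).
    by rewrite in_nb qT pq => /(_ isT)/negPn/eqP ->; rewrite in_setU1 eqxx.
  have cT' : #|T| = (#|nb T v|).+1.
    by rewrite -{1}eT cardsU1 in_nb adj_irrefl andbF.
  have all_nb z : z \in T -> z != v -> adj v z.
    by rewrite -{1}eT in_setU1 in_nb => /orP[->|/andP[]].
  case: (boolP [exists z in nb T v, (1 < deg z)%N]).
    case/exists_inP => z; rewrite in_nb => /andP[zT vz] dz.
    by apply: (@ShFlat T v z) => //; rewrite cT'; lia.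
  rewrite negb_exists_in => /forall_inP h1.
  apply: ShStar => z zT zv; have vz := all_nb z zT zv; split=> //.
  have := h1 z; rewrite in_nb zT vz -leqNgt => /(_ isT).
  by have := @adj_deg _ z v; rewrite adjC vz => /(_ isT); lia.
case/exists_inP => z; rewrite in_nb => /andP[zT vz].
case/exists_inP => x; rewrite in_nb => /andP[xT zx] xv.
have [d4|d3] := ltnP 3 (deg v).
  exact: (ShHigh d4 zT xT).
have dv : deg v = 3%N by lia.
have nbz : nb T v = [set z].
  apply/esym/eqP; rewrite eqEcard sub1set in_nb zT vz cards1 /=; lia.
have dz2 : (1 < deg z)%N.
  by apply: (@deg_ge2 _ z v x) => //; rewrite ?(adjC z v) // eq_sym.
move: dz2; rewrite leq_eqVlt => /orP[/eqP e|dz].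
  exact: (ShTwo dv nbz xT zx xv).
case: (boolP [exists y in nb T z, (y != v) && (1 < deg y)%N]).
  case/exists_inP => y; rewrite in_nb => /andP[yT zy] /andP[yv dy].
  exact: (ShDeep dv zT yT vz zy yv).
rewrite negb_exists_in => /forall_inP h.
have hp y : y \in T -> adj z y -> y != v -> deg y = 1%N.
  move=> yT zy yv; have := h y; rewrite in_nb yT zy yv /= -leqNgt => /(_ isT).
  by have := @adj_deg _ y z; rewrite adjC zy => /(_ isT); lia.
have eT : v |: (z |: nb T z) = T.
  have [_ cl] := cT; apply: cl.
  - by rewrite !subUset !sub1set vT zT nb_sub.
  - by apply/set0Pn; exists v; rewrite !inE eqxx.
  move=> p q; rewrite !in_setU1 => /or3P[/eqP ->|/eqP ->|pN] qT pq.
  - have : q \in nb T v by rewrite in_nb qT.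
    by rewrite nbz inE => ->; rewrite orbT.
  - by rewrite in_nb qT pq !orbT.
  move: pN; rewrite in_nb => /andP[pT zp].
  case: (eqVneq p v) => [e|pv].
    have : q \in nb T v by rewrite in_nb qT -e.
    by rewrite nbz inE => ->; rewrite orbT.
  rewrite adjC in zp.
  by rewrite (deg1_nb (hp p pT _ pv) pq zp) ?eqxx ?orbT // adjC.
apply: (ShP dv nbz dz) => y yT yv yz.
have zy : adj z y.
  move: yT; rewrite -{1}eT !in_setU1 (negbTE yv) (negbTE yz) in_nb.
  by case/andP.
by split=> //; apply: hp.
Qed.

End Shape.

(** In this lemma and the next two the constants are the values at s = 3, 4, 5 and d = s + 1,
    rounded down; larger d is worse because of [delta]. *)
Lemma star_num3 s d : (3 <= s)%N -> (s < d)%N ->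
  38 / 5 <= (s - 1)%:R * (fw 1 d - 1) + delta d.
Proof.
move=> s3 sd; have d4 : (4 <= d)%N by lia.
have S : 2 <= (s - 1)%:R :> rat by rewrite (ler_nat _ 2); lia.
have F : 1 <= fw 1 d by apply: fw1_ge1; lia.
move: d4; rewrite leq_eqVlt => /orP[/eqP e|h]; last first.
  have := delta5 h; nra.
by move: S F; rewrite -e fw14 !deltaE fw33 fw34; lra.
Qed.

Lemma star_num4 s d : (4 <= s)%N -> (s < d)%N ->
  283 / 25 <= (s - 1)%:R * (fw 1 d - 1) + delta d.
Proof.
move=> s3 sd; have d4 : (5 <= d)%N by lia.
have S : 3 <= (s - 1)%:R :> rat by rewrite (ler_nat _ 3); lia.
have F : 1 <= fw 1 d by apply: fw1_ge1; lia.
move: d4; rewrite leq_eqVlt => /orP[/eqP e|].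
  by move: S F; rewrite -e fw15 !deltaE fw33 fw35; lra.
rewrite leq_eqVlt => /orP[/eqP e|h].
  by move: S F; rewrite -e fw16 !deltaE fw33 fw36; lra.
have := delta7 h; nra.
Qed.

Lemma star_num5 s d : (5 <= s)%N -> (s < d)%N ->
  141 / 10 <= (s - 1)%:R * (fw 1 d - 1) + delta d.
Proof.
move=> s3 sd; have d4 : (6 <= d)%N by lia.
have S : 4 <= (s - 1)%:R :> rat by rewrite (ler_nat _ 4); lia.
have F : 1 <= fw 1 d by apply: fw1_ge1; lia.
move: d4; rewrite leq_eqVlt => /orP[/eqP e|].
  by move: S F; rewrite -e fw16 !deltaE fw33 fw36; lra.
rewrite leq_eqVlt => /orP[/eqP e|h].
  by move: S F; rewrite -e fw17 !deltaE fw33 fw37; lra.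
have : 15 <= delta d.
  apply: le_trans (@delta_mono 8 d _); last by rewrite h.
  by rewrite !deltaE fw33 fw38; lra.
nra.
Qed.

(** * Contributions of the individual shapes *)

Section Kap.
Variable G : sgraph.
Implicit Types (A B C D F H K L P T X Z : {set G}) (u v w x y z : G) (c : seq G).
Hypotheses (cG : conn [set: G]) (G3 : (2 < #|G|)%N).

Lemma exf_U A B : [disjoint A & B] ->
  exf A + W (@ff G) A B - #|B|%:R <= exf (A :|: B).
Proof.
move=> d; rewrite !exfE (ex_U (@ffC G) d).
have := W_ge0 (ff1 cG G3) B B; rewrite /ex; lra.
Qed.

Lemma exf_leaves A L h : h \in A -> [disjoint A & L] ->
  (forall z, z \in L -> deg z = 1%N /\ adj h z) ->
  exf A + #|L|%:R * (fw 1 (deg h) - 1) <= exf (A :|: L).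
Proof.
move=> hA d hL; apply: le_trans (exf_U d).
have : #|L|%:R * fw 1 (deg h) <= W (@ff G) A L; last by lra.
rewrite (W_sym (@ffC G)) mulrC mulr_natr -sumr_const; apply: ler_sum => z zL.
have [dz hz] := hL z zL; rewrite adjC in hz.
by have := sum_nb_ge1 (ff1 cG G3) hA hz; rewrite {1}/ff dz.
Qed.

(** [p] need not be injective: a shared neighbour is charged only once, which increases the
    excess. *)
Lemma exf_privates A P (p : G -> G) : P \subset A ->
  (forall u, u \in P -> p u \notin A /\ adj u (p u)) ->
  exf A + \sum_(u in P) (ff u (p u) - 1) <= exf (A :|: [set p u | u in P]).
Proof.
move=> PA hp; have d : [disjoint A & [set p u | u in P]].
  rewrite disjoint_sym disjoint_subset; apply/subsetP => _ /imsetP[u uP ->].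
  by rewrite inE; case: (hp u uP).
apply: le_trans (exf_U d).
have h1 : #|[set p u | u in P]|%:R <= #|P|%:R :> rat.
  by rewrite ler_nat leq_imset_card.
have h2 : \sum_(u in P) ff u (p u) <= W (@ff G) A [set p u | u in P].
  rewrite /W [leRHS](big_setID P) /= (setIidPr PA).
  apply: (@le_trans _ _ (\sum_(u in P) \sum_(y in nb [set p u | u in P] u) ff u y)).
    apply: ler_sum => u uP; apply: (sum_nb_ge1 (ff1 cG G3)); last by case: (hp u uP).
    exact: imset_f.
  rewrite lerDl; apply: sumr_ge0 => x _; apply: sumr_ge0 => y.
  by rewrite in_nb => /andP[_ xy]; apply: le_trans (ff1 cG G3 xy).
have e : \sum_(u in P) (ff u (p u) - 1) = \sum_(u in P) ff u (p u) - #|P|%:R :> rat.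
  by rewrite big_split /= sumrN sumr_const.
rewrite e; lra.
Qed.

Lemma kap_star T v : conn T -> v \in T ->
  (forall z, z \in T -> z != v -> deg z = 1%N /\ adj v z) ->
  (#|T| - 1)%:R * (fw 1 (deg v) - 1) + delta (deg v) <= kap T v.
Proof.
move=> cT vT h; rewrite kapE lerD2r.
have eT : [set v] :|: (T :\ v) = T by rewrite setD1K.
have := @exf_leaves [set v] (T :\ v) v; rewrite eT exf1 set11.
have -> : #|T :\ v| = (#|T| - 1)%N by rewrite (cardsD1 v T) vT; lia.
move=> hh; have := hh isT; rewrite disjoints1 setD11 => /(_ isT) {}hh.
have : (forall z, z \in T :\ v -> deg z = 1%N /\ adj v z).
  by move=> z; rewrite !inE => /andP[zv zT]; apply: h.
move=> /hh; lra.
Qed.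

Lemma exf2 v z : adj v z -> exf [set z; v] = ff v z - 2.
Proof.
move=> vz; have zv : z \notin [set v] by rewrite inE eq_sym adj_neq.
have e : nb [set v] z = [set v].
  by apply/setP => y; rewrite !inE; case: eqP => // ->; rewrite adjC vz.
rewrite exfE (ex_add (@ffC G) zv) ex1 e big_set1 (ffC z).
move: (ff v z) => r; lra.
Qed.

Lemma exf3 v z x : adj v z -> adj z x -> x != v ->
  ff v z + ff z x - 3 <= exf (x |: [set z; v]).
Proof.
move=> vz zx xv; have := @exf_add1 G cG G3 x z [set z; v].
rewrite !inE negb_or xv eq_sym (adj_neq zx) eqxx adjC zx => /(_ isT isT isT).
rewrite exf2 // (ffC x); lra.
Qed.

Lemma exf_sub T A : conn T -> A \subset T -> A != set0 -> exf A <= exf T.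
Proof. exact: exf_mono. Qed.

Lemma kap_edge T v z : conn T -> v \in T -> z \in T -> adj v z ->
  ff v z - 1 + delta (deg v) <= kap T v.
Proof.
move=> cT vT zT vz; rewrite kapE lerD2r.
have h : exf [set z; v] <= exf T.
  apply: exf_sub => //; first by rewrite subUset !sub1set zT.
  by apply/set0Pn; exists z; rewrite !inE eqxx.
by rewrite exf2 // in h; lra.
Qed.

Lemma kap_path T v z x : conn T -> v \in T -> z \in T -> x \in T -> adj v z ->
  adj z x -> x != v -> ff v z + ff z x - 2 + delta (deg v) <= kap T v.
Proof.
move=> cT vT zT xT vz zx xv; rewrite kapE lerD2r.
have h : exf (x |: [set z; v]) <= exf T.
  apply: exf_sub => //; first by rewrite !subUset !sub1set zT xT.
  by apply/set0Pn; exists z; rewrite !inE eqxx orbT.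
by have := exf3 vz zx xv; lra.
Qed.

Lemma kap_path3 T v z x y : conn T -> v \in T -> z \in T -> x \in T -> y \in T ->
  adj v z -> adj z x -> x != v -> adj x y -> y != z -> y != v ->
  ff v z + ff z x + ff x y - 3 + delta (deg v) <= kap T v.
Proof.
move=> cT vT zT xT yT vz zx xv xy yz yv; rewrite kapE lerD2r.
have h : exf (y |: (x |: [set z; v])) <= exf T.
  apply: exf_sub => //; first by rewrite !subUset !sub1set zT xT yT.
  by apply/set0Pn; exists y; rewrite !inE eqxx.
have := exf3 vz zx xv; have := @exf_add1 G cG G3 y x (x |: [set z; v]).
rewrite !inE !negb_or yz yv eq_sym (adj_neq xy) eqxx adjC xy => /(_ isT isT isT).
rewrite (ffC y); lra.
Qed.

Lemma kap2 T v : conn T -> v \in T -> (1 < #|T|)%N -> (2 < deg v)%N ->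
  19 / 8 <= kap T v.
Proof.
move=> cT vT T2 dv; have [z zT vz] := conn_nb cT T2 vT.
apply: le_trans (kap_edge cT vT zT vz).
have dz : (0 < deg z)%N by apply: (@adj_deg _ z v); rewrite adjC.
move: dz; rewrite leq_eqVlt => /orP[/eqP e|dz].
  by rewrite /ff -e fwC; apply: pendant_delta.
have := @ff8 _ v z (ltnW dv) dz; have := delta_ge0 dv; lra.
Qed.

(** The worst case is deg z = 2, with two edges of weight 8 and deg v = 4: 8 + 8 - 2 + 243/50. *)
Lemma kap_high T v z x : conn T -> v \in T -> z \in T -> x \in T ->
  (3 < deg v)%N -> adj v z -> adj z x -> x != v -> 943 / 50 <= kap T v.
Proof.
move=> cT vT zT xT dv vz zx xv.
apply: le_trans (kap_path cT vT zT xT vz zx xv).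
have dz : (1 < deg z)%N.
  by apply: (@deg_ge2 _ z v x) => //; rewrite ?(adjC z v) // eq_sym.
have dx : (0 < deg x)%N by apply: (@adj_deg _ x z); rewrite adjC.
have D := delta4 dv.
have f1 := ff1 cG G3 zx.
move: dz; rewrite leq_eqVlt => /orP[/eqP e|].
  have d0 : (0 < deg v)%N by lia.
  have e1 : ff v z = 8.
    by rewrite /ff -e fwC; apply: fw2.
  have e2 : ff z x = 8.
    by rewrite /ff -e; apply: fw2.
  rewrite e1 e2; lra.
have fv n : (3 <= n)%N -> (n <= deg z)%N -> fw 4 n <= ff v z.
  by move=> n3 nz; rewrite /ff; apply: fw_mono; apply/andP; split; lia.
rewrite leq_eqVlt => /orP[/eqP e|h]; last first.
  by have := fv 4%N isT h; rewrite fw44; lra.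
have := fv 3%N isT; rewrite -e leqnn (fwC 4) fw34 => /(_ isT).
have : 27 / 8 <= ff z x; last by lra.
rewrite /ff -e; move: dx; rewrite leq_eqVlt => /orP[/eqP <-|dx].
  by rewrite fwC fw13 lexx.
by have := @fw_ge8 3 (deg x) isT dx; lra.
Qed.

Lemma kap_deep T v z x : conn T -> v \in T -> z \in T -> x \in T ->
  deg v = 3%N -> adj v z -> adj z x -> x != v -> (2 < deg z)%N ->
  (1 < deg x)%N -> 173 / 10 <= kap T v.
Proof.
move=> cT vT zT xT dv vz zx xv dz dx.
apply: le_trans (kap_path cT vT zT xT vz zx xv).
have := ff8 (ltnW dz) dx.
have : fw 3 3 <= ff v z by rewrite /ff dv; apply: fw3_mono.
rewrite fw33 dv delta3; lra.
Qed.

Lemma kap_flat T v z : conn T -> v \in T -> z \in T -> adj v z ->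
  (1 < deg z)%N -> (1 < deg v)%N -> 7 + delta (deg v) <= kap T v.
Proof.
move=> cT vT zT vz dz dv; apply: le_trans (kap_edge cT vT zT vz).
by have := ff8 dv dz; lra.
Qed.

Lemma nb_set1P T v z : nb T v = [set z] -> z \in T /\ adj v z.
Proof. by move=> e; apply/andP; rewrite -in_nb e set11. Qed.

(** Either a third edge without pendant end follows, giving 3 * 8 - 3 = 21, or all remaining
    vertices are pendant at x, as in Z. *)
Lemma kap_two T v z x : conn T -> v \in T -> nb T v = [set z] -> x \in T ->
  deg v = 3%N -> adj z x -> x != v -> deg z = 2 ->
  (exists y, [/\ y \in T, adj x y, y != z, (1 < deg y)%N & 21 <= kap T v]) \/
  (forall y, y \in T -> y != v -> y != z -> y != x -> deg y = 1%N /\ adj x y) /\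
  14 + (#|T| - 3)%:R * (fw 1 (deg x) - 1) <= kap T v.
Proof.
move=> cT vT nv xT dv zx xv dz; have [zT vz] := nb_set1P nv.
have xz : x != z by rewrite eq_sym adj_neq.
have zv : z != v by rewrite eq_sym adj_neq.
have dx0 : (0 < deg x)%N by apply: (@adj_deg _ x z); rewrite adjC.
have Nz t : adj z t -> t = v \/ t = x.
  move=> zt; case: (eqVneq t v) => [|tv]; first by left.
  right; apply/eqP; apply: contraT => tx.
  have : (#|[set v; x] :|: [set t]| <= deg z)%N.
    apply/subset_leq_card/subsetP => q; rewrite !inE -orbA.
    by case/or3P => /eqP ->; rewrite // adjC.
  rewrite setUC cardsU1 cards2 !inE negb_or tv tx eq_sym xv dz.
  by [].
case: (boolP [exists y in T, [&& adj x y, y != z & (1 < deg y)%N]]).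
  case/exists_inP => y yT /and3P[xy yz dy]; left; exists y; split=> //.
  have yv : y != v.
    apply: contraTneq xy => ->; rewrite adjC; apply/negP => vx.
    have : x \in nb T v by rewrite in_nb xT.
    by rewrite nv inE (negbTE xz).
  apply: le_trans (kap_path3 cT vT zT xT yT vz zx xv xy yz yv).
  have dx : (1 < deg x)%N.
    by apply: (@deg_ge2 _ x z y); rewrite // 1?adjC // eq_sym.
  have := ff8 dx dy.
  have e1 : ff v z = 8 by rewrite /ff dz fwC fw2 // dv.
  have e2 : ff z x = 8 by rewrite /ff dz fw2.
  rewrite e1 e2 dv delta3; lra.
rewrite negb_exists_in => /forall_inP h; right.
have hp y : y \in T -> adj x y -> y != z -> deg y = 1%N.
  move=> yT xy yz; have := h y yT; rewrite xy yz /= -leqNgt.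
  by have := @adj_deg _ y x; rewrite adjC xy => /(_ isT); lia.
have eT : (x |: [set z; v]) :|: nb T x = T.
  have [_ cl] := cT; apply: cl.
  - by rewrite !subUset !sub1set vT zT xT nb_sub.
  - by apply/set0Pn; exists v; rewrite !inE eqxx !orbT.
  move=> p q; rewrite !in_setU !in_set1 -!orbA => pp qT pq.
  case/or4P: pp => [/eqP e|/eqP e|/eqP e|pN].
  - by rewrite in_nb qT -e pq !orbT.
  - by rewrite e in pq; case: (Nz q pq) => ->; rewrite eqxx ?orbT.
  - have : q \in nb T v by rewrite in_nb qT -e.
    by rewrite nv inE => ->; rewrite !orbT.
  move: pN; rewrite in_nb => /andP[pT xp].
  case: (eqVneq p z) => [e|pz].
    by rewrite e in pq; case: (Nz q pq) => ->; rewrite eqxx ?orbT.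
  rewrite adjC in xp; rewrite (deg1_nb (hp p pT _ pz) pq xp) ?eqxx //.
  by rewrite adjC.
have nbx y : y \in T -> y != v -> y != z -> y != x -> deg y = 1%N /\ adj x y.
  move=> yT yv yz yx; have xy : adj x y.
    move: yT; rewrite -{1}eT !in_setU !in_set1 (negbTE yv) (negbTE yz) (negbTE yx).
    by rewrite in_nb /= => /andP[].
  by split=> //; apply: hp.
split=> //.
pose A := x |: [set z; v]; have sA : A \subset T by rewrite !subUset !sub1set vT zT xT.
have cA : #|A| = 3%N.
  by rewrite cardsU1 cards2 !inE negb_or xz xv zv.
have cL : #|T :\: A| = (#|T| - 3)%N by rewrite cardsD (setIidPr sA) cA.
have dA : [disjoint A & T :\: A].
  by rewrite disjoint_sym disjoint_subset; apply/subsetP => y; rewrite in_setD => /andP[].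
have := @exf_leaves A (T :\: A) x; rewrite !inE eqxx => /(_ isT dA).
rewrite -cL kapE dv delta3.
have -> : A :|: (T :\: A) = T.
  by apply/setP => y; rewrite in_setU in_setD; case: (boolP (y \in A)) => [/(subsetP sA) ->|].
move=> hh; have := exf3 vz zx xv; rewrite -/A.
have : 8 = ff v z by rewrite /ff dz dv fwC fw2.
have : 8 = ff z x by rewrite /ff dz fw2.
have : forall y, y \in T :\: A -> deg y = 1%N /\ adj x y.
  move=> y; rewrite in_setD !in_setU !in_set1 !negb_or.
  by case/andP => /and3P[? ? ?] ?; apply: nbx.
move/hh; lra.
Qed.

Lemma kap_P T v z : conn T -> v \in T -> nb T v = [set z] -> deg v = 3%N ->
  (forall x, x \in T -> x != v -> x != z -> deg x = 1%N /\ adj z x) ->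
  [/\ ff v z - 1 + (#|T| - 2)%:R * (fw 1 (deg z) - 1) <= kap T v,
    (1 < #|T|)%N & (#|T| - 1 <= deg z)%N].
Proof.
move=> cT vT nv dv h; have [zT vz] := nb_set1P nv.
have zv : z != v by rewrite eq_sym adj_neq.
pose A := [set z; v]; have sA : A \subset T by rewrite !subUset !sub1set vT zT.
have cA : #|A| = 2%N by rewrite cards2 zv.
have cL : #|T :\: A| = (#|T| - 2)%N by rewrite cardsD (setIidPr sA) cA.
have dA : [disjoint A & T :\: A].
  by rewrite disjoint_sym disjoint_subset; apply/subsetP => y; rewrite in_setD => /andP[].
have T2 : (1 < #|T|)%N by rewrite -cA subset_leq_card.
have hL : forall y, y \in T :\: A -> deg y = 1%N /\ adj z y.
  move=> y; rewrite in_setD !in_setU !in_set1 !negb_or.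
  by case/andP => /andP[? ?] ?; apply: h.
split=> //.
  have := @exf_leaves A (T :\: A) z; rewrite !inE eqxx => /(_ isT dA hL).
  rewrite -cL kapE dv delta3.
  have -> : A :|: (T :\: A) = T.
    by apply/setP => y; rewrite in_setU in_setD; case: (boolP (y \in A)) => [/(subsetP sA) ->|].
  rewrite /A exf2 //; lra.
have : (#|v |: (T :\: A)| <= deg z)%N.
  apply/subset_leq_card/subsetP => y; rewrite in_setU1 inE => /orP[/eqP ->|/hL[]//].
  by rewrite adjC.
by rewrite cardsU1 in_setD !inE eqxx orbT cL /=; lia.
Qed.

End Kap.

Lemma fw3_ge4 d : (4 <= d)%N -> 1728 / 125 <= fw 3 d.
Proof. by move=> h; rewrite -fw34; apply: fw3_mono. Qed.

Lemma fw3_ge5 d : (5 <= d)%N -> 125 / 8 <= fw 3 d.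
Proof. by move=> h; rewrite -fw35; apply: fw3_mono. Qed.

(** The constant is fw 3 4 - 1 rounded down, which covers all d >= 4; for d = 3 the two pendant
    edges make up the difference. *)
Lemma P_num s d : (4 <= s)%N -> (s - 1 <= d)%N ->
  641 / 50 <= fw 3 d - 1 + (s - 2)%:R * (fw 1 d - 1).
Proof.
move=> s4 sd; have d3 : (3 <= d)%N by lia.
have S : 2 <= (s - 2)%:R :> rat by rewrite (ler_nat _ 2); lia.
have F : 1 <= fw 1 d by apply: fw1_ge1; lia.
move: d3; rewrite leq_eqVlt => /orP[/eqP e|h].
  by move: S F; rewrite -e fw13 fw33; lra.
by have := fw3_ge4 h; nra.
Qed.

Section Robust.
Variable G : sgraph.
Implicit Types (A B C D F H K L P T X Z : {set G}) (u v w x y z : G) (c : seq G).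
Hypotheses (cG : conn [set: G]) (G3 : (2 < #|G|)%N).

Lemma ff3_ge v z : deg v = 3%N -> (2 < deg z)%N -> 729 / 64 <= ff v z.
Proof. by move=> dv dz; rewrite -fw33 /ff dv; apply: fw3_mono. Qed.

Lemma kap3 T v : conn T -> v \in T -> (2 < #|T|)%N ->
  (#|nb T v| + 2 <= deg v)%N -> 38 / 5 <= kap T v.
Proof.
move=> cT vT T3 hd; case: (shapeP G3 cT vT T3 hd).
- move=> h; apply: le_trans (kap_star cG G3 cT vT h); apply: star_num3 => //.
  have e : nb T v = T :\ v.
    apply/setP => z; rewrite !inE; case: (eqVneq z v) => [->|zv].
      by rewrite adj_irrefl andbF.
    by case: (boolP (z \in T)) => // zT; case: (h z zT zv).
  by have := cardsD1 v T; rewrite vT -e; lia.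
- move=> z zT vz dz dv; apply: le_trans (kap_flat cG G3 cT vT zT vz dz _); last by lia.
  have := @delta4 (deg v); have d4 : (4 <= deg v)%N by lia.
  by move=> /(_ d4); lra.
- by move=> z x dv zT xT vz zx xv; have := kap_high cG G3 cT vT zT xT dv vz zx xv; lra.
- move=> z x dv nv xT zx xv dz.
  have [zT vz] := nb_set1P nv.
  have d0 : (0 < deg x)%N by apply: (@adj_deg _ x z); rewrite adjC.
  have e1 : ff v z = 8 by rewrite /ff dz fwC fw2 // dv.
  have e2 : ff z x = 8 by rewrite /ff dz fw2.
  have := kap_path cG G3 cT vT zT xT vz zx xv.
  by rewrite e1 e2 dv delta3; lra.
- move=> z x dv zT xT vz zx xv dz dx.
  by have := kap_deep cG G3 cT vT zT xT dv vz zx xv dz dx; lra.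
move=> z dv nv dz h; have [zT vz] := nb_set1P nv.
have := kap_edge cG G3 cT vT zT vz; have := ff3_ge dv dz.
by rewrite dv delta3; lra.
Qed.

Lemma kap45 T v : conn T -> v \in T -> (3 < #|T|)%N ->
  (#|nb T v| + 2 <= deg v)%N ->
  (283 / 25 <= kap T v) /\ ((4 < #|T|)%N -> 641 / 50 <= kap T v).
Proof.
move=> cT vT T3 hd; suff [h|[h1 h2]] :
   641 / 50 <= kap T v \/ (forall z, z \in T -> z != v -> deg z = 1%N /\ adj v z) /\ (#|T| < deg v)%N.
- by split=> [|_]; move: h; lra.
- have h := kap_star cG G3 cT vT h1; split.
    by apply: le_trans h; apply: star_num4.
  by move=> T5; have := star_num5 T5 h2; lra.
case: (shapeP G3 cT vT (ltnW T3) hd).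
- move=> h; right; split=> //.
  have e : nb T v = T :\ v.
    apply/setP => z; rewrite !inE; case: (eqVneq z v) => [->|zv].
      by rewrite adj_irrefl andbF.
    by case: (boolP (z \in T)) => // zT; case: (h z zT zv).
  by have := cardsD1 v T; rewrite vT -e; lia.
- move=> z zT vz dz dv; left; apply: le_trans (kap_flat cG G3 cT vT zT vz dz _); last by lia.
  have := @delta5 (deg v); have d4 : (5 <= deg v)%N by lia.
  by move=> /(_ d4); lra.
- by move=> z x dv zT xT vz zx xv; left; have := kap_high cG G3 cT vT zT xT dv vz zx xv; lra.
- move=> z x dv nv xT zx xv dz; left.
  have [zT vz] := nb_set1P nv.
  have d0 : (0 < deg x)%N by apply: (@adj_deg _ x z); rewrite adjC.
  have e1 : ff v z = 8 by rewrite /ff dz fwC fw2 // dv.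
  have e2 : ff z x = 8 by rewrite /ff dz fw2.
  have := kap_path cG G3 cT vT zT xT vz zx xv.
  by rewrite e1 e2 dv delta3; lra.
- move=> z x dv zT xT vz zx xv dz dx.
  by left; have := kap_deep cG G3 cT vT zT xT dv vz zx xv dz dx; lra.
move=> z dv nv dz h; left.
have [+ _ sd] := kap_P cG G3 cT vT nv dv h.
by have := P_num T3 sd; rewrite /ff dv; lra.
Qed.

(* With at most one neighbour outside T for each non-root vertex, the bound
   14 of the 2-vertex case is not attained. *)
Lemma kap6 T v : conn T -> v \in T -> (5 < #|T|)%N ->
  (#|nb T v| + 2 <= deg v)%N ->
  (forall x, x \in T -> x != v -> (deg x <= (#|nb T x|).+1)%N) ->
  141 / 10 <= kap T v.
Proof.
move=> cT vT T6 hd hx.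
case: (shapeP G3 cT vT (ltnW (ltnW (ltnW T6))) hd).
- move=> h; apply: le_trans (kap_star cG G3 cT vT h); apply: star_num5.
    exact: ltnW.
  have e : nb T v = T :\ v.
    apply/setP => z; rewrite !inE; case: (eqVneq z v) => [->|zv].
      by rewrite adj_irrefl andbF.
    by case: (boolP (z \in T)) => // zT; case: (h z zT zv).
  by have := cardsD1 v T; rewrite vT -e; lia.
- move=> z zT vz dz dv; apply: le_trans (kap_flat cG G3 cT vT zT vz dz _); last by lia.
  have := @delta5 (deg v); have d4 : (5 <= deg v)%N by lia.
  by move=> /(_ d4); lra.
- by move=> z x dv zT xT vz zx xv; have := kap_high cG G3 cT vT zT xT dv vz zx xv; lra.
- move=> z x dv nv xT zx xv dz.
  have [[y [_ _ _ _ h]]|[h1 h2]] := kap_two cG G3 cT vT nv xT dv zx xv dz.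
    by move: h; lra.
  have [zT vz] := nb_set1P nv.
  have dx : (deg x <= #|T|)%N.
    apply: leq_trans (hx x xT xv) _; rewrite (cardsD1 x T) xT /= add1n ltnS.
    rewrite -nbD1; exact: subset_leq_card (nb_sub _ _).
  have dx' : (deg x <= (#|T| - 3) + 2)%N.
    apply: leq_trans (hx x xT xv) _.
    have : (#|nb T x| <= #|T :\ x :\ v|)%N.
      apply/subset_leq_card/subsetP => y; rewrite !inE => /andP[-> xy].
      rewrite andbT [y == x]eq_sym (adj_neq xy) andbT.
      apply: contraTneq xy => ->; rewrite adjC; apply/negP => vx.
      have : x \in nb T v by rewrite in_nb xT.
      by rewrite nv inE eq_sym (negbTE (adj_neq zx)).
    have := cardsD1 x T; rewrite xT; have := cardsD1 v (T :\ x).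
    by rewrite !inE eq_sym xv vT /=; lia.
  set t := (#|T| - 3)%N in h2 dx'; have t3 : (3 <= t)%N by rewrite /t; lia.
  have dx2 : (2 <= deg x)%N.
    have [y yT yN] : exists2 y, y \in T & y \notin [set v; z; x].
      apply/subsetPn; apply/negP => /subset_leq_card.
      have : (#|[set v; z; x]| <= 3)%N.
        by rewrite setUC cardsU1 cards2; case: (x \notin _); case: (v != z).
      lia.
    move: yN; rewrite !inE !negb_or => /andP[/andP[yv yz] yx].
    have [_ xy] := h1 y yT yv yz yx.
    by apply: (@deg_ge2 _ x z y) => //; rewrite ?(adjC x z) // eq_sym.
  (* (1+e)^3 - 1 >= 3 e with e = 1/(deg x - 1) *)
  have : 3 / (deg x - 1)%:R <= fw 1 (deg x) - 1.
    case: (deg x) dx2 => // d d1; rewrite subn1 /=.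
    have D : 1 <= d%:R :> rat by rewrite ler1n; lia.
    have := @fw1 d; rewrite -(ler_pM2l (x := d%:R)); last lra.
    move=> -> //; rewrite mulrCA mulfV; last by rewrite lt0r_neq0 //; lra.
    have : 0 <= 3 / d%:R :> rat by rewrite divr_ge0.
    have : 0 <= 1 / d%:R ^+ 2 :> rat by rewrite divr_ge0 // sqr_ge0.
    lra.
  have : 1 / 10 <= t%:R * (3 / (deg x - 1)%:R) :> rat.
    have D : 0 < (deg x - 1)%:R :> rat by rewrite ltr0n; lia.
    rewrite mulrA (ler_pdivlMr _ _ D).
    have : (deg x - 1)%:R <= (t + 1)%:R :> rat by rewrite ler_nat; lia.
    have : 3 <= t%:R :> rat by rewrite (ler_nat _ 3).
    rewrite natrD; lra.
  have T0 : 0 <= t%:R :> rat by [].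
  move=> h3 h4; have := ler_wpM2l T0 h4; lra.
- move=> z x dv zT xT vz zx xv dz dx.
  by have := kap_deep cG G3 cT vT zT xT dv vz zx xv dz dx; lra.
move=> z dv nv dz h.
have [+ _ sd] := kap_P cG G3 cT vT nv dv h.
have d5 : (5 <= deg z)%N by lia.
have F : 1 <= fw 1 (deg z) by apply: fw1_ge1; lia.
have S : 0 <= (#|T| - 2)%:R :> rat by [].
have := fw3_ge5 d5; rewrite /ff dv; nra.
Qed.

(** * Cycles in heavy sets *)

Section HeavyCycle.
Variables (H : {set G}) (c : seq G).
Hypotheses (cH : conn H) (cc : cyc c) (cs : cset c \subset H) (hH : heavy H).

Lemma nb_branch v : v \in c -> (#|nb (branch H c v) v| + 2 <= #|nb H v|)%N.
Proof.
move=> vc; have [nc pc an ap [np nv pv]] := cyc_next cc vc.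
have no u : u \in c -> u != v -> u \notin branch H c v.
  move=> uc uv; rewrite in_setD negb_and negbK; apply/orP; left.
  by apply: (subsetP (cyc_hcomp cc cs vc)); rewrite in_setD1 uv in_cset.
have : (#|nb (branch H c v) v :|: [set next c v; prev c v]| <= #|nb H v|)%N.
  apply/subset_leq_card; rewrite subUset nbS ?branch_sub //=.
  by apply/subsetP => y; rewrite !inE => /orP[]/eqP->; rewrite (cyc_in cs).
rewrite cardsU cards2 np (_ : _ :&: _ = set0) ?cards0 ?subn0 //.
apply/setP => y; rewrite in_setI in_nb in_set2 in_set0; apply/negbTE/negP => /andP[/andP[yB _]].
case/orP => /eqP e; rewrite e in yB.
  by have := no _ nc nv; rewrite yB.
by have := no _ pc pv; rewrite yB.
Qed.

Lemma nb_branch_deg v : v \in c -> (#|nb (branch H c v) v| + 2 <= deg v)%N.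
Proof. by move=> vc; apply: leq_trans (nb_branch vc) (nb_leq_deg _ _). Qed.

Lemma heavy_cyc_private v Z : v \in c -> conn Z -> Z \subset H :\ v ->
  exists z, [/\ z \in H, z \notin Z, adj v z & z != v].
Proof.
by move=> vc cZ ZH; apply: heavy_private => //; [apply: (cyc_in cs)|apply: (cyc_nb cc)].
Qed.

(** The rest of the cycle is connected, so by heaviness v has a neighbour off the cycle. *)
Lemma heavy_cyc_deg v : v \in c -> (2 < deg v)%N.
Proof.
move=> vc; have [|z [zH zN vz _]] := heavy_cyc_private vc (cyc_conn_D1 cc vc).
  exact: setSD.
have [nc pc an ap [np nv pv]] := cyc_next cc vc.
have : (#|z |: [set next c v; prev c v]| <= deg v)%N.
  apply/subset_leq_card/subsetP => y; rewrite !inE.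
  by case/or3P => /eqP ->.
rewrite cardsU1 cards2 np !inE negb_or.
have zc : z \notin c by move: zN; rewrite in_setD1 in_cset eq_sym (adj_neq vz).
have -> : z != next c v by apply: contraNneq zc => ->.
by have -> : z != prev c v by apply: contraNneq zc => ->.
Qed.

(** With the whole of [hcomp H c v] as Z, the private neighbour has to lie in the branch. *)
Lemma heavy_branch v : v \in c -> (1 < #|branch H c v|)%N.
Proof.
move=> vc.
have [|z [zH zN vz zv]] := heavy_cyc_private vc (conn_hcomp cc cs vc).
  exact: hcomp_sub.
apply/card_gt1P; exists z, v; split=> //.
  by rewrite in_setD zN.
exact: (branch_self cc cs).
Qed.

Lemma cycle_sum (X : rat) : 0 <= X ->
  (forall v, v \in c -> X <= kap (branch H c v) v) ->
  3 * (665 / 64 + X) <= exf H.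
Proof.
move=> X0 hX; apply: le_trans (branch_bound cG G3 cH cc cs heavy_cyc_deg).
apply: (@le_trans _ _ (\sum_(v in cset c) (665 / 64 + X))); last first.
  apply: ler_sum => v; rewrite in_cset => vc; have := hX v vc; rewrite fw33; lra.
have r0 : 0 <= 665 / 64 + X by lra.
move: r0; move: (665 / 64 + X) => r r0.
rewrite sumr_const -[r *+ _]mulr_natl; apply: ler_wpM2r => //.
by rewrite (ler_nat _ 3) card_cset //; case/and3P: cc.
Qed.

End HeavyCycle.

(** The bounds are 3 (665/64 + X), rounded down, where X estimates a branch with at least 2, 3, 4
    and 5 vertices respectively; 665/64 is fw 3 3 - 1. *)
Lemma uni_bound H k : conn H -> heavy H -> en H = #|H| -> apexk k H ->
  [/\ 38 <= exf H, (3 <= k)%N -> 53 <= exf H, (4 <= k)%N -> 65 <= exf H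
    & (5 <= k)%N -> 139 / 2 <= exf H].
Proof.
move=> cH hH eH aH.
have [c cc cs] := en_cycle (proj1 cH) (eq_leq (esym eH)).
have cb v (vc : v \in c) := conn_branch cH cc cs vc.
have vb v (vc : v \in c) := branch_self cc cs vc.
have nb v (vc : v \in c) := nb_branch_deg cc cs vc.
have kb v (vc : v \in c) := uni_branch_card cH cc cs vc eH aH.
have bd (X : rat) := @cycle_sum H c cH cc cs hH X.
split.
- have := bd (19 / 8); have h : 0 <= 19 / 8 :> rat by lra.
  move=> /(_ h); have {}h : forall v, v \in c -> 19 / 8 <= kap (branch H c v) v.
    move=> v vc; apply: (kap2 cG G3 (cb v vc) (vb v vc)).
      exact: heavy_branch.
    exact: (heavy_cyc_deg cH cc cs hH).
  by move=> /(_ h); lra.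
- move=> k3; have := bd (38 / 5); have h : 0 <= 38 / 5 :> rat by lra.
  move=> /(_ h); have {}h : forall v, v \in c -> 38 / 5 <= kap (branch H c v) v.
    move=> v vc; apply: (kap3 (cb v vc) (vb v vc) _ (nb v vc)).
    exact: leq_trans (kb v vc).
  by move=> /(_ h); lra.
- move=> k4; have := bd (283 / 25); have h : 0 <= 283 / 25 :> rat by lra.
  move=> /(_ h); have {}h : forall v, v \in c -> 283 / 25 <= kap (branch H c v) v.
    move=> v vc; have b4 : (3 < #|branch H c v|)%N by apply: leq_trans (kb v vc).
    by case: (kap45 (cb v vc) (vb v vc) b4 (nb v vc)).
  by move=> /(_ h); lra.
move=> k5; have := bd (641 / 50); have h : 0 <= 641 / 50 :> rat by lra.
move=> /(_ h); have {}h : forall v, v \in c -> 641 / 50 <= kap (branch H c v) v.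
  move=> v vc; have b5 : (4 < #|branch H c v|)%N by apply: leq_trans (kb v vc).
  by case: (kap45 (cb v vc) (vb v vc) (ltnW b5) (nb v vc)) => _; apply.
by move=> /(_ h); lra.
Qed.

End Robust.

(** * Heavy graphs with at least two cycles *)

Lemma psi4_ge d : (4 <= d)%N -> 65 / 8 <= psi d.
Proof.
move=> h; apply: le_trans (@psi_mono 4 d _); last by rewrite h.
by rewrite !psiE fw33 fw34; lra.
Qed.

Lemma psi_delta d : 2 * psi d - 1 = 665 / 64 + delta d.
Proof. by rewrite psiE deltaE fw33; lra. Qed.

Lemma psi_ge0 d : (3 <= d)%N -> 0 <= psi d.
Proof.
move=> h; apply: le_trans (@psi_mono 3 d _); last by rewrite h.
by rewrite !psiE fw33; lra.
Qed.

Lemma psi3_num d e : (4 <= d)%N -> (0 < e)%N ->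
  247 / 10 <= 3 * psi d - 1 + (fw d e - 1).
Proof.
move=> d4 e0.
have p5 : (4 < d)%N -> psi 5 <= psi d by move=> h; apply: psi_mono; rewrite h.
have P0 := psi4_ge d4.
move: e0; rewrite leq_eqVlt => /orP[/eqP <-|e2]; last first.
  by have := @fw_ge8 d e (ltnW (ltnW d4)) e2; lra.
have F : 1 <= fw d 1 by rewrite fwC; apply: fw1_ge1; lia.
move: d4; rewrite leq_eqVlt => /orP[/eqP e4|h].
  by rewrite -e4 fwC fw14 !psiE fw33 fw34; lra.
have := p5 h.
by rewrite {1}psiE fw33 fw35; lra.
Qed.

Section Bicyclic.
Variable G : sgraph.
Implicit Types (A B C D F H K L P T X Z : {set G}) (u v w x y z : G) (c : seq G).
Hypotheses (cG : conn [set: G]) (G3 : (2 < #|G|)%N).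

Lemma conn_cut H u B : conn H -> u \in H -> B \subset H :\ u ->
  closed_in (H :\ u) B -> conn (u |: B).
Proof.
move=> [_ cH] uH BH clB; split.
  by apply/set0Pn; exists u; rewrite !inE eqxx.
have uB : u \notin B by apply/negP => /(subsetP BH); rewrite !inE eqxx.
have BH' := subset_trans BH (subD1set H u).
move=> A AB /set0Pn[a aA] clA.
have AH : A \subset H by apply: subset_trans AB _; rewrite subUset sub1set uH.
case: (boolP (u \in A)) => uA; last first.
  suff e : A = H by rewrite e uH in uA.
  apply: cH => //; first by apply/set0Pn; exists a.
  move=> p q pA qH pq; case: (eqVneq q u) => [e|qu].
    by apply: (clA p) => //; rewrite e !inE eqxx.
  apply: (clA p) => //; rewrite in_setU1; apply/orP; right.
  apply: (clB p) => //; last by rewrite in_setD1 qu.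
  have := subsetP AB p pA; rewrite in_setU1 => /orP[/eqP e|//].
  by rewrite -e pA in uA.
apply/eqP; rewrite eqEsubset AB /= -setD_eq0; apply/negPn/negP => n0.
have e : (u |: B) :\: A = H.
  apply: cH => //.
    by rewrite subDset subUset sub1set inE uH orbT (subset_trans BH') ?subsetUr.
  move=> p q; rewrite in_setD => /andP[pA pB] qH pq.
  have pu : p != u by apply: contraNneq pA => ->.
  have {}pB : p \in B by move: pB; rewrite in_setU1 (negbTE pu).
  have qA : q \notin A.
    by apply: contra pA => qA; apply: (clA q) => //; rewrite ?in_setU1 ?pB ?orbT // adjC.
  rewrite in_setD qA in_setU1; apply/orP; right.
  apply: (clB p) => //; rewrite in_setD1 qH andbT.
  by apply: contraNneq qA => ->.
by move: uH; rewrite -e in_setD uA.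
Qed.

(* The configuration in which a heavy bicyclic graph may be too light; removing
   u and z then allows an induction on the apex number. *)
Definition poor H n u := exists z y1 y2,
  [/\ [/\ conn (H :\ z :\ u), u \in H & z \in H],
      [/\ y1 \in H :\ z :\ u, y2 \in H :\ z :\ u & y1 != y2],
      [/\ adj u z, adj u y1 & adj u y2],
      deg u = 3%N /\ deg z = 1%N & (n <= deg y1)%N /\ (n <= deg y2)%N].

Lemma mk_poor H Z u z y1 y2 n : conn H -> u \in H -> z \in H -> conn Z ->
  Z \subset H :\ u -> z \notin Z -> y1 \in Z -> y2 \in Z -> y1 != y2 ->
  adj u z -> adj u y1 -> adj u y2 -> deg u = 3%N -> deg z = 1%N ->
  (n <= deg y1)%N -> (n <= deg y2)%N -> poor H n u.
Proof.
move=> cH uH zH cZ ZH zZ y1Z y2Z yy uz uy1 uy2 du dz n1 n2.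
have zu : z != u by rewrite eq_sym adj_neq.
have ZH' : Z \subset (H :\ z) :\ u.
  apply/subsetP => t tZ; have := subsetP ZH t tZ; rewrite !in_setD1 => /andP[-> ->].
  by rewrite andbT; apply: contraNneq zZ => <-.
have cz : conn (H :\ z).
  apply: (@conn_del_pendant _ H u z cH uH zH zu).
  apply/subsetP => t; rewrite in_nb => /andP[_ zt]; rewrite inE.
  by rewrite adjC in uz; rewrite (deg1_nb dz zt uz).
exists z, y1, y2; split=> //.
- split=> //; apply: (@conn_del _ (H :\ z) Z u) => //.
    by rewrite in_setD1 eq_sym zu.
  apply/subsetP => y; rewrite in_nb in_setD1 => /andP[/andP[yz yH] uy].
  apply: contraT => yZ; have : (#|y |: (z |: [set y1; y2])| <= deg u)%N.
    apply/subset_leq_card/subsetP => t; rewrite !inE.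
    by case/or4P => /eqP ->.
  rewrite 2!cardsU1 cards2 yy !inE !negb_or yz.
  have nz t : t \in Z -> z != t by move=> tZ; apply: contraNneq zZ => ->.
  have ny t : t \in Z -> y != t by move=> tZ; apply: contraNneq yZ => ->.
  by rewrite !nz // !ny // du.
by split=> //; apply: (subsetP ZH').
Qed.

(** Removing u and z lowers the apex number by at most two but gains more than two ordinary steps
    may need: u has two edges to vertices of degree at least n, and the pendant edge gives 27/8 -
    1. *)
Lemma poor_exf H n u : (2 < n)%N -> poor H n u -> exists K,
  [/\ conn K, (#|K|.+2 = #|H|)%N, (en K + 3 = en H)%N, K \subset H &
    exf K + (2 * fw 3 n - 1) + 19 / 8 <= exf H].
Proof.
move=> n3 [z [y1 [y2 [[cK uH zH] [y1K y2K yy] [uz uy1 uy2] [du dz] [n1 n2]]]]].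
have zu : z != u by rewrite eq_sym adj_neq.
have uHz : u \in H :\ z by rewrite in_setD1 eq_sym zu.
exists (H :\ z :\ u).
have nz : nb H z = [set u].
  apply/setP => t; rewrite in_nb inE; apply/andP/eqP => [[_ zt]|->].
    by rewrite adjC in uz; rewrite (deg1_nb dz zt uz).
  by rewrite uH adjC.
have nu : nb (H :\ z) u = [set y1; y2].
  have [y1H y2H] : y1 \in H :\ z /\ y2 \in H :\ z.
    by split; [move: y1K|move: y2K]; rewrite in_setD1 => /andP[].
  apply/setP => t; rewrite in_nb in_set2.
  apply/idP/orP => [/andP[tH ut]|[]/eqP ->]; last 2 first.
  - by rewrite y1H.
  - by rewrite y2H.
  apply/orP; apply: contraT; rewrite negb_or => /andP[t1 t2].
  have : (#|t |: (z |: [set y1; y2])| <= deg u)%N.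
    apply/subset_leq_card/subsetP => s; rewrite !inE.
    by case/or4P => /eqP ->.
  move: tH y1H y2H; rewrite !in_setD1 => /andP[tz _] /andP[z1 _] /andP[z2 _].
  by rewrite 2!cardsU1 cards2 yy !inE !negb_or tz t1 t2 eq_sym z1 eq_sym z2 du.
split=> //.
- by have := cardsD1 z H; have := cardsD1 u (H :\ z); rewrite zH uHz; lia.
- have := en_D1 zH; have := en_D1 uHz; rewrite nz nu cards1 cards2 yy; lia.
- by apply: subset_trans (subD1set _ _) (subD1set _ _).
have e2 : fw 3 n <= ff u y1 by rewrite /ff du; apply: fw3_mono; lia.
have e3 : fw 3 n <= ff u y2 by rewrite /ff du; apply: fw3_mono; lia.
have := exf_add2 cG G3 (negbT (setD11 u (H :\ z))) y1K y2K yy uy1 uy2.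
rewrite (setD1K uHz).
have zu' : adj z u by rewrite adjC.
have := exf_add1 cG G3 (negbT (setD11 z H)) uHz zu'.
rewrite (setD1K zH).
have e1 : ff z u = 27 / 8 by rewrite /ff dz du fw13.
by rewrite e1; lra.
Qed.

(** Each edge is divided between its ends by [fw_psi], so a vertex receives [psi] once per neighbour
    inside A. *)
Lemma exf_psi A : (forall u, u \in A -> (2 < deg u)%N) ->
  \sum_(u in A) (#|nb A u|%:R * psi (deg u) - 1) <= exf A.
Proof.
move=> dA; rewrite exfE /ex.
have e : \sum_(u in A) (#|nb A u|%:R * psi (deg u) - 1) =
  \sum_(u in A) (#|nb A u|%:R * psi (deg u)) - #|A|%:R.
  by rewrite big_split /= sumrN sumr_const.
rewrite e lerD2r ler_pdivlMr //.
have h : \sum_(x in A) \sum_(y in nb A x) (psi (deg x) + psi (deg y)) <= W (@ff G) A A.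
  apply: ler_sum => x xA; apply: ler_sum => y; rewrite in_nb => /andP[yA _].
  by apply: fw_psi; apply: dA.
have s1 : \sum_(x in A) \sum_(y in nb A x) psi (deg x) =
    \sum_(u in A) (#|nb A u|%:R * psi (deg u)).
  by apply: eq_bigr => x _; rewrite sumr_const -[psi (deg x) *+ _]mulr_natl.
have s2 : \sum_(x in A) \sum_(y in nb A x) psi (deg y) =
    \sum_(x in A) \sum_(y in nb A x) psi (deg x).
  rewrite (eq_bigr (fun x => \sum_(y in A) if adj x y then psi (deg y) else 0)).
    rewrite exchange_big /=; apply: eq_bigr => y _.
    rewrite -big_mkcondr /=; apply: eq_bigl => x.
    by rewrite in_nb adjC.
  move=> x _; rewrite -big_mkcondr /=; apply: eq_bigl => y.
  by rewrite in_nb.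
have : \sum_(x in A) \sum_(y in nb A x) (psi (deg x) + psi (deg y)) =
   \sum_(x in A) \sum_(y in nb A x) psi (deg x) +
   \sum_(x in A) \sum_(y in nb A x) psi (deg y).
  by rewrite -big_split /=; apply: eq_bigr => x _; rewrite -big_split.
by rewrite s2 s1 => e2; move: h; rewrite e2; lra.
Qed.

Lemma exf_cycle c : cyc c -> (forall u, u \in c -> (2 < deg u)%N) ->
  \sum_(u in cset c) (665 / 64 + delta (deg u)) <= exf (cset c).
Proof.
move=> cc dc; have dc' u : u \in cset c -> (2 < deg u)%N by rewrite in_cset; apply: dc.
apply: le_trans (exf_psi dc'); apply: ler_sum => u uc.
rewrite -psi_delta lerD2r; apply: ler_wpM2r; first exact/psi_ge0/dc'.
by rewrite (ler_nat _ 2) (cyc_nb cc) // -in_cset.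
Qed.

(** 421/5 lies just above the excess of the graphs A and B. The weaker bounds occur only if a
    3-vertex has a pendant neighbour, and then [poor_exf] applies. The last alternative comes from
    K4 minus an edge, whose central vertices have degree at least 4; apex number 5 needs this
    stronger form of [poor]. *)
Definition heavy_alt H := [\/ 421 / 5 <= exf H,
   165 / 2 <= exf H /\ exists u, poor H 3 u
 | 388 / 5 <= exf H /\ exists u, poor H 4 u].

End Bicyclic.

Section TwoCycles.
Variable G : sgraph.
Implicit Types (A B C D F H K L P T X Z : {set G}) (u v w x y z : G) (c : seq G).
Hypotheses (cG : conn [set: G]) (G3 : (2 < #|G|)%N).
Variable H : {set G}.
Hypotheses (cH : conn H) (hH : heavy H).

Lemma heavy_deg3 Z u y1 y2 : u \in H -> conn Z -> Z \subset H :\ u ->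
  y1 \in Z -> y2 \in Z -> y1 != y2 -> adj u y1 -> adj u y2 ->
  exists z, [/\ z \in H, z \notin u |: Z, adj u z & (2 < deg u)%N].
Proof.
move=> uH cZ ZH y1Z y2Z yy uy1 uy2.
have y1H := subsetP ZH _ y1Z; have y2H := subsetP ZH _ y2Z.
have nu : (1 < #|nb H u|)%N.
  apply/card_gt1P; exists y1, y2; rewrite !in_nb uy1 uy2.
  by move: y1H y2H; rewrite !in_setD1 => /andP[_ ->] /andP[_ ->].
have [z [zH zZ uz zu]] := heavy_private cH hH uH nu cZ ZH.
exists z; split=> //; first by rewrite in_setU1 negb_or zu.
have : (#|z |: [set y1; y2]| <= deg u)%N.
  apply/subset_leq_card/subsetP => t; rewrite !inE.
  by case/or3P => /eqP ->.
rewrite cardsU1 cards2 yy !inE negb_or.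
have nz t : t \in Z -> z != t by move=> tZ; apply: contraNneq zZ => ->.
by rewrite !nz.
Qed.

(** Only a 3-vertex with a pendant neighbour stays below 31/5; this is the situation in which [poor]
    becomes available. *)
Lemma private_num u z : (2 < deg u)%N -> adj u z ->
  19 / 8 <= ff u z - 1 + delta (deg u) /\
  (~ (deg u = 3%N /\ deg z = 1%N) -> 31 / 5 <= ff u z - 1 + delta (deg u)).
Proof.
move=> du uz.
have dz : (0 < deg z)%N by apply: (@adj_deg _ z u); rewrite adjC.
have [z1|z1] := leqP (deg z) 1.
  have {z1}z1 : deg z = 1%N by lia.
  have d4 : ~ (deg u = 3%N /\ deg z = 1%N) -> (4 <= deg u)%N.
    by move=> h; have : deg u != 3%N by [apply/eqP => e; apply: h]; lia.
  rewrite /ff z1 fwC in d4 *; split; first exact: pendant_delta.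
  by move=> h; apply: pendant_delta4; apply: d4.
have h8 := ff8 (ltnW du) z1; have := delta_ge0 du.
by split=> [|_]; lra.
Qed.

Lemma exf_ge_privates A P (p : G -> G) : A \subset H -> A != set0 -> P \subset A ->
  (forall u, u \in P -> [/\ p u \in H, p u \notin A & adj u (p u)]) ->
  exf A + \sum_(u in P) (ff u (p u) - 1) <= exf H.
Proof.
move=> AH A0 PA hp; apply: le_trans (exf_privates cG G3 PA _) _.
  by move=> u /hp[].
apply: exf_mono => //.
  rewrite subUset AH /=; apply/subsetP => _ /imsetP[u uP ->].
  by case: (hp u uP).
by case/set0Pn: A0 => a aA; apply/set0Pn; exists a; rewrite inE aA.
Qed.

Lemma exf_U_edge A B x y : [disjoint A & B] -> x \in A -> y \in B -> adj x y ->
  exf A + exf B + ff x y <= exf (A :|: B).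
Proof.
move=> d xA yB xy; rewrite !exfE (ex_U (@ffC G) d) lerD2l.
rewrite /W (bigD1 x) //=.
have := sum_nb_ge1 (ff1 cG G3) yB xy.
have : 0 <= \sum_(i in A | i != x) \sum_(y0 in nb B i) ff i y0; last by lra.
apply: sumr_ge0 => i _; apply: sumr_ge0 => t; rewrite in_nb => /andP[_ it].
by apply: le_trans (ff1 cG G3 it).
Qed.

Lemma exf_ge_m1 A : conn A -> -1 <= exf A.
Proof.
move=> cA; have [/set0Pn[a aA] _] := cA.
rewrite -(exf1 a); apply: exf_mono; rewrite ?sub1set //.
by apply/set0Pn; exists a; rewrite inE.
Qed.

Lemma cyc_two c g : cyc c -> exists u1 u2, [/\ u1 \in c, u2 \in c, u1 != g, u2 != g & u1 != u2].
Proof.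
move=> cc; have : (1 < #|cset c :\ g|)%N.
  have := cardsD1 g (cset c); rewrite card_cset //.
  by case/and3P: cc => h _ _; case: (_ \in _); lia.
case/card_gt1P => u1 [u2 []]; rewrite !in_setD1 !in_cset.
by move=> /andP[a1 b1] /andP[a2 b2] uu; exists u1, u2.
Qed.

(* A is the union of both cycles and of a path joining them, and E bounds the
   contribution of that path. *)
Lemma two_cycles_aux c1 c2 A (p : G -> G) (E : rat) u1 u2 u3 u4 :
  cyc c1 -> cyc c2 -> (forall u, u \in c1 -> (2 < deg u)%N) ->
  (forall u, u \in c2 -> (2 < deg u)%N) ->
  A \subset H -> cset c1 :|: cset c2 \subset A -> [disjoint cset c1 & cset c2] ->
  exf (cset c1) + exf (cset c2) + E <= exf A ->
  [/\ u1 \in c1, u2 \in c1 & u1 != u2] -> [/\ u3 \in c2, u4 \in c2 & u3 != u4] ->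
  (forall u, u \in [:: u1; u2; u3; u4] -> [/\ p u \in H, p u \notin A & adj u (p u)]) ->
  6 * (665 / 64) + E + \sum_(u <- [:: u1; u2; u3; u4]) (ff u (p u) - 1 + delta (deg u)) <= exf H.
Proof.
move=> cc1 cc2 d1 d2 AH cA dis hE [h1 h2 h12] [h3 h4 h34] hp.
have n1 u v : u \in c1 -> v \in c2 -> u != v.
  move=> uc vc; apply: contraTneq vc => <-.
  by move: dis; rewrite disjoint_subset => /subsetP/(_ u); rewrite !inE uc => /(_ isT).
pose P := [set u in [:: u1; u2; u3; u4]].
have uP : uniq [:: u1; u2; u3; u4].
  by rewrite /= !inE !negb_or h12 h34 !n1.
have PA : P \subset A.
  apply/subsetP => u; rewrite !inE => h; apply: (subsetP cA); rewrite inE !in_cset.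
  by case/or4P: h => /eqP ->; rewrite ?h1 ?h2 ?h3 ?h4 ?orbT.
have A0 : A != set0 by apply/set0Pn; exists u1; apply: (subsetP PA); rewrite !inE eqxx.
have hs (f : G -> rat) : \sum_(u in P) f u = \sum_(u <- [:: u1; u2; u3; u4]) f u.
  by rewrite big_uniq //=; apply: eq_bigl => u; rewrite inE.
have hpP : forall u, u \in P -> [/\ p u \in H, p u \notin A & adj u (p u)].
  by move=> u; rewrite in_set; apply: hp.
have := @exf_ge_privates A P p AH A0 PA hpP; rewrite hs.
have c1b := exf_cycle cc1 d1; have c2b := exf_cycle cc2 d2.
have sumD (r : rat) B (f : G -> rat) :
    \sum_(u in B) (r + f u) = #|B|%:R * r + \sum_(u in B) f u.
  by rewrite big_split /= sumr_const mulr_natl.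
have two (r : rat) c (v1 v2 : G) : 0 <= r -> cyc c ->
   (forall u, u \in c -> (2 < deg u)%N) ->
   v1 \in c -> v2 \in c -> v1 != v2 ->
   3 * r + delta (deg v1) + delta (deg v2) <=
   \sum_(u in cset c) (r + delta (deg u)).
  move=> r0 cc dc v1c v2c vv.
  have sc : (3%:R : rat) <= #|cset c|%:R.
    by rewrite ler_nat card_cset //; case/and3P: cc.
  rewrite sumD (bigD1 v1) ?in_cset // (bigD1 v2) /=; last by rewrite in_cset v2c eq_sym.
  have : 0 <= \sum_(i | (i \in cset c) && (i != v1) && (i != v2)) delta (deg i).
    by apply: sumr_ge0 => i /andP[/andP[]]; rewrite in_cset => ic _ _; apply/delta_ge0/dc.
  have := ler_wpM2r r0 sc; lra.
have r0 : 0 <= 665 / 64 :> rat by lra.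
have t1 := two _ c1 u1 u2 r0 cc1 d1 h1 h2 h12; have t2 := two _ c2 u3 u4 r0 cc2 d2 h3 h4 h34.
rewrite !big_cons !big_nil; lra.
Qed.

End TwoCycles.

Section TwoCycles2.
Variable G : sgraph.
Implicit Types (A B C D F H K L P T X Z : {set G}) (u v w x y z : G) (c : seq G).
Hypotheses (cG : conn [set: G]) (G3 : (2 < #|G|)%N).
Variable H : {set G}.
Hypotheses (cH : conn H) (hH : heavy H).

Lemma cyc_private c u Z : cyc c -> cset c \subset H -> u \in c -> conn Z ->
  cset c :\ u \subset Z -> Z \subset H :\ u ->
  exists z, [/\ z \in H, z \notin u |: Z, adj u z &
    deg u = 3%N -> deg z = 1%N -> poor H 3 u].
Proof.
move=> cc cs uc cZ cuZ ZH.
have [nc pc an ap [np nv pv]] := cyc_next cc uc.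
have inZ v : v \in c -> v != u -> v \in Z.
  by move=> vc vu; apply: (subsetP cuZ); rewrite in_setD1 vu in_cset.
have nZ := inZ _ nc nv; have pZ := inZ _ pc pv.
have uH := cyc_in cs uc.
have [z [zH zZ uz d3]] := heavy_deg3 cH hH uH cZ ZH nZ pZ np an ap.
exists z; split=> // du dz.
have zZ' : z \notin Z by move: zZ; rewrite in_setU1 negb_or => /andP[].
by apply: (mk_poor cH uH zH cZ ZH zZ' nZ pZ np uz an ap du dz);
  apply: (heavy_cyc_deg cH cc cs hH).
Qed.

(** Two vertices on each cycle, away from the ends of a connection between the cycles, have private
    neighbours outside the union A of the cycles and the connection. The four private edges and the
    connection bring the sum to the required bound. *)
Lemma two_cycles c1 c2 : cyc c1 -> cyc c2 -> cset c1 \subset H ->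
  cset c2 \subset H -> [disjoint cset c1 & cset c2] -> heavy_alt H.
Proof.
move=> cc1 cc2 cs1 cs2 dis.
have d1 u : u \in c1 -> (2 < deg u)%N by apply: (heavy_cyc_deg cH cc1 cs1 hH).
have d2 u : u \in c2 -> (2 < deg u)%N by apply: (heavy_cyc_deg cH cc2 cs2 hH).
have n12 x : x \in c2 -> x \notin cset c1.
  move=> xc; rewrite disjoint_sym in dis.
  by move: dis; rewrite disjoint_subset => /subsetP/(_ x); rewrite in_cset; apply.
have [x2 x2c] : exists x, x \in c2.
  by have [x] := set0Pn _ (cset0 cc2); rewrite in_cset; exists x.
have x2H : x2 \in H :\: cset c1 by rewrite in_setD n12 //= (cyc_in cs2).
(* [K] is the part of H beyond the first cycle that contains the second one, and [g] is where an
   edge from [K] enters the first cycle. *)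
pose K := gcomp (H :\: cset c1) x2.
have cK : conn K := conn_gcomp x2H.
have KH : K \subset H :\: cset c1 := gcomp_sub x2H.
have KH' : K \subset H := subset_trans KH (subsetDl _ _).
have c2K : cset c2 \subset K.
  apply: conn_sub_gcomp; [exact: conn_cset| |by rewrite in_cset].
  by apply/subsetP => x; rewrite in_cset => xc; rewrite in_setD n12 //= (cyc_in cs2).
have K1 x : x \in K -> x \notin cset c1 by move=> /(subsetP KH); rewrite in_setD => /andP[].
have clK : closed_in (H :\: cset c1) K := gcomp_closed x2H.
have [x1 x1c] : exists x, x \in c1.
  by have [x] := set0Pn _ (cset0 cc1); rewrite in_cset; exists x.
have [|k [g [kK gH gK kg]]] := conn_exit cH KH' (proj1 cK).
  by apply: contraTneq (cyc_in cs1 x1c) => <-; apply/negP => /K1; rewrite in_cset x1c.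
have gc : g \in c1.
  rewrite -in_cset; apply: contraT => gn; case/negP: gK; apply: (clK k) => //.
  by rewrite in_setD gn.
have priv1 u : u \in c1 -> u != g -> exists z, [/\ z \in H, z \notin cset c1 :|: K,
    adj u z & deg u = 3%N -> deg z = 1%N -> poor H 3 u].
  move=> uc ug; pose Z := (cset c1 :\ u) :|: K.
  have uK : u \notin K by apply/negP => /K1; rewrite in_cset uc.
  have cZ : conn Z.
    apply: (conn_union (cyc_conn_D1 cc1 uc) cK _ kK (x := g)).
      by rewrite in_setD1 eq_sym ug in_cset.
    by rewrite adjC kg orbT.
  have ZH : Z \subset H :\ u.
    rewrite subUset setSD //=; apply/subsetP => t tK.
    by rewrite in_setD1 (subsetP KH') // andbT; apply: contraNneq uK => <-.
  have [z [zH zZ uz pz]] := cyc_private cc1 cs1 uc cZ (subsetUl _ _) ZH.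
  exists z; split=> //; move: zZ; rewrite setUA setD1K //.
  by rewrite in_cset.
have inK u z : u \in c2 -> z \in H -> z \notin cset c1 -> adj u z -> z \in K.
  move=> uc zH z1 uz; apply: (clK u) => //; last by rewrite in_setD z1.
  by apply: (subsetP c2K); rewrite in_cset.
(* Private neighbours of the first cycle avoid all of [K]. Those of the second cycle may lie in [K],
   so A is chosen smaller there, and [h] is the vertex at which the connection meets the second
   cycle. *)
suff [A [h [E [sA [cA hA [hE hpriv]]]]]] : exists A h (E : rat),
    A \subset cset c1 :|: K /\ [/\ cset c1 :|: cset c2 \subset A,
      exf (cset c1) + exf (cset c2) + E <= exf A & 
      fw 3 3 <= E /\ forall u, u \in c2 -> u != h -> exists z, 
      [/\ z \in H, z \notin A, adj u z & deg u = 3%N -> deg z = 1%N -> poor H 3 u]].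
  have [u1 [u2 [u1c u2c u1g u2g u12]]] := cyc_two G3 g cc1.
  have [u3 [u4 [u3c u4c u3h u4h u34]]] := cyc_two G3 h cc2.
  have [p1 [p1H p1N a1 q1]] := priv1 u1 u1c u1g.
  have [p2 [p2H p2N a2 q2]] := priv1 u2 u2c u2g.
  have [p3 [p3H p3N a3 q3]] := hpriv u3 u3c u3h.
  have [p4 [p4H p4N a4 q4]] := hpriv u4 u4c u4h.
  have n1 u v : u \in c1 -> v \in c2 -> (v == u) = false.
    move=> uc vc; apply/eqP => e; have := n12 v vc; rewrite e in_cset uc; by [].
  pose p u := if u == u1 then p1 else if u == u2 then p2 else if u == u3 then p3 else p4.
  have e1 : p u1 = p1 by rewrite /p eqxx.
  have e2 : p u2 = p2 by rewrite /p eqxx eq_sym (negbTE u12).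
  have e3 : p u3 = p3 by rewrite /p eqxx !n1.
  have e4 : p u4 = p4 by rewrite /p (n1 u1 u4) // (n1 u2 u4) // eq_sym (negbTE u34).
  have AH : A \subset H.
    by apply: subset_trans sA _; rewrite subUset cs1.
  have nA z : z \notin cset c1 :|: K -> z \notin A by apply: contra; apply: (subsetP sA).
  have hp u : u \in [:: u1; u2; u3; u4] -> [/\ p u \in H, p u \notin A & adj u (p u)].
    by rewrite !inE => /or4P[] /eqP ->; rewrite ?e1 ?e2 ?e3 ?e4; split=> //; apply: nA.
  have := two_cycles_aux cG G3 cH cc1 cc2 d1 d2 AH cA dis hA
    (And3 u1c u2c u12) (And3 u3c u4c u34) hp.
  rewrite !big_cons big_nil e1 e2 e3 e4.
  have pr v z : (2 < deg v)%N -> adj v z -> (deg v = 3%N -> deg z = 1%N -> poor H 3 v) ->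
      19 / 8 <= ff v z - 1 + delta (deg v) /\
      ((exists u, poor H 3 u) \/ 31 / 5 <= ff v z - 1 + delta (deg v)).
    move=> dv vz q; have [r1 r2] := private_num G3 dv vz; split; first exact: r1.
    case: (eqVneq (deg v) 3%N) => [e|ne]; last first.
      by right; apply: r2 => -[e _]; rewrite e in ne.
    case: (eqVneq (deg z) 1%N) => [f|nf]; last first.
      by right; apply: r2 => -[_ f]; rewrite f in nf.
    by left; exists v; apply: q.
  have [b1 r1] := pr _ _ (d1 _ u1c) a1 q1.
  have [b2 r2] := pr _ _ (d1 _ u2c) a2 q2.
  have [b3 r3] := pr _ _ (d2 _ u3c) a3 q3.
  have [b4 r4] := pr _ _ (d2 _ u4c) a4 q4.
  move=> big; have hE1 : 729 / 64 <= E by rewrite -fw33.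
  have hi : (exists u, poor H 3 u) -> heavy_alt H.
    by move=> hp'; apply: Or32; split; [move: big hE1 b1 b2 b3 b4; lra|exact: hp'].
  case: r1 => [|r1]; first exact: hi.
  case: r2 => [|r2]; first exact: hi.
  case: r3 => [|r3]; first exact: hi.
  case: r4 => [|r4]; first exact: hi.
  by apply: Or31; move: big hE1 r1 r2 r3 r4; lra.
have dK : [disjoint cset c1 & K].
  by rewrite disjoint_sym disjoint_subset; apply/subsetP => t /K1.
have gK1 : adj g k by rewrite adjC.
(* If [k] is on the second cycle, the edge from [g] to [k] is the whole connection; otherwise the
   connection goes through the component [K'] of [k] in [K] minus that cycle. *)
have [kc|kc] := boolP (k \in c2).
  exists (cset c1 :|: cset c2), k, (ff g k); split; first by rewrite setUS.
  split; [by []| |split].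
  - apply: (exf_U_edge cG G3 dis _ _ gK1); by rewrite in_cset.
  - by apply: fw_mono; [apply: (d1 g gc)|apply: (d2 k kc)].
  move=> u uc uk; pose Z := (cset c2 :\ u) :|: cset c1.
  have cZ : conn Z.
    apply: (conn_union (cyc_conn_D1 cc2 uc) (conn_cset cc1) (x := k) (y := g)).
    - by rewrite in_setD1 eq_sym uk in_cset.
    - by rewrite in_cset.
    by rewrite kg orbT.
  have ZH : Z \subset H :\ u.
    rewrite subUset setSD //=; apply/subsetP => t tc.
    rewrite in_setD1 (subsetP cs1) // andbT; apply: contraTneq tc => ->.
    exact: n12.
  have [z [zH zZ uz pz]] := cyc_private cc2 cs2 uc cZ (subsetUl _ _) ZH.
  exists z; split=> //; move: zZ; rewrite setUA setD1K ?in_cset //.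
  by rewrite setUC.
have kK2 : k \in K :\: cset c2 by rewrite in_setD in_cset kc.
pose K' := gcomp (K :\: cset c2) k.
have cK' : conn K' := conn_gcomp kK2.
have K'K : K' \subset K :\: cset c2 := gcomp_sub kK2.
have K'K' : K' \subset K := subset_trans K'K (subsetDl _ _).
have clK' : closed_in (K :\: cset c2) K' := gcomp_closed kK2.
have [|k' [h [k'K hK hK' k'h]]] := conn_exit cK K'K' (proj1 cK').
  apply: contraTneq (subsetP c2K x2 _) => [<-|]; last by rewrite in_cset.
  by apply/negP => /(subsetP K'K); rewrite in_setD in_cset x2c.
have hc : h \in c2.
  rewrite -in_cset; apply: contraT => hn; case/negP: hK'; apply: (clK' k') => //.
  by rewrite in_setD hn.
have d2K' : [disjoint cset c2 & K'].
  rewrite disjoint_sym disjoint_subset; apply/subsetP => t /(subsetP K'K).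
  by rewrite in_setD => /andP[].
have kK' : k \in K' := gcomp_id _ _.
have hg : h != g by apply: contraTneq hc => ->; apply/negP => /n12; rewrite in_cset gc.
(* Both edges at the ends of the connection weigh at least 8. As the excess of [K'] is at least -1,
   together they give at least 15, more than fw 3 3. *)
have dk : (1 < deg k)%N /\ (1 < deg k')%N.
  case: (eqVneq k k') => [e|ne].
    by rewrite -e; split; apply: (@deg_ge2 _ k g h) => //; rewrite ?e // eq_sym.
  have K2 : (1 < #|K'|)%N by apply/card_gt1P; exists k, k'.
  have [s sK ks] := conn_nb cK' K2 kK'; have [s' sK' ks'] := conn_nb cK' K2 k'K.
  split.
    apply: (@deg_ge2 _ k g s) => //; apply: contraNneq gK => ->.
    exact: (subsetP K'K').
  apply: (@deg_ge2 _ k' h s') => //; apply: contraNneq hK' => ->.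
  by [].
exists (cset c1 :|: (cset c2 :|: K')), h, (ff g k + ff h k' - 1); split.
  by rewrite setUS // subUset c2K.
split; [by rewrite setUS // subsetUl| |split].
- have d1' : [disjoint cset c1 & cset c2 :|: K'].
    rewrite disjoint_sym disjoint_subset; apply/subsetP => t.
    rewrite in_setU => /orP[tc|/(subsetP K'K')/K1 //].
    by apply: n12; rewrite -in_cset.
  have kU : k \in cset c2 :|: K' by rewrite in_setU kK' orbT.
  have gc' : g \in cset c1 by rewrite in_cset.
  have hc' : h \in cset c2 by rewrite in_cset.
  have hk' : adj h k' by rewrite adjC.
  have := exf_U_edge cG G3 d1' gc' kU gK1.
  have := exf_U_edge cG G3 d2K' hc' k'K hk'.
  have := exf_ge_m1 cG G3 cK'; lra.
- have := ff8 (ltnW (d1 g gc)) dk.1; have := ff8 (ltnW (d2 h hc)) dk.2; rewrite fw33; lra.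
move=> u uc uh; pose Z := (cset c2 :\ u) :|: (K' :|: cset c1).
have cKc : conn (K' :|: cset c1).
  apply: (conn_union cK' (conn_cset cc1) kK' (y := g)); first by rewrite in_cset.
  by rewrite kg orbT.
have cZ : conn Z.
  apply: (conn_union (cyc_conn_D1 cc2 uc) cKc (x := h) (y := k')).
  - by rewrite in_setD1 eq_sym uh in_cset.
  - by rewrite in_setU k'K.
  by rewrite adjC k'h orbT.
have ZH : Z \subset H :\ u.
  rewrite subUset setSD //=; apply/subsetP => t.
  rewrite in_setD1 in_setU => /orP[tK|tc].
    rewrite (subsetP KH') ?(subsetP K'K') // andbT; apply: contraTneq tK => ->.
    by apply/negP => /(subsetP K'K); rewrite in_setD in_cset uc.
  rewrite (subsetP cs1) // andbT; apply: contraTneq tc => ->.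
  exact: n12.
have [z [zH zZ uz pz]] := cyc_private cc2 cs2 uc cZ (subsetUl _ _) ZH.
exists z; split=> //; move: zZ; rewrite [u |: _]setUA setD1K; last by rewrite in_cset.
by rewrite setUA setUC.
Qed.

End TwoCycles2.

Lemma sum_ge1 (I : finType) (A : {set I}) (f : I -> rat) (X : rat) a n :
  a \in A -> (n < #|A|)%N -> 0 <= X ->
  (forall u, u \in A -> u != a -> X <= f u) ->
  f a + n%:R * X <= \sum_(u in A) f u.
Proof.
move=> aA nA X0 h; rewrite (bigD1 a aA) /= lerD2l.
apply: (@le_trans _ _ (\sum_(i in A :\ a) X)).
  rewrite sumr_const -[X *+ _]mulr_natl; apply: ler_wpM2r => //.
  by rewrite ler_nat; move: nA; rewrite (cardsD1 a A) aA.
have e i : (i \in A :\ a) = (i \in A) && (i != a) by rewrite in_setD1 andbC.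
rewrite (eq_bigl _ _ e); apply: ler_sum => i /andP[iA ia]; exact: h.
Qed.

Lemma sum_ge2 (I : finType) (A : {set I}) (f : I -> rat) (X : rat) a b n :
  a \in A -> b \in A -> a != b -> (n.+1 < #|A|)%N -> 0 <= X ->
  (forall u, u \in A -> u != a -> u != b -> X <= f u) ->
  f a + (f b + n%:R * X) <= \sum_(u in A) f u.
Proof.
move=> aA bA ab nA X0 h; rewrite (bigD1 a aA) /= lerD2l.
have e i : (i \in A) && (i != a) = (i \in A :\ a) by rewrite in_setD1 andbC.
rewrite (eq_bigl _ _ e).
apply: sum_ge1 => //.
- by rewrite in_setD1 eq_sym ab.
- by move: nA; rewrite (cardsD1 a A) aA.
by move=> u; rewrite in_setD1 => /andP[ua uA] ub; apply: h.
Qed.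

Lemma fw44_num (d e : nat) : (4 <= d)%N -> (4 <= e)%N ->
  512 / 27 <= fw d e /\ (d = 4%N /\ e = 4%N \/ 23 <= fw d e).
Proof.
move=> d4 e4; have h5 : (20 / 7) ^+ 3 = fw 4 5 by rewrite unlock hwE; field.
have h45 m n : (4 <= m)%N -> (5 <= n)%N -> fw 4 5 <= fw m n.
  by move=> h1 h2; apply: fw_mono; [exact: h1|exact: h2].
have b5 : 23 <= fw 4 5 by rewrite -h5; lra.
split; first by rewrite -fw44; apply: fw_mono; [exact: d4|exact: e4].
case: (ltnP 4 d) => [d5|dl].
  by right; apply: le_trans b5 _; rewrite (fwC d); apply: h45.
case: (ltnP 4 e) => [e5|el]; first by right; apply: le_trans b5 _; apply: h45.
left; split; apply/eqP; rewrite eqn_leq; apply/andP; split; assumption.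
Qed.

(* In K4 minus an edge, a and b are the degrees of the two vertices of the
   central edge; the bounded quantity is the contribution of a third vertex, of
   degree d, with a neighbour of degree e outside. *)
Lemma K4e_num (a b d e : nat) : (4 <= a)%N -> (4 <= b)%N -> (3 <= d)%N -> (0 < e)%N ->
  29 <= fw d a + fw d b - 1 + (fw d e - 1) /\
  (d = 3%N /\ e = 1%N \/ 841 / 25 <= fw d a + fw d b - 1 + (fw d e - 1)).
Proof.
move=> a4 b4 d3 e0.
have m n x : (3 <= n)%N -> (4 <= x)%N -> (n <= d)%N -> fw n 4 <= fw d x.
  by move=> h1 h2 h3; apply: fw_mono; apply/andP; split=> //; apply: ltnW.
have fa := m 3%N a isT a4 d3; have fb := m 3%N b isT b4 d3.
have ga := m 4%N a isT a4; have gb := m 4%N b isT b4.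
have F1 : (1 < e)%N -> 8 <= fw d e by move=> h; apply: fw_ge8 => //; apply: ltnW.
have F2 : 1 <= fw d e by apply: fw_ge1; lia.
have E1 : d = 3%N -> e = 1%N -> fw d e = 27 / 8 by move=> -> ->; rewrite fwC fw13.
have [d4|dl] := ltnP 3 d.
  by have := ga d4; have := gb d4; rewrite fw44 => h1 h2; split; [|right]; lra.
have d3' : d = 3%N by apply/eqP; rewrite eqn_leq dl d3.
rewrite fw34 in fa fb.
have [e2|el] := ltnP 1 e.
  by have h := F1 e2; split; [|right]; lra.
have e1 : e = 1%N by apply/eqP; rewrite eqn_leq el e0.
have h := E1 d3' e1; split; last (left; split; [exact: d3'|exact: e1]).
lra.
Qed.

Section Theta.
Variable G : sgraph.
Implicit Types (A B C D F H K L P S T X Z : {set G}) (a b u v w x y z : G) (c : seq G).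
Hypotheses (cG : conn [set: G]) (G3 : (2 < #|G|)%N).

Lemma nb_conn H u : conn H -> (1 < #|H|)%N -> u \in H -> (0 < #|nb H u|)%N.
Proof.
move=> cH h uH; have [y yH uy] := conn_nb cH h uH.
by apply/card_gt0P; exists y; rewrite in_nb yH.
Qed.

Lemma nbU_disj A B u : [disjoint A & B] -> (#|nb (A :|: B) u| = #|nb A u| + #|nb B u|)%N.
Proof.
move=> d; have -> : nb (A :|: B) u = nb A u :|: nb B u.
  by apply/setP => y; rewrite in_setU !in_nb in_setU andb_orl.
rewrite cardsU (_ : _ :&: _ = set0) ?cards0 ?subn0 //.
apply/setP => y; rewrite in_setI !in_nb in_set0; apply/negbTE/negP.
case/andP => /andP[yA _] /andP[yB _].
by move: d; rewrite disjoint_subset => /subsetP/(_ y yA); rewrite inE yB.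
Qed.

(** * Minimal connected sets with more edges than vertices *)

Section Minimal.
Variable Q : {set G}.
Hypotheses (cQ : conn Q) (eQ : (#|Q| < en Q)%N).
Hypothesis minQ : forall S, S \subset Q -> conn S -> (#|S| < en S)%N -> (#|Q| <= #|S|)%N.
Hypothesis one_cyc : forall A B, A \subset Q -> B \subset Q -> [disjoint A & B] ->
  A != set0 -> B != set0 -> (#|A| <= en A)%N -> (#|B| <= en B)%N -> False.

Lemma min_proper S : S \subset Q -> conn S -> (#|S| < #|Q|)%N -> (en S <= #|S|)%N.
Proof. by move=> SQ cS lt; rewrite leqNgt; apply/negP => h; have := minQ SQ cS h; lia. Qed.

Lemma min_gt1 : (1 < #|Q|)%N.
Proof.
have [/set0Pn[u uQ] _] := cQ; rewrite ltnNge; apply/negP => le.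
have e : Q = [set u].
  by apply/esym/eqP; rewrite eqEcard sub1set uQ cards1.
by move: eQ; rewrite e en1.
Qed.

Lemma min_nb2 u : u \in Q -> (1 < #|nb Q u|)%N.
Proof.
move=> uQ; rewrite ltnNge; apply/negP => le.
have n1 : #|nb Q u| = 1%N by have := nb_conn cQ min_gt1 uQ; lia.
have /eqP/cards1P[w nw] := n1.
have [wQ uw] := nb_set1P nw.
have cD : conn (Q :\ u).
  by apply: (@conn_del_pendant _ Q w u) => //; rewrite ?nw // adj_neq.
have := min_proper (subD1set _ _) cD; have := cardsD1 u Q; have := en_D1 uQ.
by rewrite uQ n1; lia.
Qed.

(** The two sides of a cut vertex, each together with u, are connected and smaller, so neither has
    more edges than vertices. If u had only one neighbour on one side, that side without u would
    still contain a cycle, disjoint from one in the other side with u. *)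
Lemma min_cut u : u \in Q -> ~ conn (Q :\ u) -> (3 < #|nb Q u|)%N.
Proof.
move=> uQ ncD; have n2 := min_nb2 uQ.
have /card_gt0P[x xN] : (0 < #|nb Q u|)%N by apply: ltnW.
have xD : x \in Q :\ u by rewrite -nbD1 in xN; apply: (subsetP (nb_sub _ u)).
pose A := gcomp (Q :\ u) x; pose B := (Q :\ u) :\: A.
have sA : A \subset Q :\ u := gcomp_sub xD.
have sB : B \subset Q :\ u := subsetDl _ _.
have clA : closed_in (Q :\ u) A := gcomp_closed xD.
have iB t : (t \in B) = (t \notin A) && (t \in Q :\ u) by rewrite /B in_setD.
have clB : closed_in (Q :\ u) B.
  move=> p q; rewrite !iB => /andP[pA pD] qD pq; rewrite qD andbT.
  by apply: contra pA => qA; apply: (clA q) => //; rewrite adjC.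
have A0 : A != set0 by apply/set0Pn; exists x; apply: gcomp_id.
have B0 : B != set0.
  apply: contra_notN ncD => /eqP B0; have <- : A = Q :\ u; last exact: conn_gcomp.
  by apply/eqP; rewrite eqEsubset sA -setD_eq0 -/B B0 eqxx.
have dAB : [disjoint A & B].
  by rewrite disjoint_subset; apply/subsetP => t tA; rewrite inE iB tA.
have UAB : A :|: B = Q :\ u.
  apply/setP => t; rewrite in_setU iB.
  by case: (boolP (t \in A)) => [/(subsetP sA) ->|].
have uA : u \notin A by apply/negP => /(subsetP sA); rewrite in_setD1 eqxx.
have uB : u \notin B by apply/negP => /(subsetP sB); rewrite in_setD1 eqxx.
have cA := conn_cut cQ uQ sA clA; have cB := conn_cut cQ uQ sB clB.
have cr0 : cross A B = 0%N.
  rewrite /cross big1 // => p pA; apply/eqP; rewrite cards_eq0; apply/set0Pn => -[q].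
  rewrite in_nb => /andP[qB pq]; have qA := clA _ _ pA (subsetP sB q qB) pq.
  by move: qB; rewrite iB qA.
have eD := en_U dAB; rewrite UAB cr0 addn0 in eD.
have rD := nbU_disj u dAB; rewrite UAB nbD1 in rD.
have eu := en_D1 uQ.
have cardQ : #|Q| = (#|A| + #|B|).+1.
  by rewrite (cardsD1 u Q) uQ -UAB cardsU (disjoint_setI0 dAB) cards0 subn0.
have pA : (0 < #|A|)%N by rewrite card_gt0.
have pB : (0 < #|B|)%N by rewrite card_gt0.
have sub1 S : S \subset Q :\ u -> u |: S \subset Q.
  by move=> h; rewrite subUset sub1set uQ (subset_trans h (subD1set _ _)).
have leA := min_proper (sub1 _ sA) cA; have leB := min_proper (sub1 _ sB) cB.
have eA := en_add uA; have eB := en_add uB.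
rewrite !cardsU1 uA uB cardQ /= in leA leB.
have rA : (0 < #|nb A u|)%N.
  by rewrite -[nb A u](_ : nb (u |: A) u = _) ?nb_conn ?cardsU1 ?uA ?inE ?eqxx //= -nbD1 setU1K.
have rB : (0 < #|nb B u|)%N.
  by rewrite -[nb B u](_ : nb (u |: B) u = _) ?nb_conn ?cardsU1 ?uB ?inE ?eqxx //= -nbD1 setU1K.
(* With a single edge from u to A, the edge counts force both A and the other side with u to have as
   many edges as vertices. *)
have nA1 : #|nb A u| != 1%N.
  apply/eqP => h; apply: (@one_cyc A (u |: B)) => //.
  - exact: subset_trans sA (subD1set _ _).
  - exact: sub1.
  - by rewrite disjoint_sym disjoint_subset; apply/subsetP => t; rewrite in_setU1 => /orP[/eqP ->|tB];
      rewrite inE //; move: tB; rewrite iB => /andP[].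
  - by apply/set0Pn; exists u; rewrite !inE eqxx.
  - lia.
  - rewrite cardsU1 uB /=; lia.
have nB1 : #|nb B u| != 1%N.
  apply/eqP => h; apply: (@one_cyc B (u |: A)) => //.
  - exact: subset_trans sB (subD1set _ _).
  - exact: sub1.
  - rewrite disjoint_subset; apply/subsetP => t tB; rewrite inE in_setU1 negb_or.
    by move: (tB); rewrite iB => /andP[-> _]; rewrite andbT; apply: contraNneq uB => <-.
  - by apply/set0Pn; exists u; rewrite !inE eqxx.
  - lia.
  - rewrite cardsU1 uA /=; lia.
lia.
Qed.

End Minimal.
End Theta.

Lemma fw4_ge e : (0 < e)%N -> 64 / 27 <= fw 4 e.
Proof.
case: e => [h|[_|e _]]; [discriminate h|rewrite fwC fw14; exact: lexx|].
by have := @fw_ge8 4 e.+2 isT isT; lra.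
Qed.

Section Heavy.
Variable G : sgraph.
Implicit Types (A B C D F H K L P S T X Z : {set G}) (a b u v w x y z : G) (c : seq G).
Hypotheses (cG : conn [set: G]) (G3 : (2 < #|G|)%N).
Variable H : {set G}.
Hypotheses (cH : conn H) (hH : heavy H).

Section MinimalHeavy.
Variable Q : {set G}.
Hypotheses (QH : Q \subset H) (cQ : conn Q) (eQ : (#|Q| < en Q)%N).
Hypothesis minQ : forall S, S \subset Q -> conn S -> (#|S| < en S)%N -> (#|Q| <= #|S|)%N.
Hypothesis one_cyc : forall A B, A \subset Q -> B \subset Q -> [disjoint A & B] ->
  A != set0 -> B != set0 -> (#|A| <= en A)%N -> (#|B| <= en B)%N -> False.

Lemma Q_private u : u \in Q -> conn (Q :\ u) ->
  exists z, [/\ z \in H, z \notin Q, adj u z & (#|nb Q u| < deg u)%N].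
Proof.
move=> uQ cD; have uH := subsetP QH u uQ.
have n2 : (1 < #|nb H u|)%N.
  by apply: leq_trans (min_nb2 G3 cQ eQ minQ uQ) _; apply/subset_leq_card/nbS.
have [z [zH zN uz zu]] := heavy_private cH hH uH n2 cD (setSD _ QH).
have zQ : z \notin Q by move: zN; rewrite in_setD1 zu.
exists z; split=> //.
have : (#|z |: nb Q u| <= deg u)%N.
  apply/subset_leq_card/subsetP => t; rewrite in_setU1 in_nb inE.
  by case/orP => [/eqP ->|/andP[]].
by rewrite cardsU1 in_nb (negbTE zQ).
Qed.

Lemma Q_small_conn u : u \in Q -> (#|nb Q u| <= 3)%N -> conn (Q :\ u).
Proof.
move=> uQ r3; case: (connP (Q :\ u)) => // nc.
by have := min_cut G3 cQ eQ minQ one_cyc uQ nc; rewrite ltnNge r3.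
Qed.

Lemma Q_deg u : u \in Q -> (2 < deg u)%N /\ ((2 < #|nb Q u|)%N -> (3 < deg u)%N).
Proof.
move=> uQ; have n2 := min_nb2 G3 cQ eQ minQ uQ; have nd := nb_leq_deg Q u.
have [r3|r4] := leqP #|nb Q u| 3; last by split; lia.
have [z [_ _ _ lt]] := Q_private uQ (Q_small_conn uQ r3).
by split; lia.
Qed.

(** The value u is a dummy for the case without private neighbour; [p_private] excludes that case
    for vertices with at most three neighbours in Q. *)
Let p u := odflt u [pick z | [&& z \in H, z \notin Q & adj u z]].

Lemma p_private u : u \in Q -> (#|nb Q u| <= 3)%N ->
  [/\ p u \in H, p u \notin Q & adj u (p u)].
Proof.
move=> uQ r3; have [z [zH zQ uz _]] := Q_private uQ (Q_small_conn uQ r3).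
rewrite /p; case: pickP => [t /and3P[]|/(_ z)] //.
by rewrite zH zQ uz.
Qed.

Lemma Q_poor n u y1 y2 : u \in Q -> (#|nb Q u| <= 3)%N -> y1 \in Q -> y2 \in Q ->
  y1 != y2 -> adj u y1 -> adj u y2 -> deg u = 3%N -> deg (p u) = 1%N ->
  (n <= deg y1)%N -> (n <= deg y2)%N -> poor H n u.
Proof.
move=> uQ r3 y1Q y2Q yy uy1 uy2 du dp n1 n2.
have [pH pQ up] := p_private uQ r3.
have inD y : y \in Q -> adj u y -> y \in Q :\ u.
  by move=> yQ uy; rewrite in_setD1 yQ eq_sym adj_neq.
apply: (@mk_poor G H (Q :\ u) u (p u) y1 y2 n) => //.
- exact: (subsetP QH).
- exact: Q_small_conn.
- exact: setSD.
- by rewrite in_setD1 negb_and pQ orbT.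
- exact: inD.
- exact: inD.
Qed.

Lemma Q_two_nb u : u \in Q -> exists y1 y2,
  [/\ y1 \in Q, y2 \in Q, y1 != y2, adj u y1 & adj u y2].
Proof.
move=> uQ; case/card_gt1P: (min_nb2 G3 cQ eQ minQ uQ) => y1 [y2 []].
by rewrite !in_nb => /andP[? ?] /andP[? ?] ?; exists y1, y2.
Qed.

Lemma Q_poor3 u : u \in Q -> (#|nb Q u| <= 3)%N -> deg u = 3%N ->
  deg (p u) = 1%N -> poor H 3 u.
Proof.
move=> uQ r3 du dp; have [y1 [y2 [y1Q y2Q yy u1 u2]]] := Q_two_nb uQ.
by apply: (Q_poor uQ r3 y1Q y2Q yy u1 u2 du dp); [case: (Q_deg y1Q)|case: (Q_deg y2Q)].
Qed.

(** The share of u in the excess of Q together with the private neighbours. Vertices with four or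
    more neighbours in Q may be cut vertices, so no private neighbour is claimed for them; their
    edges inside Q suffice. *)
Let ch u : rat := #|nb Q u|%:R * psi (deg u) - 1 +
  (if (#|nb Q u| <= 3)%N then ff u (p u) - 1 else 0).

Lemma ch_sum : \sum_(u in Q) ch u <= exf H.
Proof.
pose P := [set u in Q | (#|nb Q u| <= 3)%N].
have PQ : P \subset Q by apply/subsetP => u; rewrite inE => /andP[].
have hp u : u \in P -> [/\ p u \in H, p u \notin Q & adj u (p u)].
  by rewrite inE => /andP[uQ r3]; apply: p_private.
have := exf_ge_privates cG G3 cH QH (proj1 cQ) PQ hp.
have := exf_psi (fun u uQ => proj1 (Q_deg uQ)).
have -> : \sum_(u in Q) ch u = \sum_(u in Q) (#|nb Q u|%:R * psi (deg u) - 1) +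
    \sum_(u in P) (ff u (p u) - 1).
  rewrite /ch big_split /= -big_mkcondr /=; congr (_ + _).
  by apply: eq_bigl => u; rewrite inE.
lra.
Qed.

Lemma ch4 u : u \in Q -> (3 < #|nb Q u|)%N -> 63 / 2 <= ch u.
Proof.
move=> uQ r4; rewrite /ch leqNgt r4 /= addr0.
have d4 := (proj2 (Q_deg uQ)) (ltnW r4).
have P := psi4_ge d4.
have R : 4 <= #|nb Q u|%:R :> rat by rewrite (ler_nat _ 4).
nra.
Qed.

Lemma p_deg u : u \in Q -> (#|nb Q u| <= 3)%N -> (0 < deg (p u))%N.
Proof.
move=> uQ r3; have [_ _ up] := p_private uQ r3.
by apply: (@adj_deg _ _ u); rewrite adjC.
Qed.

Lemma ch3 u : u \in Q -> #|nb Q u| = 3%N -> 247 / 10 <= ch u.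
Proof.
move=> uQ r3; have p0 : (0 < deg (p u))%N by apply: p_deg; rewrite ?r3.
rewrite /ch r3 leqnn; apply: psi3_num => //.
by case: (Q_deg uQ) => _; apply; rewrite r3.
Qed.

Lemma ch2 u : u \in Q -> #|nb Q u| = 2%N -> 817 / 64 <= ch u /\
  ((deg u = 3%N /\ deg (p u) = 1%N) \/ 165 / 10 <= ch u).
Proof.
move=> uQ r2; have r3 : (#|nb Q u| <= 3)%N by rewrite r2.
have [_ _ up] := p_private uQ r3; have [d3 _] := Q_deg uQ.
have [h1 h2] := private_num G3 d3 up.
have e : ch u = 665 / 64 + (ff u (p u) - 1 + delta (deg u)).
  by have P := psi_delta (deg u); rewrite /ch r2 (_ : (2 <= 3)%N = true); [lra|].
have h3 : 817 / 64 <= ch u by rewrite e; lra.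
have h4 : 31 / 5 <= ff u (p u) - 1 + delta (deg u) -> 165 / 10 <= ch u by rewrite e; lra.
split; first exact: h3.
case: (eqVneq (deg u) 3%N) => [f1|n1]; last first.
  by right; apply: h4; apply: h2 => -[f _]; rewrite f in n1.
case: (eqVneq (deg (p u)) 1%N) => [f2|n2]; last first.
  by right; apply: h4; apply: h2 => -[_ f]; rewrite f in n2.
by left; split.
Qed.

Lemma ch_min u : u \in Q -> 817 / 64 <= ch u /\ (poor H 3 u \/ 165 / 10 <= ch u).
Proof.
move=> uQ; have n2 := min_nb2 G3 cQ eQ minQ uQ.
have [r4|r3] := ltnP 3 #|nb Q u|.
  by have := ch4 uQ r4; split; [|right]; lra.
case: (eqVneq #|nb Q u| 3%N) => [e|ne].
  by have := ch3 uQ e; split; [|right]; lra.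
have r2 : #|nb Q u| = 2%N by lia.
have [h1 [[du dp]|h2]] := ch2 uQ r2; split; try exact: h1.
  by left; apply: Q_poor3.
by right; exact: h2.
Qed.

Lemma poor_or_ge : (exists u, poor H 3 u) \/ forall u, u \in Q -> 165 / 10 <= ch u.
Proof.
case: (boolP [forall u in Q, 165 / 10 <= ch u]) => [/forall_inP h|]; first by right; exact: h.
rewrite negb_forall_in => /exists_inP[u uQ nch]; left; exists u.
have [_ [pr|h]] := ch_min uQ; first exact: pr.
by case/negP: nch; exact: h.
Qed.

(** Four further vertices remain besides [a]: 63/2 + 4 * 817/64 just exceeds 165/2. *)
Lemma heavy_big a : a \in Q -> (3 < #|nb Q a|)%N -> heavy_alt H.
Proof.
move=> aQ r4; have c4 : (4 < #|Q|)%N.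
  have := cardsD1 a Q; rewrite aQ; have := subset_leq_card (nb_sub (Q :\ a) a).
  by rewrite nbD1; lia.
have r0 : 0 <= 817 / 64 :> rat by lra.
have s0 : 0 <= 165 / 10 :> rat by lra.
have ca := ch4 aQ r4.
have h1 := @sum_ge1 _ Q ch (817 / 64) a 4 aQ c4 r0 (fun u uQ _ => proj1 (ch_min uQ)).
have hs := ch_sum.
have [pr|h] := poor_or_ge.
  by apply: Or32; split; [lra|exact: pr].
have h2 := @sum_ge1 _ Q ch (165 / 10) a 4 aQ c4 s0 (fun u uQ _ => h u uQ).
by apply: Or31; lra.
Qed.

(** The degrees inside Q are 2 or 3 and add up to at least [2 * #|Q| + 2]. *)
Lemma two_three : (forall u, u \in Q -> (#|nb Q u| <= 3)%N) ->
  exists a b, [/\ a \in Q, b \in Q, a != b, #|nb Q a| = 3%N & #|nb Q b| = 3%N].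
Proof.
move=> r3; pose T3 := [set u in Q | #|nb Q u| == 3%N].
have : (1 < #|T3|)%N.
  have h : (e2 Q <= \sum_(u in Q) (2 + (u \in T3)))%N.
    apply: leq_sum => u uQ; have := r3 u uQ; have := min_nb2 G3 cQ eQ minQ uQ.
    by rewrite inE uQ /=; case: eqP => /=; lia.
  have : (\sum_(u in Q) (u \in T3) = #|T3|)%N.
    rewrite -sum1_card big_mkcond [RHS]big_mkcond; apply: eq_bigr => u _.
    by rewrite inE; case: (u \in Q) => //=; case: eqP.
  move: h; rewrite big_split /= sum_nat_const e2_double => h e; rewrite e in h.
  by move: eQ; lia.
case/card_gt1P => a [b []]; rewrite !inE => /andP[aQ /eqP ra] /andP[bQ /eqP rb] ab.
by exists a, b.
Qed.

Lemma heavy_min : heavy_alt H.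
Proof.
case: (boolP [exists a in Q, (3 < #|nb Q a|)%N]) => [/exists_inP[a aQ ra]|].
  exact: heavy_big aQ ra.
rewrite negb_exists_in => /forall_inP h3.
have r3 u : u \in Q -> (#|nb Q u| <= 3)%N by move=> uQ; have := h3 u uQ; rewrite -leqNgt.
have [a [b [aQ bQ ab ra rb]]] := two_three r3.
have nleq u : u \in Q -> (#|nb Q u| < #|Q|)%N.
  move=> uQ; have := subset_leq_card (nb_sub (Q :\ u) u); have := cardsD1 u Q.
  by rewrite uQ nbD1; lia.
have c4 : (3 < #|Q|)%N by have := nleq a aQ; rewrite ra.
(* With five vertices, 2 * 247/10 + 3 * 817/64 exceeds 421/5 without any private case
   distinction. *)
have [c5|c4'] := ltnP 4 #|Q|.
  have r0 : 0 <= 817 / 64 :> rat by lra.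
  have h1 := @sum_ge2 _ Q ch (817 / 64) a b 3 aQ bQ ab c5 r0 (fun u uQ _ _ => proj1 (ch_min uQ)).
  by apply: Or31; have := ch_sum; have := ch3 aQ ra; have := ch3 bQ rb; lra.
(* On four vertices [a] and [b] are adjacent to everything else in Q. Whether [c] and [d] are
   adjacent is left open, since that edge would only add weight. *)
have cQ4 : #|Q| = 4%N by lia.
have alladj u t : u \in Q -> #|nb Q u| = 3%N -> t \in Q -> t != u -> adj u t.
  move=> uQ ru tQ tu; have e : nb (Q :\ u) u = Q :\ u.
    by apply/eqP; rewrite eqEcard nb_sub nbD1 ru; have := cardsD1 u Q; rewrite uQ cQ4; lia.
  have : t \in Q :\ u by rewrite in_setD1 tu.
  by rewrite -e in_nb => /andP[].
have [c [d [cQ' dQ cd [ca cb da db]]]] : exists c d : G, [/\ c \in Q, d \in Q, c != d &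
    [/\ c != a, c != b, d != a & d != b]].
  have : (1 < #|Q :\ a :\ b|)%N.
    have := cardsD1 a Q; have := cardsD1 b (Q :\ a).
    by rewrite in_setD1 eq_sym ab bQ aQ cQ4; lia.
  case/card_gt1P => c [d []]; rewrite !in_setD1.
  by case/and3P => ? ? ? /and3P[? ? ?] ?; exists c, d.
have adjab : adj a b by apply: (alladj a b); rewrite // eq_sym.
have ac : adj a c by apply: alladj. have ad : adj a d by apply: alladj.
have bc : adj b c by apply: alladj. have bd : adj b d by apply: alladj.
have a4 : (3 < deg a)%N by case: (Q_deg aQ) => _; apply; rewrite ra.
have b4 : (3 < deg b)%N by case: (Q_deg bQ) => _; apply; rewrite rb.
have c3 : (2 < deg c)%N by case: (Q_deg cQ').
have d3 : (2 < deg d)%N by case: (Q_deg dQ).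
have poorx x : x \in Q -> x != a -> x != b -> adj a x -> adj b x -> deg x = 3%N ->
    deg (p x) = 1%N -> poor H 4 x.
  move=> xQ xa xb ax bx dx px.
  by apply: (Q_poor xQ (r3 x xQ) aQ bQ ab _ _ dx px); rewrite // adjC.
have uq : uniq [:: a; b; c; d].
  by rewrite /= !inE !negb_or ab cd ![a == _]eq_sym ca da ![b == _]eq_sym cb db.
have Q4 : Q = [set x in [:: a; b; c; d]].
  apply/esym/eqP; rewrite eqEcard cardsE (card_uniqP uq) cQ4 leqnn andbT.
  by apply/subsetP => x; rewrite !inE => /or4P[] /eqP ->.
have hQ : exf Q = ff a b + (ff c a + ff c b - 1) + (ff d a + ff d b - 1) - 2 \/
   ff a b + (ff c a + ff c b - 1) + (ff d a + ff d b - 1) - 2 <= exf Q.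
  right; have cD : c \notin [set b; a] by rewrite !inE negb_or cb.
  have dD : d \notin c |: [set b; a] by rewrite !inE !negb_or eq_sym cd db.
  have hab := exf2 adjab.
  have h1 := @exf_add2 G cG G3 c a b [set b; a] cD; have h2 := @exf_add2 G cG G3 d a b (c |: [set b; a]) dD.
  have ia : a \in [set b; a] by rewrite !inE eqxx orbT.
  have ib : b \in [set b; a] by rewrite !inE eqxx.
  have ia' : a \in c |: [set b; a] by rewrite in_setU1 ia orbT.
  have ib' : b \in c |: [set b; a] by rewrite in_setU1 ib orbT.
  have aca : adj c a by rewrite adjC. have acb : adj c b by rewrite adjC.
  have ada : adj d a by rewrite adjC. have adb : adj d b by rewrite adjC.
  have := h1 ia ib ab aca acb; have := h2 ia' ib' ab ada adb.
  have -> : d |: (c |: [set b; a]) = Q.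
    rewrite Q4; apply/setP => x; rewrite !inE.
    by case: (x == a); case: (x == b); case: (x == c); case: (x == d).
  rewrite hab; lra.
have hp u : u \in Q -> [/\ p u \in H, p u \notin Q & adj u (p u)].
  by move=> uQ; apply: p_private (r3 u uQ).
have pd u : u \in Q -> (0 < deg (p u))%N by move=> uQ; apply: p_deg (r3 u uQ).
have := exf_ge_privates cG G3 cH QH (proj1 cQ) (subxx Q) hp.
have -> : \sum_(u in Q) (ff u (p u) - 1) =
   (ff a (p a) - 1) + ((ff b (p b) - 1) + ((ff c (p c) - 1) + (ff d (p d) - 1))).
  rewrite Q4 (eq_bigl (fun x => x \in [:: a; b; c; d])); last by move=> x; rewrite inE.
  rewrite -big_uniq // !big_cons big_nil /=.
  by rewrite addr0.
have apa : adj a (p a) by case: (hp a aQ).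
have apb : adj b (p b) by case: (hp b bQ).
have da0 := pd a aQ; have db0 := pd b bQ; have dc0 := pd c cQ'; have dd0 := pd d dQ.
have inc y : y = c \/ y = d -> deg y = 3%N /\ deg (p y) = 1%N -> exists u, poor H 4 u.
  by move=> [->|->] [e1 e2]; [exists c|exists d]; apply: poorx.
clear poorx ch uq Q4 alladj.
have pa := ff1 cG G3 apa; have pb := ff1 cG G3 apb.
have pa4 : deg a = 4%N -> 64 / 27 <= ff a (p a) by move=> e; rewrite /ff e; exact: fw4_ge.
have pb4 : deg b = 4%N -> 64 / 27 <= ff b (p b) by move=> e; rewrite /ff e; exact: fw4_ge.
have [n1 n2] := fw44_num a4 b4.
have [kc1 kc2] := K4e_num a4 b4 c3 dc0.
have [kd1 kd2] := K4e_num a4 b4 d3 dd0.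
have hQ' : ff a b + (ff c a + ff c b - 1) + (ff d a + ff d b - 1) - 2 <= exf Q.
  by case: hQ => [->|h]; [exact: lexx|exact: h].
rewrite /ff in hQ' pa pb pa4 pb4 *.
move=> big.
have hi : (exists u, poor H 4 u) -> heavy_alt H.
  move=> pr; apply: Or33; split; last exact: pr.
  case: n2 => [[e1 e2]|h]; last by lra.
  by have := pa4 e1; have := pb4 e2; lra.
case: kc2 => [e12|kc2].
  by apply: hi; apply: (inc c); [left; reflexivity|exact: e12].
case: kd2 => [e12|kd2].
  by apply: hi; apply: (inc d); [right; reflexivity|exact: e12].
by apply: Or31; lra.
Qed.

End MinimalHeavy.

(** Without two disjoint cycles, a smallest connected subset with more edges than vertices satisfies
    the hypotheses of the preceding section. *)
Theorem bicyclic_heavy : (#|H| < en H)%N -> heavy_alt H.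
Proof.
move=> eH.
case: (boolP [exists A : {set G}, exists B : {set G},
  [&& A \subset H, B \subset H, [disjoint A & B], A != set0, B != set0,
    (#|A| <= en A)%N & (#|B| <= en B)%N]]).
  case/existsP => A /existsP[B /and5P[AH BH dAB A0 /and3P[B0 eA eB]]].
  have [c1 cc1 cs1] := en_cycle A0 eA; have [c2 cc2 cs2] := en_cycle B0 eB.
  apply: (two_cycles cG G3 cH hH cc1 cc2 (subset_trans cs1 AH) (subset_trans cs2 BH)).
  by apply: disjointWl cs1 _; apply: disjointWr cs2 dAB.
rewrite negb_exists => /forallP none.
pose PS S := [&& connb S, (#|S| < en S)%N & S \subset H].
have PH : PS H by rewrite /PS eH subxx; case: connP.
case: (arg_minnP (fun S : {set G} => #|S|) PH) => Q /and3P[/connP cQ eQ QH] minQ.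
apply: (heavy_min QH cQ eQ).
  move=> S SQ cS eS; apply: minQ; rewrite /PS eS (subset_trans SQ QH) andbT.
  by case: connP.
move=> A B AQ BQ dAB A0 B0 eA eB; have := none A; rewrite negb_exists => /forallP/(_ B).
by rewrite (subset_trans AQ QH) (subset_trans BQ QH) dAB A0 B0 eA eB.
Qed.

End Heavy.

(** * Graphs with at least two cycles *)

Section Dense.
Variable G : sgraph.
Implicit Types (A B C D F H K L N P R S T X Z : {set G}) (a b u v w x y z : G) (c : seq G).

(** Used with base weight 8 for all edges and a bonus for those between vertices of larger
    degree. *)
Lemma dense_exf N R (m d : rat) : R \subset N ->
  (forall x y, x \in N -> y \in N -> adj x y -> m <= ff x y) ->
  (forall x y, x \in R -> y \in R -> adj x y -> m + d <= ff x y) ->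
  m * (en N)%:R - #|N|%:R + d * (en R)%:R <= exf N.
Proof.
move=> RN hN hR; rewrite exfE /ex.
have dbl (A : {set G}) : (e2 A)%:R = 2 * (en A)%:R :> rat by rewrite e2_double -muln2 natrM mulrC.
suff : m * (e2 N)%:R + d * (e2 R)%:R <= W (@ff G) N N.
  by rewrite !dbl; lra.
have -> : m * (e2 N)%:R + d * (e2 R)%:R =
    \sum_(x in N) (m * #|nb N x|%:R + if x \in R then d * #|nb R x|%:R else 0).
  rewrite big_split /= -big_mkcondr /= -!mulr_sumr -!natr_sum; congr (_ + _ * _%:R).
  rewrite /e2; apply: eq_bigl => x; case: (boolP (x \in R)) => xR; last by rewrite andbF.
  by rewrite (subsetP RN).
apply: ler_sum => x xN.
apply: (@le_trans _ _ (\sum_(y in nb N x) (m + if (x \in R) && (y \in R) then d else 0))).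
  rewrite big_split /= sumr_const mulr_natr lerD2l.
  case: (x \in R); last by rewrite big1.
  rewrite -big_mkcondr /= (eq_bigl (fun y => y \in nb R x)).
    by rewrite sumr_const mulr_natr.
  move=> y; rewrite !in_nb; case: (boolP (y \in R)) => yR; rewrite ?andbF //= andbT.
  by rewrite (subsetP RN).
apply: ler_sum => y; rewrite in_nb => /andP[yN xy].
case: ifP => [/andP[xR yR]|_]; first exact: hR.
by rewrite addr0; apply: hN.
Qed.

Lemma dense_exf8 N : (forall x, x \in N -> (1 < deg x)%N) ->
  8 * (en N)%:R - #|N|%:R <= exf N.
Proof.
move=> hN; have h8 x y : x \in N -> y \in N -> adj x y -> 8 <= ff x y.
  by move=> xN yN _; apply: ff8; apply: hN.
have := @dense_exf N N 8 0 (subxx N) h8.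
rewrite mul0r [8 + 0]addr0 [_ - _ + 0]addr0; apply; exact: h8.
Qed.

Hypotheses (cG : conn [set: G]) (G3 : (2 < #|G|)%N).

Lemma cyc_exf c : cyc c -> 21 <= exf (cset c).
Proof.
move=> cc; have d1 x : x \in cset c -> (1 < deg x)%N.
  move=> xc; apply: leq_trans (nb_leq_deg (cset c) x).
  by apply: (cyc_nb cc); rewrite -?in_cset.
have g3 : 3 <= #|cset c|%:R :> rat.
  by rewrite (ler_nat _ 3) card_cset //; case/and3P: cc.
have ec : #|cset c|%:R <= (en (cset c))%:R :> rat by rewrite ler_nat cset_en.
by have := dense_exf8 d1; lra.
Qed.

Lemma heavy_alt_ge H : heavy_alt H -> 388 / 5 <= exf H.
Proof. by case=> [h|[h _]|[h _]]; lra. Qed.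

Lemma apexk_le k l H : (k <= l)%N -> apexk l H -> apexk k H.
Proof. by move=> kl aH F FH tF; apply: leq_trans (aH F FH tF); rewrite leq_add2l. Qed.

Lemma light_apexk k H y : y \in H -> apexk k.+1 H -> apexk k (H :\ y).
Proof.
move=> yH aH F FD tF; have := aH F (subset_trans FD (subD1set _ _)) tF.
by have := cardsD1 y H; rewrite yH; lia.
Qed.

Lemma apexkS_nontree k H : conn H -> apexk k.+1 H -> (#|H| <= en H)%N.
Proof. exact: apexk_nontree. Qed.

Lemma heavy_ge H : conn H -> heavy H -> (#|H| <= en H)%N ->
  388 / 5 <= exf H \/ en H = #|H|.
Proof.
move=> cH hH; rewrite leq_eqVlt => /orP[/eqP e|e]; first by right.
by left; apply/heavy_alt_ge/bicyclic_heavy.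
Qed.

(** Start of an induction on the apex number. A cycle gives 3 * 8 - 3 = 21, and each light vertex
    adds 15; in the heavy case [uni_bound] or [heavy_alt_ge] must keep pace. *)
Lemma chain1 H : H != set0 -> conn H -> (#|H| <= en H)%N -> 21 <= exf H.
Proof.
move=> H0 cH eH; have [c cc cs] := en_cycle H0 eH.
apply: le_trans (cyc_exf cc) (exf_mono cG G3 cH cs _).
exact: cset0.
Qed.

Lemma chain2 H : conn H -> apexk 2 H -> 36 <= exf H.
Proof.
move=> cH aH; have eH := apexkS_nontree cH aH.
have [hH|[y [yH ny cD]]] := heavy_or_light H.
  have [h|e] := heavy_ge cH hH eH; first by lra.
  by have [h _ _ _] := uni_bound cG G3 cH hH e aH; lra.
have aD := light_apexk yH aH.
have h := chain1 (proj1 cD) cD (apexkS_nontree cD aD).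
by have := light_exf cG G3 cH yH ny cD; lra.
Qed.

Lemma chain3 H : conn H -> apexk 3 H -> 51 <= exf H.
Proof.
move=> cH aH; have eH := apexkS_nontree cH aH.
have [hH|[y [yH ny cD]]] := heavy_or_light H.
  have [h|e] := heavy_ge cH hH eH; first by lra.
  by have [_ /(_ isT) h _ _] := uni_bound cG G3 cH hH e aH; lra.
have h := chain2 cD (light_apexk yH aH).
by have := light_exf cG G3 cH yH ny cD; lra.
Qed.

(** From here on heavy unicyclic sets are the bottleneck: they give 65 where the light step would
    give 66, and 139/2 instead of 80 for apex number five. *)
Lemma chain4 H : conn H -> apexk 4 H -> 65 <= exf H.
Proof.
move=> cH aH; have eH := apexkS_nontree cH aH.
have [hH|[y [yH ny cD]]] := heavy_or_light H.
  have [h|e] := heavy_ge cH hH eH; first by lra.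
  by have [_ _ /(_ isT) h _] := uni_bound cG G3 cH hH e aH; lra.
have h := chain3 cD (light_apexk yH aH).
by have := light_exf cG G3 cH yH ny cD; lra.
Qed.

Lemma chain5 H : conn H -> apexk 5 H -> 139 / 2 <= exf H.
Proof.
move=> cH aH; have eH := apexkS_nontree cH aH.
have [hH|[y [yH ny cD]]] := heavy_or_light H.
  have [h|e] := heavy_ge cH hH eH; first by lra.
  by have [_ _ _ /(_ isT) h] := uni_bound cG G3 cH hH e aH; lra.
have h := chain4 cD (light_apexk yH aH).
by have := light_exf cG G3 cH yH ny cD; lra.
Qed.

Lemma poor_apexk k H K : K \subset H -> #|K|.+2 = #|H| -> apexk k.+2 H -> apexk k K.
Proof. by move=> KH cK aH F FK tF; have := aH F (subset_trans FK KH) tF; lia. Qed.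

(** The light step gives 139/2 + 15. In the poor cases apex number four remains, so that 65 + 2 fw 3
    3 - 1 + 19/8 is ample. *)
Lemma bicyclic6 H : conn H -> (#|H| < en H)%N -> apexk 6 H -> 421 / 5 <= exf H.
Proof.
move=> cH eH aH; have [hH|[y [yH ny cD]]] := heavy_or_light H; last first.
  have h := chain5 cD (light_apexk yH aH).
  by have := light_exf cG G3 cH yH ny cD; lra.
have key n u : poor H n u -> (2 < n)%N -> 421 / 5 <= exf H.
  move=> pr n3; have [K [cK sK _ KH +]] := poor_exf cG G3 n3 pr.
  have := chain4 cK (poor_apexk KH sK aH); have := @fw3_mono 3 n n3; rewrite fw33; lra.
case: (bicyclic_heavy cG G3 cH hH eH) => [h|[_ [u pr]]|[_ [u pr]]].
- exact: h.
- exact: key pr isT.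
- exact: key pr isT.
Qed.

(** The light step gives exactly 65 + 15. With a poor vertex of level 4, 51 + 2 fw 3 4 - 1 + 19/8
    barely exceeds 80; level 3 would not suffice, but there 165/2 is already known. *)
Lemma bicyclic5 H : conn H -> (#|H| < en H)%N -> apexk 5 H -> 80 <= exf H.
Proof.
move=> cH eH aH; have [hH|[y [yH ny cD]]] := heavy_or_light H; last first.
  have h := chain4 cD (light_apexk yH aH).
  by have := light_exf cG G3 cH yH ny cD; lra.
case: (bicyclic_heavy cG G3 cH hH eH) => [h|[h _]|[_ [u pr]]]; try by lra.
have [K [cK sK _ KH +]] := poor_exf cG G3 (n := 4) isT pr.
by have := chain3 cK (poor_apexk KH sK aH); rewrite fw34; lra.
Qed.

End Dense.

(** * Branches of unicyclic sets *)

Section Unicyclic.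
Variable G : sgraph.
Implicit Types (A B C D F K L N P R S T X Z : {set G}) (a b u v w x y z : G).
Variables (H : {set G}) (c : seq G).
Hypotheses (cH : conn H) (cc : cyc c) (cs : cset c \subset H) (eH : en H = #|H|).

(** The edge count leaves exactly two edges between the sides, and the two cycle edges at v are
    among them. *)
Lemma uni_nb_hcomp v : v \in c -> #|nb (hcomp H c v) v| = 2%N.
Proof.
move=> vc; have [[_ tC] [_ tB]] := uni_trees cH cc cs vc eH.
have [nc pc an ap [np nv pv]] := cyc_next cc vc.
have hin u : u \in c -> u != v -> u \in hcomp H c v.
  by move=> uc uv; apply: (subsetP (cyc_hcomp cc cs vc)); rewrite in_setD1 uv in_cset.
have ge : (2 <= #|nb (hcomp H c v) v|)%N.
  apply/card_gt1P; exists (next c v), (prev c v).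
  by rewrite !in_nb !hin.
have := en_U (branch_hcomp_disj H c v); rewrite (branch_U cc cs vc) eH.
have := card_branch_hcomp cc cs vc.
have le : (#|nb (hcomp H c v) v| <= cross (branch H c v) (hcomp H c v))%N.
  by rewrite /cross (bigD1 v) ?(branch_self cc cs) //= leq_addr.
lia.
Qed.

Lemma uni_nb_branch v : v \in c -> (#|nb (branch H c v) v| + 2 = #|nb H v|)%N.
Proof.
move=> vc; rewrite -{2}(branch_U cc cs vc) nbU_disj ?(branch_hcomp_disj H c v) //.
by rewrite uni_nb_hcomp.
Qed.

(** The union of the branches is closed in H: an edge leaving a branch starts at its root, whose
    neighbours outside are its two neighbours on the cycle. *)
Lemma uni_cover x : x \in H -> exists2 v, v \in c & x \in branch H c v.
Proof.
pose U := [set x in H | has (fun v => x \in branch H c v) c].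
have UH : U \subset H by apply/subsetP => z; rewrite inE => /andP[].
have cU : cset c \subset U.
  apply/subsetP => v; rewrite in_cset => vc; rewrite inE (cyc_in cs) //=.
  by apply/hasP; exists v => //; apply: (branch_self cc cs).
suff e : U = H by rewrite -{1}e inE => /andP[_ /hasP].
apply: (proj2 cH) => //.
  by apply: contraTneq cU => ->; rewrite subset0 (negbTE (cset0 cc)).
move=> z y; rewrite inE => /andP[zH /hasP[v vc zB]] yH zy.
rewrite inE yH; apply/hasP; case: (eqVneq z v) => [e|zv]; last first.
  by exists v => //; apply: (branch_closed cc cs vc zB zv yH zy).
subst z; case: (boolP (y \in branch H c v)) => [yB|yB]; first by exists v.
have yC : y \in nb (hcomp H c v) v.
  by rewrite in_nb zy andbT; move: yB; rewrite in_setD yH andbT negbK.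
have [nc pc an ap [np nv pv]] := cyc_next cc vc.
have hin u : u \in c -> u != v -> u \in hcomp H c v.
  by move=> uc uv; apply: (subsetP (cyc_hcomp cc cs vc)); rewrite in_setD1 uv in_cset.
have e : [set next c v; prev c v] = nb (hcomp H c v) v.
  apply/eqP; rewrite eqEcard uni_nb_hcomp // cards2 np andbT subUset !sub1set !in_nb.
  by rewrite !hin //= an ap.
have yc : y \in c by move: yC; rewrite -e in_set2 => /orP[] /eqP ->.
by exists y => //; apply: (branch_self cc cs).
Qed.

Lemma uni_sum_card : (\sum_(v in cset c) #|branch H c v|)%N = #|H|.
Proof.
have e v : #|branch H c v| = (\sum_(x in H) (x \in branch H c v))%N.
  rewrite -sum1_card big_mkcond [RHS]big_mkcond; apply: eq_bigr => x _.
  case: (boolP (x \in H)) => xH; first by case: (x \in branch _ _ _).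
  by case: ifP => // /(subsetP (branch_sub H c v)); rewrite (negbTE xH).
rewrite (eq_bigr _ (fun v _ => e v)) exchange_big /= -sum1_card; apply: eq_bigr => x xH.
have [v vc xB] := uni_cover xH.
rewrite (bigD1 v) ?in_cset //= xB big1 // => u; rewrite in_cset => /andP[uc uv].
by have := branch_disj cH cc cs uc vc uv; case: (boolP (x \in _)) => // xu /disjointFr/(_ xu); rewrite xB.
Qed.

End Unicyclic.

Lemma sum_ge_const (I : finType) (A : {set I}) (f : I -> rat) (X : rat) n :
  (n <= #|A|)%N -> 0 <= X -> (forall u, u \in A -> X <= f u) ->
  n%:R * X <= \sum_(u in A) f u.
Proof.
move=> nA X0 h; apply: (@le_trans _ _ (\sum_(u in A) X)); last exact: ler_sum.
by rewrite sumr_const -[X *+ _]mulr_natl; apply: ler_wpM2r => //; rewrite ler_nat.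
Qed.

Lemma sum_bound (I : finType) (A : {set I}) (b : I -> nat) m v :
  v \in A -> (forall u, u \in A -> (b u <= m)%N) ->
  (\sum_(u in A) b u <= b v + (#|A| - 1) * m)%N.
Proof.
move=> vA h; rewrite (bigD1 v) //= leq_add2l.
rewrite (eq_bigl (fun u => u \in A :\ v)); last by move=> u; rewrite in_setD1 andbC.
apply: (@leq_trans (\sum_(u in A :\ v) m)).
  by apply: leq_sum => u; rewrite in_setD1 => /andP[_ /h].
by rewrite sum_nat_const (cardsD1 v A) vA addKn.
Qed.

Variant sizes_spec (I : finType) (A : {set I}) (b : I -> nat) m n : Prop :=
  | SizesMany of (3 < #|A|)%N
  | SizesBig v of v \in A & (m < b v)%N
  | SizesAll of forall v, v \in A -> (n < b v)%N.

(** If there are three branches and none has more than five vertices, each of them has at least 14 -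
    2 * 5 = 4. *)
Lemma sizes14 (I : finType) (A : {set I}) (b : I -> nat) : (2 < #|A|)%N ->
  (forall v, v \in A -> (2 < b v)%N) -> (14 <= \sum_(v in A) b v)%N ->
  sizes_spec A b 5 3.
Proof.
move=> A3 b3 s14; have [A4|A4] := ltnP 3 #|A|; first exact: SizesMany.
case: (boolP [exists v in A, (5 < b v)%N]) => [/exists_inP[v vA v6]|].
  exact: SizesBig vA v6.
rewrite negb_exists_in => /forall_inP h; apply: SizesAll => v vA.
have h5 u : u \in A -> (b u <= 5)%N by move=> uA; have := h u uA; rewrite -leqNgt.
by have := sum_bound vA h5; lia.
Qed.

Lemma sizes13 (I : finType) (A : {set I}) (b : I -> nat) : (2 < #|A|)%N ->
  (forall v, v \in A -> (1 < b v)%N) -> (13 <= \sum_(v in A) b v)%N ->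
  (3 < #|A|)%N \/ exists2 v, v \in A & (3 < b v)%N.
Proof.
move=> A3 b3 s14; have [A4|A4] := ltnP 3 #|A|; first by left.
case: (boolP [exists v in A, (3 < b v)%N]) => [/exists_inP[v vA v6]|].
  by right; exists v.
rewrite negb_exists_in => /forall_inP h.
have h5 u : u \in A -> (b u <= 3)%N by move=> uA; have := h u uA; rewrite -leqNgt.
have /card_gt0P[v vA] : (0 < #|A|)%N by lia.
by have := sum_bound vA h5; have := h5 v vA; lia.
Qed.

(** * Heavy unicyclic sets left after removing one or two light vertices *)

Section FourApex.
Variable G : sgraph.
Implicit Types (A B C D F H K L N P R S T X Z : {set G}) (a b u v w x y z : G) (c : seq G).
Hypotheses (cG : conn [set: G]) (G3 : (2 < #|G|)%N).

Section Uni.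
Variables (H : {set G}) (c : seq G).
Hypotheses (cH : conn H) (cc : cyc c) (cs : cset c \subset H) (eH : en H = #|H|).
Hypothesis hH : heavy H.

Let B v := branch H c v.

Lemma uni_exf : \sum_(v in cset c) (665 / 64 + kap (B v) v) <= exf H.
Proof.
apply: le_trans (branch_bound cG G3 cH cc cs (heavy_cyc_deg cH cc cs hH)).
by apply: ler_sum => v _; rewrite fw33; lra.
Qed.

Lemma cset3 : (2 < #|cset c|)%N.
Proof. by rewrite card_cset //; case/and3P: cc. Qed.

Lemma uni_kap2 v : v \in cset c -> 19 / 8 <= kap (B v) v.
Proof.
rewrite in_cset => vc.
apply: (kap2 cG G3 (conn_branch cH cc cs vc) (branch_self cc cs vc)).
  exact: heavy_branch.
exact: (heavy_cyc_deg cH cc cs hH).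
Qed.

Lemma uni_kap3 v : v \in cset c -> (2 < #|B v|)%N -> 38 / 5 <= kap (B v) v.
Proof.
rewrite in_cset => vc b3.
exact: (kap3 cG G3 (conn_branch cH cc cs vc) (branch_self cc cs vc) b3 (nb_branch_deg cc cs vc)).
Qed.

Lemma uni_kap4 v : v \in cset c -> (3 < #|B v|)%N -> 283 / 25 <= kap (B v) v.
Proof.
rewrite in_cset => vc b3.
exact: (proj1 (kap45 cG G3 (conn_branch cH cc cs vc) (branch_self cc cs vc) b3
  (nb_branch_deg cc cs vc))).
Qed.

Lemma uni_kap6 v : (forall x, x \in H -> (deg x <= #|nb H x|.+1)%N) ->
  v \in cset c -> (5 < #|B v|)%N -> 141 / 10 <= kap (B v) v.
Proof.
move=> hd; rewrite in_cset => vc b3.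
apply: (kap6 cG G3 (conn_branch cH cc cs vc) (branch_self cc cs vc) b3
  (nb_branch_deg cc cs vc)) => x xB xv.
apply: leq_trans (hd x (subsetP (branch_sub H c v) x xB)) _.
rewrite ltnS; apply/subset_leq_card/subsetP => y; rewrite !in_nb => /andP[yH xy].
by rewrite xy andbT; apply: (branch_closed cc cs vc xB xv yH xy).
Qed.

Lemma uni_exf_ge n (X : rat) : (n <= #|cset c|)%N -> 0 <= X ->
  (forall v, v \in cset c -> X <= kap (B v) v) -> n%:R * (665 / 64 + X) <= exf H.
Proof.
move=> nC X0 hX; apply: le_trans uni_exf; apply: sum_ge_const; [exact: nC|lra|].
by move=> v /hX; rewrite lerD2l.
Qed.

Lemma uni_exf_ge1 (X Y : rat) a : a \in cset c -> 0 <= X ->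
  (forall v, v \in cset c -> X <= kap (B v) v) -> Y <= kap (B a) a ->
  665 / 64 + Y + 2 * (665 / 64 + X) <= exf H.
Proof.
move=> aC X0 hX hY; have r0 : 0 <= 665 / 64 + X by lra.
have h u : u \in cset c -> u != a -> 665 / 64 + X <= 665 / 64 + kap (B u) u.
  by move=> uC _; rewrite lerD2l; exact: hX.
have := @sum_ge1 _ _ (fun u => 665 / 64 + kap (B u) u) _ a 2 aC cset3 r0 h.
by have := uni_exf; lra.
Qed.

(** The bound is 3773/50 - 15, what is needed after one light vertex. The tight case is one branch
    with six vertices and two with three, which is why [kap6] improves on 14; the degree condition
    holds because only one vertex was removed. *)
Lemma uni14 : (14 <= #|H|)%N -> apexk 3 H ->
  (forall x, x \in H -> (deg x <= #|nb H x|.+1)%N) -> 3023 / 50 <= exf H.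
Proof.
move=> H14 aH hd.
have b3 v : v \in cset c -> (2 < #|B v|)%N.
  by rewrite in_cset => vc; apply: (uni_branch_card cH cc cs vc eH aH).
rewrite -(uni_sum_card cH cc cs eH) in H14.
have k3 v (vC : v \in cset c) := uni_kap3 vC (b3 v vC).
have r0 : 0 <= 38 / 5 :> rat by lra.
case: (sizes14 cset3 b3 H14) => [c4|v vC v6|h4].
- by have := uni_exf_ge c4 r0 k3; lra.
- by have := uni_exf_ge1 vC r0 k3 (uni_kap6 hd vC v6); lra.
- have r1 : 0 <= 283 / 25 :> rat by lra.
  by have := uni_exf_ge cset3 r1 (fun v vC => uni_kap4 vC (h4 v vC)); lra.
Qed.

(** The bound is 3773/50 - 2 * 15, what is needed after two light vertices. *)
Lemma uni13 : (13 <= #|H|)%N -> 2273 / 50 <= exf H.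
Proof.
move=> H13.
have b2 v : v \in cset c -> (1 < #|B v|)%N.
  by rewrite in_cset => vc; apply: heavy_branch.
rewrite -(uni_sum_card cH cc cs eH) in H13.
have r0 : 0 <= 19 / 8 :> rat by lra.
case: (sizes13 cset3 b2 H13) => [c4|[v vC v4]].
- by have := uni_exf_ge c4 r0 uni_kap2; lra.
- by have := uni_exf_ge1 vC r0 uni_kap2 (uni_kap4 vC v4); lra.
Qed.

End Uni.
End FourApex.

(** Bernoulli's bound leaves 3t / (t + 4), which is 9/7 at t = 3. *)
Lemma leaves_num t : (3 <= t)%N -> 9 / 7 <= t%:R * (fw 1 (t + 5) - 1).
Proof.
move=> t3; have T3 : 3 <= t%:R :> rat by rewrite (ler_nat _ 3).
have := @fw1 (t + 4); rewrite -addnS natrD.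
have t4 : (0 < t + 4)%N by rewrite addn_gt0 orbT.
move=> /(_ t4).
have p : 0 < t%:R + 4 :> rat by lra.
set f := fw _ _; move=> e.
have q : 0 <= 3 / (t%:R + 4) :> rat by apply: divr_ge0; lra.
have q2 : 0 <= 1 / (t%:R + 4) ^+ 2 :> rat by apply: divr_ge0; [lra|apply: exprn_ge0; lra].
have : 3 <= (t%:R + 4) * (f - 1) by rewrite e; lra.
nra.
Qed.

(** * Counting nonpendant vertices for apex number four *)

Section Pendants.
Variable G : sgraph.
Implicit Types (A B C D F H K L N P R S T X Z : {set G}) (a b u v w x y z : G) (c : seq G).

(* If three light vertices can be removed in succession and a cycle remains, the
   subgraph of the nonpendant vertices has at least three more edges than
   vertices. *)
Definition core : {set G} := [set x | (1 < deg x)%N].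

(** Each vertex of degree at most one takes away at most one edge. *)
Lemma core_excess A : (en A + #|A :&: core| <= en (A :&: core) + #|A|)%N.
Proof.
have [m] := ubnP #|A|; elim: m A => // m IH A lt.
case: (boolP (A \subset core)) => [/setIidPl ->|/subsetPn[z zA]]; first by rewrite addnC.
rewrite inE -leqNgt => dz.
have e := cardsD1 z A; rewrite zA in e.
have := IH (A :\ z); have -> : (A :\ z) :&: core = A :&: core.
  apply/setP => x; rewrite !in_setI in_setD1; case: (eqVneq x z) => //= ->.
  by rewrite inE ltnNge dz andbF.
have := en_D1 zA; have := nb_leq_deg A z; lia.
Qed.

Lemma e2_le R : (e2 R <= #|R| * (#|R| - 1))%N.
Proof.
rewrite -sum_nat_const; apply: leq_sum => x xR.
have := subset_leq_card (nb_sub (R :\ x) x); have := cardsD1 x R.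
by rewrite xR nbD1; lia.
Qed.

Lemma cross_le A B : (cross A B <= #|A| * #|B|)%N.
Proof. by rewrite -sum_nat_const; apply: leq_sum => x _; apply/subset_leq_card/nb_sub. Qed.

Lemma crossC A B : cross A B = cross B A.
Proof.
have e C D : cross C D = (\sum_(x in C) \sum_(y in D) adj x y)%N.
  apply: eq_bigr => x _; rewrite -sum1_card big_mkcond [RHS]big_mkcond.
  by apply: eq_bigr => y _; rewrite in_nb; case: (y \in D); case: (adj x y).
rewrite !e exchange_big; apply: eq_bigr => x _; apply: eq_bigr => y _.
by rewrite adj_sym.
Qed.

(** Within the core, edges that meet [Z] weigh exactly 8, so a gain over the plain bound has to come
    from edges inside [R]. *)
Let Z : {set G} := [set x in core | deg x == 2].
Let R : {set G} := core :\: Z.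

Lemma two_sub : Z \subset core.
Proof. by apply/subsetP => x; rewrite inE => /andP[]. Qed.

Lemma two_disj : [disjoint Z & R].
Proof. by rewrite disjoint_sym disjoints_subset; apply/subsetP => x; rewrite in_setD in_setC => /andP[]. Qed.

Lemma two_U : Z :|: R = core.
Proof.
apply/setP => x; rewrite in_setU in_setD; case: (boolP (x \in Z)) => //= xZ.
by rewrite (subsetP two_sub).
Qed.

Lemma core_card : (#|Z| + #|R| = #|core|)%N.
Proof. by rewrite -two_U cardsU disjoint_setI0 ?two_disj // cards0 subn0. Qed.

Lemma core_en : en core = (en Z + en R + cross Z R)%N.
Proof. by rewrite -{1}two_U en_U // two_disj. Qed.

Lemma two_nb : (2 * en Z + cross Z R <= 2 * #|Z|)%N.
Proof.
rewrite mul2n -e2_double -big_split /= mulnC -sum_nat_const; apply: leq_sum => x xZ.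
rewrite -nbU_disj ?two_disj // two_U.
by apply: leq_trans (nb_leq_deg _ _) _; move: xZ; rewrite inE => /andP[_ /eqP->].
Qed.

Lemma R_en : (2 * en R <= #|R| * (#|R| - 1))%N.
Proof. by rewrite mul2n -e2_double e2_le. Qed.

Lemma R_deg x : x \in R -> (2 < deg x)%N.
Proof.
rewrite in_setD => /andP[+ xN]; rewrite inE xN /= => d2; rewrite inE in xN.
by rewrite ltn_neqAle eq_sym d2.
Qed.

Lemma core_deg x : x \in core -> (1 < deg x)%N.
Proof. by rewrite inE. Qed.

Lemma core_exf (X : rat) : (forall x y, x \in R -> y \in R -> adj x y -> 8 + X <= ff x y) ->
  8 * (en core)%:R - #|core|%:R + X * (en R)%:R <= exf core.
Proof.
move=> h; apply: dense_exf; [exact: subsetDl| |exact: h].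
by move=> x y xN yN _; apply: ff8; apply: core_deg.
Qed.

Lemma core_exf3 : 8 * (en core)%:R - #|core|%:R + 217 / 64 * (en R)%:R <= exf core.
Proof.
apply: core_exf => x y xR yR xy.
have h : fw 3 3 <= ff x y by apply: fw_mono; rewrite !R_deg.
by rewrite fw33 in h; lra.
Qed.

(** At most [2 * #|Z|] edges meet Z. So three or fewer vertices in Z leave three edges inside R, and
    otherwise the core is K_{2,4} with an edge between the two hubs. *)
Lemma core_six_nat : #|core| = 6%N -> (9 <= en core)%N ->
  (3 <= en R)%N \/ [/\ #|R| = 2%N, #|Z| = 4%N, en R = 1%N & cross Z R = 8%N].
Proof.
have := core_card; have := core_en; have := two_nb; have := cross_le Z R; have := R_en.
set z := #|Z|; set r := #|R|; set p := en Z; set q := en R; set t := cross Z R.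
move=> h1 h2 h3 -> h5 h6; have e : r = (6 - z)%N by lia.
have [z3|z4] := leqP z 3; first by left; lia.
have {z4} : z = 4%N \/ z = 5%N \/ z = 6%N by lia.
case=> [zz|[zz|zz]]; rewrite zz in h1 h2 h3 h5 e *; rewrite e in h1 h2 *; [right; split|left|left]; lia.
Qed.

Lemma core_seven_nat : #|core| = 7%N -> (10 <= en core)%N ->
  [\/ (11 <= en core)%N, (0 < en R)%N |
   [/\ #|R| = 2%N, #|Z| = 5%N, en R = 0%N, en Z = 0%N & cross Z R = 10%N]].
Proof.
have := core_card; have := core_en; have := two_nb; have := cross_le Z R; have := R_en.
set z := #|Z|; set r := #|R|; set p := en Z; set q := en R; set t := cross Z R.
move=> h1 h2 h3 -> h5 h6; have e : r = (7 - z)%N by lia.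
case: (posnP q) => [q0|q0]; last by constructor 2.
have [g|g] := ltnP 10 (p + q + t); first by constructor 1.
have [z3|z4] := leqP z 4; first by lia.
constructor 3; have {z4} : z = 5%N \/ z = 6%N \/ z = 7%N by lia.
case=> [zz|[zz|zz]]; rewrite zz in h1 h2 h3 h5 e *; rewrite e in h1 h2 *; split; lia.
Qed.

Lemma R_full x m : x \in R -> #|R| = 2%N -> #|Z| = m -> cross Z R = (2 * m)%N ->
  #|nb Z x| = m.
Proof.
move=> xR r2 zm; rewrite crossC /cross (bigD1 x) //=.
have : (\sum_(i in R | i != x) #|nb Z i| <= m)%N.
  apply: (@leq_trans (\sum_(i in R :\ x) m)).
    rewrite [X in (X <= _)%N](eq_bigl (fun i => i \in R :\ x)).
      by apply: leq_sum => i _; rewrite -zm; apply/subset_leq_card/nb_sub.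
    by move=> i; rewrite in_setD1 andbC.
  by rewrite sum_nat_const; have := cardsD1 x R; rewrite xR r2; lia.
by have := subset_leq_card (nb_sub Z x); rewrite zm; lia.
Qed.

Lemma core_six : #|core| = 6%N -> (9 <= en core)%N -> 3773 / 50 <= exf core.
Proof.
move=> c6 e9; case: (core_six_nat c6 e9) => [r3|[r2 z4 q1 t8]].
  have := core_exf3; rewrite c6.
  have : 9 <= (en core)%:R :> rat by rewrite (ler_nat _ 9).
  have : 3 <= (en R)%:R :> rat by rewrite (ler_nat _ 3).
  lra.
have d5 x y : x \in R -> y \in R -> adj x y -> (5 <= deg x)%N.
  move=> xR yR xy; have := R_full xR r2 z4 t8.
  have : (0 < #|nb R x|)%N by apply/card_gt0P; exists y; rewrite in_nb yR.
  have := nb_leq_deg core x; rewrite -two_U nbU_disj ?two_disj //; lia.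
have h22 x y : x \in R -> y \in R -> adj x y -> 8 + 22 <= ff x y.
  move=> xR yR xy; have h : fw 5 5 <= ff x y.
    apply: fw_mono; first exact: (d5 x y xR yR xy).
    by apply: (d5 y x yR xR); rewrite adjC.
  by rewrite fw55 in h; lra.
have := core_exf h22; rewrite c6 q1.
have : 9 <= (en core)%:R :> rat by rewrite (ler_nat _ 9).
lra.
Qed.

Section Bipartite.
Hypotheses (cG : conn [set: G]) (G3 : (2 < #|G|)%N).
Hypotheses (r2 : #|R| = 2%N) (z5 : #|Z| = 5%N) (eR : en R = 0%N) (eZ : en Z = 0%N)
  (t10 : cross Z R = 10%N).

Lemma nb_en0 A x y : en A = 0%N -> x \in A -> y \in A -> adj x y = false.
Proof.
move=> eA xA yA; apply/negP => xy.
have : (0 < e2 A)%N; last by rewrite e2_double eA.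
rewrite /e2 (bigD1 x) //= addn_gt0; apply/orP; left.
by apply/card_gt0P; exists y; rewrite in_nb yA.
Qed.

Lemma Z_nb x y : x \in Z -> adj x y -> y \in R.
Proof.
move=> xZ xy; have hle i : i \in Z -> (#|nb R i| <= 2)%N.
  by move=> _; rewrite -r2; apply/subset_leq_card/nb_sub.
have e : #|nb R x| = 2%N.
  move: t10; rewrite /cross (bigD1 x) //=.
  have : (\sum_(i in Z | i != x) #|nb R i| <= 8)%N.
    apply: (@leq_trans (\sum_(i in Z :\ x) 2)).
      rewrite [X in (X <= _)%N](eq_bigl (fun i => i \in Z :\ x)).
        by apply: leq_sum => i; rewrite in_setD1 => /andP[_ /hle].
      by move=> i; rewrite in_setD1 andbC.
    by rewrite sum_nat_const; have := cardsD1 x Z; rewrite xZ z5; lia.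
  by have := hle x xZ; lia.
have d2 : deg x = 2%N by move: xZ; rewrite inE => /andP[_ /eqP].
have : nb R x = [set w | adj x w].
  apply/eqP; rewrite eqEcard e -[#|[set w | _]|]/(deg x) d2 leqnn andbT.
  by apply/subsetP => w; rewrite in_nb inE => /andP[].
by move/setP/(_ y); rewrite in_nb [in RHS]inE xy => /andP[].
Qed.

Let L a : {set G} := [set z | (deg z == 1%N) && adj a z].

Lemma R_Z a z : a \in R -> z \in Z -> adj a z.
Proof.
move=> aR zZ; have := R_full aR r2 z5 t10; rewrite -z5 => e.
have : nb Z a = Z by apply/eqP; rewrite eqEcard nb_sub e leqnn.
by move/setP/(_ z); rewrite in_nb zZ.
Qed.

Lemma R_degL a : a \in R -> deg a = (#|L a| + 5)%N.
Proof.
move=> aR; rewrite -(R_full aR r2 z5 t10) -cardsUI.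
rewrite (_ : L a :&: nb Z a = set0) ?cards0 ?addn0.
  apply: eq_card => w; rewrite [LHS]inE in_setU in_nb [in RHS]inE.
  case: (boolP (adj a w)) => aw; rewrite ?andbF // !andbT.
  have d0 : (0 < deg w)%N by apply: (@adj_deg _ w a); rewrite adjC.
  case: (eqVneq (deg w) 1%N) => //= d1; case: (boolP (w \in Z)) => // wZ.
  have wR : w \in R by rewrite in_setD wZ inE; lia.
  by rewrite (nb_en0 eR aR wR) in aw.
apply/setP => w; rewrite in_setI in_nb !inE; case: eqP => //= ->.
by rewrite !andbF.
Qed.

(** Deleting [a] with its pendant vertices leaves a star around [b], which is a tree; apex number
    four requires at least four deleted vertices. *)
Lemma R_three a b : apexk 4 [set: G] -> R = [set a; b] -> a != b -> (3 <= #|L a|)%N.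
Proof.
move=> aV eRR ab; have aR : a \in R by rewrite eRR !inE eqxx.
have bR : b \in R by rewrite eRR !inE eqxx orbT.
pose F : {set G} := ~: (a |: L a).
have inF x : x \in F -> x != b -> x \in Z \/ deg x = 1%N /\ adj b x.
  rewrite in_setC in_setU1 negb_or => /andP[xa xL] xb.
  have nR : x \notin R by rewrite eRR !inE negb_or xa xb.
  case: (boolP (x \in Z)) => xZ; [by left|right].
  have d1 : deg x = 1%N.
    have : x \notin core by rewrite -two_U in_setU negb_or xZ.
    have : (0 < deg x)%N; last by rewrite inE; lia.
    have := @nb_conn _ setT x cG; rewrite cardsT in_setT => /(_ (ltnW G3) isT).
    by case/card_gt0P => y; rewrite in_nb => /andP[_]; apply: adj_deg.
  split=> //; have [y xy] : exists y, adj x y.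
    by move: d1; rewrite /deg => /eqP/cards1P[y /setP/(_ y)]; rewrite !inE eqxx => xy; exists y.
  have dy : (1 < deg y)%N.
    by have := adj_deg2 cG G3 xy; rewrite d1.
  have yC : y \in core by rewrite inE.
  rewrite -two_U in_setU in yC; case/orP: yC => [yZ|yR].
    have := @Z_nb y x yZ; rewrite adjC => /(_ xy) xR; by rewrite xR in nR.
  move: yR; rewrite eRR in_set2 => /orP[] /eqP ey; rewrite ey in xy.
    by move: xL; rewrite inE d1 eqxx adjC xy.
  by rewrite adjC.
have bF : b \in F.
  rewrite in_setC in_setU1 negb_or eq_sym ab inE negb_and; apply/orP; left.
  by have := R_deg bR; lia.
have bad x : x \in F -> x != b -> adj b x.
  by move=> xF xb; case: (inF x xF xb) => [xZ|[]//]; apply: R_Z.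
have eF0 : e2 (F :\ b) = 0%N.
  apply: big1 => x; rewrite in_setD1 => /andP[xb xF]; apply: eq_card0 => y.
  rewrite in_nb in_setD1; apply/negbTE/negP => /andP[/andP[yb yF] xy].
  case: (inF x xF xb) => [xZ|[d1 bx]].
    have := Z_nb xZ xy; rewrite eRR in_set2 (negbTE yb) orbF => /eqP ya.
    by move: yF; rewrite in_setC in_setU1 ya eqxx.
  by move: yb; rewrite (deg1_nb d1 xy (_ : adj x b)) ?eqxx // adjC.
have tF : tset F.
  split; last first.
    rewrite (en_D1 bF) /en eF0 add0n (cardsD1 b F) bF add1n; congr _.+1.
    rewrite -nbD1; apply/eqP; rewrite eqn_leq subset_leq_card ?nb_sub //=.
    apply/subset_leq_card/subsetP => x xF; rewrite in_nb xF.
    by move: xF; rewrite in_setD1 => /andP[xb xF]; apply: bad.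
  split; first by apply/set0Pn; exists b.
  move=> A AF /set0Pn[x xA] clA.
  have bA : b \in A.
    case: (eqVneq x b) xA => [->//|xb] xA; apply: (clA x b xA bF).
    by rewrite adjC; apply: bad => //; apply: (subsetP AF).
  apply/eqP; rewrite eqEsubset AF; apply/subsetP => y yF.
  by case: (eqVneq y b) => [->//|yb]; apply: (clA b y bA yF (bad y yF yb)).
have := aV F (subsetT F) tF; have := cardsC (a |: L a).
have aL : a \notin L a by rewrite inE adj_irrefl andbF.
by rewrite -/F cardsU1 aL cardsT; lia.
Qed.

(** The pendant vertices forced at both hubs lift the sum to 73 + 2 * 9/7, just above 3773/50. *)
Lemma bipartite_exf : apexk 4 [set: G] -> 3773 / 50 <= exf [set: G].
Proof.
move=> aV; have [a [b [ab eRR]]] : exists a b, a != b /\ R = [set a; b].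
  by move/eqP/cards2P: r2 => [a [b [ab e]]]; exists a, b.
have aR : a \in R by rewrite eRR !inE eqxx.
have bR : b \in R by rewrite eRR !inE eqxx orbT.
have ta := R_three aV eRR ab.
have tb : (3 <= #|L b|)%N by apply: (R_three (b := a) aV); rewrite // ?eRR 1?setUC // eq_sym.
have Rcore := subsetP (subsetDl core Z).
have nL x y : y \in L x -> y \notin core by rewrite !inE => /andP[/eqP ->].
have d1 : [disjoint core & L a].
  by rewrite disjoint_sym disjoints_subset; apply/subsetP => y /nL; rewrite in_setC.
have d2 : [disjoint core :|: L a & L b].
  rewrite disjoint_sym disjoints_subset; apply/subsetP => y yb.
  rewrite in_setC in_setU negb_or (nL _ _ yb); apply/negP => ya.
  move: ya yb; rewrite !inE => /andP[/eqP dy ay] /andP[_ yb].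
  by move: ab; rewrite (deg1_nb dy (_ : adj y a) (_ : adj y b)) ?eqxx // adjC.
have la x y : y \in L x -> deg y = 1%N /\ adj x y by rewrite inE => /andP[/eqP].
have h1 := exf_leaves cG G3 (Rcore a aR) d1 (la a).
have bU : b \in core :|: L a by rewrite in_setU (Rcore b bR).
have h2 := exf_leaves cG G3 bU d2 (la b).
have U0 : core :|: L a :|: L b != set0 by apply/set0Pn; exists b; rewrite in_setU bU.
have h3 := exf_mono cG G3 cG (subsetT _) U0.
have h4 := dense_exf8 core_deg; have c7 : #|core| = 7%N by rewrite -core_card r2 z5.
rewrite core_en eR eZ t10 c7 in h4.
have := leaves_num ta; have := leaves_num tb; rewrite -(R_degL aR) -(R_degL bR).
lra.
Qed.

End Bipartite.

Lemma core_big : conn [set: G] -> (2 < #|G|)%N -> apexk 4 [set: G] ->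
  (#|G| + 3 <= en [set: G])%N -> (6 <= #|core|)%N -> 3773 / 50 <= exf [set: G].
Proof.
move=> cG G3 aV e3 c6; have ec : (#|core| + 3 <= en core)%N.
  by have := core_excess [set: G]; rewrite setTI cardsT; lia.
have C0 : core != set0 by rewrite -card_gt0; lia.
have mono := exf_mono cG G3 cG (subsetT _) C0.
have [c8|c7] := ltnP 7 #|core|.
  have h := dense_exf8 core_deg.
  have : (#|core| + 3)%:R <= (en core)%:R :> rat by rewrite ler_nat.
  have : 8 <= #|core|%:R :> rat by rewrite (ler_nat _ 8).
  by rewrite natrD; lra.
have {c6 c7} [c6|c7] : #|core| = 6%N \/ #|core| = 7%N by lia.
  by apply: le_trans mono; apply: core_six; lia.
have e10 : (10 <= en core)%N by lia.
case: (core_seven_nat c7 e10) => [e11|q|[r2 z5 q p t]].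
- have h := dense_exf8 core_deg; rewrite c7 in h.
  have : 11 <= (en core)%:R :> rat by rewrite (ler_nat _ 11).
  lra.
- have := core_exf3; rewrite c7.
  have : 10 <= (en core)%:R :> rat by rewrite (ler_nat _ 10).
  have : 1 <= (en R)%:R :> rat by rewrite (ler_nat _ 1).
  lra.
- exact: (bipartite_exf cG G3 r2 z5 q p t aV).
Qed.

Lemma core_mem y A : (1 < #|nb A y|)%N -> y \in core.
Proof. by move=> h; rewrite inE; apply: leq_trans h (nb_leq_deg _ _). Qed.

(** The removed vertices and a cycle among the others are six nonpendant vertices, and each removal
    took away at least two edges. *)
Lemma three_lights y1 y2 y3 : conn [set: G] -> (2 < #|G|)%N -> apexk 4 [set: G] ->
  (1 < #|nb [set: G] y1|)%N -> conn ([set: G] :\ y1) ->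
  y2 \in [set: G] :\ y1 -> (1 < #|nb ([set: G] :\ y1) y2|)%N ->
  conn ([set: G] :\ y1 :\ y2) ->
  y3 \in [set: G] :\ y1 :\ y2 -> (1 < #|nb ([set: G] :\ y1 :\ y2) y3|)%N ->
  conn ([set: G] :\ y1 :\ y2 :\ y3) -> 3773 / 50 <= exf [set: G].
Proof.
move=> cG G3 aV n1 c1 y2H n2 c2 y3H n3 c3.
have a1 := light_apexk G3 (in_setT y1) aV; have a2 := light_apexk G3 y2H a1.
have a3 := light_apexk G3 y3H a2; have e3 := apexkS_nontree c3 a3.
have f1 := en_D1 (in_setT y1); have f2 := en_D1 y2H; have f3 := en_D1 y3H.
have g1 := cardsD1 y1 [set: G]; have g2 := cardsD1 y2 ([set: G] :\ y1).
have g3 := cardsD1 y3 ([set: G] :\ y1 :\ y2).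
rewrite in_setT cardsT in g1; rewrite y2H in g2; rewrite y3H in g3.
have [c cc cs] := en_cycle (proj1 c3) e3.
have sc : cset c \subset core :\ y1 :\ y2 :\ y3.
  apply/subsetP => x xc; have := subsetP cs x xc; rewrite !in_setD1.
  case/and4P=> -> -> -> _ /=; apply: (@core_mem x (cset c)).
  by apply: (cyc_nb cc); rewrite -?in_cset.
have k3 : (2 < #|cset c|)%N by rewrite card_cset //; case/and3P: cc.
have := subset_leq_card sc.
have y32 : y3 != y2 by move: y3H; rewrite in_setD1 => /andP[].
have y31 : y3 != y1 by move: y3H; rewrite !in_setD1 => /and3P[].
have y21 : y2 != y1 by move: y2H; rewrite in_setD1 => /andP[].
have := cardsD1 y1 core; have := cardsD1 y2 (core :\ y1).
have := cardsD1 y3 (core :\ y1 :\ y2).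
rewrite !in_setD1 y32 y31 y21 (core_mem n1) (core_mem n2) (core_mem n3) /=.
by move=> h1 h2 h3 h4; apply: core_big => //; lia.
Qed.

End Pendants.

(** Light vertices are removed until a heavy set remains, at most three times. The hypothesis on
    [#|G|] keeps 14 and then 13 vertices, which the unicyclic remainders need. *)
Lemma bicyclic4 (G : sgraph) : conn [set: G] -> (15 <= #|G|)%N -> apexk 4 [set: G] ->
  (#|G| < en [set: G])%N -> 3773 / 50 <= exf [set: G].
Proof.
move=> cG G15 aV eV; have G3 : (2 < #|G|)%N by lia.
have g1 y := cardsD1 y [set: G]; rewrite -cardsT in eV.
have [hV|[y1 [y1V n1 c1]]] := heavy_or_light [set: G].
  by have := heavy_alt_ge (bicyclic_heavy cG G3 cG hV eV); lra.
have a1 := light_apexk G3 y1V aV; have l1 := light_exf cG G3 cG y1V n1 c1.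
have {}g1 : (14 <= #|[set: G] :\ y1|)%N by have := g1 y1; rewrite in_setT cardsT; lia.
have e1 := apexkS_nontree c1 a1.
have [h1|[y2 [y2H n2 c2]]] := heavy_or_light ([set: G] :\ y1).
  have [h|e] := heavy_ge cG G3 c1 h1 e1; first by lra.
  have [c cc cs] := en_cycle (proj1 c1) e1.
  have hd x : x \in [set: G] :\ y1 -> (deg x <= #|nb ([set: G] :\ y1) x|.+1)%N.
    move=> _; rewrite (degE x) -addn1.
    have /subset_leq_card : nb [set: G] x \subset nb ([set: G] :\ y1) x :|: [set y1].
      apply/subsetP => w; rewrite !in_nb in_setU in_set1 in_nb in_setD1 in_setT /=.
      by case: (w == y1); rewrite ?orbT ?orbF.
    by move/leq_trans; apply; rewrite -(cards1 y1) leq_card_setU.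
  by have := uni14 cG G3 c1 cc cs e h1 g1 a1 hd; lra.
have a2 := light_apexk G3 y2H a1; have l2 := light_exf cG G3 c1 y2H n2 c2.
have g2 : (13 <= #|[set: G] :\ y1 :\ y2|)%N.
  by have := cardsD1 y2 ([set: G] :\ y1); rewrite y2H; lia.
have e2 := apexkS_nontree c2 a2.
have [h2|[y3 [y3H n3 c3]]] := heavy_or_light ([set: G] :\ y1 :\ y2).
  have [h|e] := heavy_ge cG G3 c2 h2 e2; first by lra.
  have [c cc cs] := en_cycle (proj1 c2) e2.
  by have := uni13 cG G3 c2 cc cs e h2 g2; lra.
exact: (three_lights cG G3 aV n1 c1 y2H n2 c2 y3H n3 c3).
Qed.

(** * Unicyclic graphs *)

(* (1 + 1/t)^3 - 1 = (3 + hz t) / t *)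
Definition hz (t : nat) : rat := 3 / t%:R + 1 / t%:R ^+ 2.
(** This and the two values below are the contributions, in terms of the number s of vertices, of
    the trees of A, B and C. In [Z_val], 14 comes from the two edges at the 2-vertex and 3 + hz from
    the s - 3 pendant vertices. *)
Definition star_val s : rat := (s - 1)%:R * (fw 1 s.+1 - 1) + delta s.+1.
Definition P_val s : rat := fw 3 (s - 1) - 1 + (s - 2)%:R * (fw 1 (s - 1) - 1).
Definition Z_val s : rat := 17 + hz (s - 3).

Lemma hz_ge0 t : 0 <= hz t.
Proof.
by rewrite /hz; apply: addr_ge0; apply: divr_ge0 => //; apply: exprn_ge0.
Qed.

Lemma hz_fw t : (0 < t)%N -> t%:R * (fw 1 t.+1 - 1) = 3 + hz t.
Proof. by move=> t0; rewrite fw1 // /hz addrA. Qed.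

Lemma hz_inv t : hz t = (t%:R^-1) * (3 + t%:R^-1).
Proof. by rewrite /hz div1r -exprVn; ring. Qed.

Lemma hz_le s t : (0 < s)%N -> (s <= t)%N -> hz t <= hz s.
Proof.
move=> s0 st; rewrite !hz_inv.
have h : t%:R^-1 <= s%:R^-1 :> rat by rewrite lef_pV2 ?ler_nat // posrE ltr0n; lia.
have h0 : 0 <= t%:R^-1 :> rat by rewrite invr_ge0.
by apply: ler_pM => //; lra.
Qed.

Lemma star_val4 : star_val 4 = 725 / 64.
Proof. by rewrite /star_val -[(4 - 1)%N]/3%N deltaE fw15 fw35 fw33; lra. Qed.

(** 18 exceeds Z_7, which is 285/16: from seven vertices on a star no longer competes, which gives
    the threshold k = 7. *)
Lemma star_val_ge7 s : (7 <= s)%N -> 18 <= star_val s.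
Proof.
rewrite leq_eqVlt => /orP[/eqP <-|s8].
  by rewrite /star_val -[(7 - 1)%N]/6%N deltaE fw18 fw38 fw33; lra.
have d9 : 826 / 50 <= delta s.+1.
  apply: le_trans (@delta_mono 9 s.+1 _); last by rewrite /= ltnS.
  have f39 : fw 3 9 = 19683 / 1000 by rewrite unlock hwE; field.
  by rewrite !deltaE fw33 f39; lra.
have S : 8 <= s%:R :> rat by rewrite (ler_nat _ 8).
have F : 1 <= fw 1 s.+1 by apply: fw1_ge1; lia.
have s0 : (0 < s)%N by lia.
have e := hz_fw s0; have h0 := hz_ge0 s.
rewrite /star_val (natrB _ s0); move: d9 S F e h0.
move: (delta _) (fw _ _) (hz _) (s%:R : rat) => d f h x; nra.
Qed.

Lemma star_val5 : 1413 / 100 <= star_val 5.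
Proof. by rewrite /star_val -[(5 - 1)%N]/4%N deltaE fw16 fw36 fw33; lra. Qed.

Lemma star_val6 : 1632 / 100 <= star_val 6.
Proof. by rewrite /star_val -[(6 - 1)%N]/5%N deltaE fw17 fw37 fw33; lra. Qed.

Lemma star_val_ge s : (5 <= s)%N -> 1413 / 100 <= star_val s.
Proof.
move=> s5; have [s7|s7] := leqP 7 s; first by have := star_val_ge7 s7; lra.
have [->|->] : s = 5%N \/ s = 6%N by lia.
  exact: star_val5.
by have := star_val6; lra.
Qed.

Lemma P_val4 : P_val 4 = 969 / 64.
Proof. by rewrite /P_val -[(4 - 1)%N]/3%N -[(4 - 2)%N]/2%N fw33 fw13; lra. Qed.

Lemma P_val5 : P_val 5 = 1728 / 125 - 1 + 37 / 9.
Proof. by rewrite /P_val -[(5 - 1)%N]/4%N -[(5 - 2)%N]/3%N fw34 fw14; lra. Qed.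

Lemma P_val_ge6 s : (6 <= s)%N -> 737 / 40 <= P_val s.
Proof.
rewrite leq_eqVlt => /orP[/eqP <-|s7].
  by rewrite /P_val -[(6 - 1)%N]/5%N -[(6 - 2)%N]/4%N fw35 fw15; lra.
have f : fw 3 6 <= fw 3 (s - 1) by apply: fw3_mono; lia.
have s0 : (0 < s - 2)%N by lia.
have := hz_fw s0; rewrite (_ : (s - 2).+1 = (s - 1)%N); last by lia.
by have := hz_ge0 (s - 2); rewrite /P_val fw36 in f *; lra.
Qed.

Section Kinds.
Variable G : sgraph.
Implicit Types (A B C D F H K L N P R S T X Z : {set G}) (a b u v w x y z : G) (c : seq G).

(* The trees of the graphs A, B and C attached at v: K_{1,s-1} with v as its
   center, K_{1,s-1} with v pendant, and Z_s with v its special pendant vertex. *)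
Definition star_at T v := deg v = #|T|.+1 /\
  forall z, z \in T -> z != v -> deg z = 1%N /\ adj v z.

Definition P_at T v := deg v = 3%N /\ exists z, [/\ nb T v = [set z],
  deg z = (#|T| - 1)%N &
  forall x, x \in T -> x != v -> x != z -> deg x = 1%N /\ adj z x].

Definition Z_at T v := deg v = 3%N /\ exists z x,
  [/\ nb T v = [set z] /\ deg z = 2%N, [/\ x \in T, adj z x & x != v],
   deg x = (#|T| - 2)%N &
   forall y, y \in T -> y != v -> y != z -> y != x -> deg y = 1%N /\ adj x y].

Hypotheses (cG : conn [set: G]) (G3 : (2 < #|G|)%N).
Variables (T : {set G}) (v : G).
Hypotheses (cT : conn T) (vT : v \in T).

Lemma star_at_kap : star_at T v -> star_val #|T| <= kap T v.
Proof. by move=> [dv h]; have := kap_star cG G3 cT vT h; rewrite dv /star_val. Qed.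

Lemma P_at_kap : P_at T v -> P_val #|T| <= kap T v.
Proof.
move=> [dv [z [nv dz h]]]; have [+ _ _] := kap_P cG G3 cT vT nv dv h.
by rewrite /ff dv dz /P_val.
Qed.

Hypotheses (T4 : (3 < #|T|)%N).

Lemma Z_at_kap : Z_at T v -> Z_val #|T| <= kap T v.
Proof.
move=> [dv [z [x [[nv dz] [xT zx xv] dx h]]]].
have := kap_two cG G3 cT vT nv xT dv zx xv dz.
have s0 : (0 < #|T| - 3)%N by lia.
have e : (#|T| - 3).+1 = (#|T| - 2)%N by lia.
have := hz_fw s0; rewrite e dx /Z_val.
case: (leqP #|T| 4) => [s4 _|s5 e2].
  have -> : #|T| = 4%N by lia.
  have h4 : hz 1 = 4 by rewrite /hz; lra.
  have f12 : fw 1 2 = 8 by rewrite unlock hwE; field.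
  rewrite -[(4 - 3)%N]/1%N -[(4 - 2)%N]/2%N h4 f12; case=> [[y [_ _ _ _ h21]]|[_]].
    by lra.
  lra.
case=> [[y [_ _ _ _ h21]]|[_ h14]]; last by lra.
have h1 : hz (#|T| - 3) <= hz 1 by apply: hz_le => //; lia.
by rewrite /hz in h1 *; lra.
Qed.

Hypothesis dv2 : deg v = (#|nb T v| + 2)%N.
Hypothesis clT : forall x y, x \in T -> x != v -> adj x y -> y \in T.

Lemma deg_inner x : x \in T -> x != v -> deg x = #|nb T x|.
Proof.
move=> xT xv; apply: eq_card => y; rewrite in_nb inE.
by case: (boolP (adj x y)) => [xy|]; rewrite ?andbF ?andbT // (clT xT xv xy).
Qed.

(** Now T contains all neighbours of its vertices other than v. So in the flat case the exceptional
    leaf has a child, which leads to [kap_high], and the deep case reaches either a third edge of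
    weight 8 or a second one of weight fw 3 3. *)
Lemma exact_kind : [\/ star_at T v, P_at T v, Z_at T v | 943 / 50 <= kap T v].
Proof.
have hd : (#|nb T v| + 2 <= deg v)%N by rewrite dv2.
case: (shapeP G3 cT vT (ltnW T4) hd).
- move=> h; constructor 1; split=> //.
  have e : nb T v = T :\ v.
    apply/setP => z; rewrite in_nb in_setD1; case: (eqVneq z v) => [->|zv].
      by rewrite adj_irrefl andbF.
    by case: (boolP (z \in T)) => // zT; case: (h z zT zv).
  by rewrite dv2 e; have := cardsD1 v T; rewrite vT; lia.
- move=> z zT vz dz dvT; constructor 4.
  have zv : z != v by rewrite eq_sym adj_neq.
  rewrite (deg_inner zT zv) in dz; case/card_gt1P: dz => a [b []].
  rewrite !in_nb => /andP[aT za] /andP[bT zb] ab.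
  have d4 : (3 < deg v)%N by lia.
  case: (eqVneq a v) => [e|av]; last exact: (kap_high cG G3 cT vT zT aT d4 vz za av).
  apply: (kap_high cG G3 cT vT zT bT d4 vz zb).
  by rewrite -e eq_sym.
- by move=> z x dv zT xT vz zx xv; constructor 4; apply: kap_high dv vz zx xv.
- move=> z x dv nv xT zx xv dz.
  have [zT vz] := nb_set1P nv.
  have [[y [_ _ _ _ h]]|[h _]] := kap_two cG G3 cT vT nv xT dv zx xv dz.
    by constructor 4; lra.
  constructor 3; split=> //; exists z, x; split=> //.
  have xz : x != z by rewrite eq_sym adj_neq.
  have zv : z != v by rewrite eq_sym adj_neq.
  rewrite (deg_inner xT xv).
  have -> : nb T x = T :\ v :\ x.
    apply/setP => y; rewrite in_nb !in_setD1.
    case: (eqVneq y x) => [->|yx]; first by rewrite adj_irrefl andbF.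
    case: (eqVneq y v) => [->|yv] /=.
      apply/negbTE/negP => /andP[_]; rewrite adjC => vx.
      have : x \in nb T v by rewrite in_nb xT.
      by rewrite nv in_set1 (negbTE xz).
    case: (boolP (y \in T)) => //= yT; case: (eqVneq y z) => [->|yz].
      by rewrite adjC.
    by case: (h y yT yv yz yx).
  have := cardsD1 v T; have := cardsD1 x (T :\ v).
  by rewrite in_setD1 xv xT vT; lia.
- move=> z x dv zT xT vz zx xv dz dx; constructor 4.
  have zv : z != v by rewrite eq_sym adj_neq.
  have nv1 : #|nb T v| = 1%N by lia.
  have nv : nb T v = [set z].
    by apply/esym/eqP; rewrite eqEcard sub1set in_nb zT vz cards1 nv1.
  have xz : x != z by rewrite eq_sym adj_neq.
  have := dx; rewrite leq_eqVlt => /orP[/eqP d2|d3].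
    have [y [yT xy yz]] : exists y, [/\ y \in T, adj x y & y != z].
      move: dx; rewrite (deg_inner xT xv) => /card_gt1P[a [b []]].
      rewrite !in_nb => /andP[aT xa] /andP[bT xb] ab.
      case: (eqVneq a z) => [e|az]; last by exists a.
      by exists b; split=> //; rewrite -e eq_sym.
    have yv : y != v.
      apply: contraTneq xy => ->; rewrite adjC; apply/negP => vx.
      have : x \in nb T v by rewrite in_nb xT.
      by rewrite nv in_set1 (negbTE xz).
    have y0 : (0 < deg y)%N by apply: (@adj_deg _ y x); rewrite adjC.
    have z0 : (0 < deg z)%N by apply: ltnW (ltnW dz).
    have e1 : ff x y = 8 by rewrite /ff -d2 fw2.
    have e2 : ff z x = 8 by rewrite /ff -d2 fwC (fw2 z0).
    have := kap_path3 cG G3 cT vT zT xT yT vz zx xv xy yz yv.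
    by have := ff3_ge dv dz; rewrite e1 e2 dv delta3; lra.
  have h1 := ff3_ge dv dz.
  have h2 : fw 3 3 <= ff z x by apply: fw_mono; rewrite ?dz ?d3.
  have := kap_path cG G3 cT vT zT xT vz zx xv; rewrite fw33 in h2.
  by rewrite dv delta3; lra.
- move=> z dv nv dz h; constructor 2; split=> //; exists z; split=> //.
  have [zT vz] := nb_set1P nv; have zv : z != v by rewrite eq_sym adj_neq.
  rewrite (deg_inner zT zv); have -> : nb T z = T :\ z.
    apply/setP => y; rewrite in_nb in_setD1.
    case: (eqVneq y z) => [->|yz]; first by rewrite adj_irrefl andbF.
    case: (boolP (y \in T)) => //= yT; case: (eqVneq y v) => [->|yv].
      by rewrite adjC.
    by case: (h y yT yv yz).
  by have := cardsD1 z T; rewrite zT; lia.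
Qed.

End Kinds.

Lemma star_sum_ge s : (4 <= s)%N -> 14 / 5 <= (s - 1)%:R * (fw 1 s.+1 - 1).
Proof.
move=> s4; have s0 : (0 < s)%N by lia.
have S : 4 <= s%:R :> rat by rewrite (ler_nat _ 4).
have nz : s%:R != 0 :> rat by rewrite pnatr_eq0 -lt0n.
have i4 : s%:R^-1 <= 1 / 4 :> rat by rewrite -[_^-1]div1r ler_pdivrMr; lra.
have i0 : 0 <= s%:R^-1 :> rat by rewrite invr_ge0.
have e := hz_fw s0; rewrite hz_inv in e.
have ef : fw 1 s.+1 - 1 = s%:R^-1 * (3 + s%:R^-1 * (3 + s%:R^-1)) by rewrite -e mulKf.
rewrite (natrB _ s0) ef mulrBl (mulVKf nz) mul1r.
move: i4 i0; move: (s%:R^-1 : rat) => i; nra.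
Qed.

Section Tri.
Variable G : sgraph.
Implicit Types (A B C D F H K L N P R S T X Z : {set G}) (a b u v w x y z : G).
Hypotheses (cG : conn [set: G]) (G3 : (2 < #|G|)%N).
Variables (c : seq G) (k : nat).
Hypotheses (cc : cyc c) (eV : en [set: G] = #|G|) (k4 : (4 <= k)%N)
  (aV : apexk k [set: G]).

Let cs : cset c \subset [set: G] := subsetT _.
Let eH : en [set: G] = #|[set: G]|. Proof. by rewrite cardsT. Qed.
Let T v := branch [set: G] c v.

(** Removing a light vertex from a unicyclic graph would leave fewer edges than vertices, hence a
    tree, although k >= 4. *)
Lemma V_heavy : heavy [set: G].
Proof.
move=> y _ n2 cD; have aD := light_apexk G3 (in_setT y) (apexk_le (leq_trans (isT : 2 <= 4)%N k4) aV).
have := apexkS_nontree cD aD.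
have := en_D1 (in_setT y); have := cardsD1 y [set: G]; rewrite in_setT cardsT eV.
lia.
Qed.

Lemma tri_size v : v \in cset c -> (k <= #|T v|)%N.
Proof. by rewrite in_cset => vc; apply: (uni_branch_card cG cc cs vc eH aV). Qed.

Lemma tri_kap4 v : v \in cset c -> 283 / 25 <= kap (T v) v.
Proof.
move=> vc; apply: (uni_kap4 cG G3 cG cc cs vc).
exact: leq_trans k4 (tri_size vc).
Qed.

(** Four branches give 4 (665/64 + 283/25), above the values of all candidates. *)
Lemma tri_long : (3 < #|cset c|)%N -> 434 / 5 <= exf [set: G].
Proof.
move=> c4; have r0 : 0 <= 283 / 25 :> rat by lra.
by have := uni_exf_ge cG G3 cG cc cs V_heavy c4 r0 tri_kap4; lra.
Qed.

Lemma tri_kind v : v \in cset c ->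
  [\/ star_at (T v) v, P_at (T v) v, Z_at (T v) v | 943 / 50 <= kap (T v) v].
Proof.
move=> vC; have vc : v \in c by rewrite -in_cset.
apply: (exact_kind cG G3 (conn_branch cG cc cs vc) (branch_self cc cs vc)).
- exact: leq_trans k4 (tri_size vC).
- by rewrite (uni_nb_branch cG cc cs eH vc) degE.
- by move=> x y xT xv xy; apply: (branch_closed cc cs vc xT xv (in_setT y) xy).
Qed.

(** F misses a cycle vertex v and therefore lies on one side of it. Inside the branch at v it would
    miss two further branches of size at least k, so it lies in [hcomp] and the branch at v has at
    most k vertices. *)
Lemma tri_min F : tset F -> (#|F| + k = #|G|)%N -> exists2 v, v \in cset c & #|T v| = k.
Proof.
move=> tF sF; have /subsetPn[v vC vF] : ~~ (cset c \subset F).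
  by apply/negP; apply: tset_acyclic.
have vc : v \in c by rewrite -in_cset.
exists v => //; apply/eqP; rewrite eqn_leq (tri_size vC) andbT.
have cTC := card_branch_hcomp cc cs vc; rewrite cardsT in cTC.
case: (eqVneq (F :&: hcomp [set: G] c v) set0) => [e|n0].
  have FT : F \subset T v :\ v.
    rewrite subsetD1 vF andbT; apply/subsetP => x xF; rewrite in_setD in_setT andbT.
    by apply/negP => xC; have := in_set0 x; rewrite -e in_setI xF xC.
  have h1 : (#|F| < #|branch [set: G] c v|)%N.
    by have := subset_leq_card FT; rewrite [X in (_ < X)%N](cardsD1 v) (branch_self cc cs vc).
  have h2 := uni_sum_card cG cc cs eH; rewrite (bigD1 v) //= cardsT in h2.
  have h3 : (k * (#|cset c| - 1) <= \sum_(i in cset c | i != v) #|branch [set: G] c i|)%N.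
    rewrite (eq_bigl (fun i => i \in cset c :\ v)); last by move=> i; rewrite in_setD1 andbC.
    rewrite (cardsD1 v (cset c)) vC addKn mulnC -sum_nat_const; apply: leq_sum => i.
    by rewrite in_setD1 => /andP[_]; apply: tri_size.
  have h4 : (k * 2 <= k * (#|cset c| - 1))%N by rewrite leq_mul2l; have := cset3 cc; lia.
  by clear - h1 h2 h3 h4 sF k4; lia.
have : F :&: hcomp [set: G] c v = F.
  apply: (proj2 (proj1 tF)) => //; first exact: subsetIl.
  move=> x y; rewrite !in_setI => /andP[xF xC] yF xy; rewrite yF /=.
  apply: (hcomp_closed cc cs vc xC (in_setT y) _ xy).
  by apply: contraNneq vF => <-.
by move/setIidPl/subset_leq_card => h; clear - h cTC sF; rewrite /T; lia.
Qed.

Section Three.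
Variables (u v w : G).
Hypotheses (uv : u != v) (uw : u != w) (vw : v != w) (c3 : cset c = [set u; v; w]).

Lemma tri_in : [/\ u \in cset c, v \in cset c & w \in cset c].
Proof. by rewrite c3 !inE !eqxx !orbT. Qed.

Lemma tri_big (R : Type) (idx : R) (op : Monoid.com_law idx) (f : G -> R) :
  \big[op/idx]_(x in cset c) f x = op (f u) (op (f v) (f w)).
Proof.
rewrite c3 (eq_bigl (fun x => x \in [:: u; v; w])); last by move=> x; rewrite !inE orbA.
rewrite -big_uniq ?big_cons ?big_nil ?Monoid.mulm1 //=.
by rewrite !inE negb_or uv uw vw.
Qed.

Lemma tri_card : (#|T u| + (#|T v| + #|T w|) = #|G|)%N.
Proof. by have := uni_sum_card cG cc cs eH; rewrite tri_big /= cardsT. Qed.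

Lemma tri_exf : 1995 / 64 + (kap (T u) u + (kap (T v) v + kap (T w) w)) <= exf [set: G].
Proof.
have := uni_exf cG G3 cG cc cs V_heavy; rewrite tri_big /=.
by rewrite -!/(T _); lra.
Qed.

Lemma tri_next (x a b : G) : x \in cset c -> a != x -> b != x -> a != b ->
  cset c = [set x; a; b] -> ff x (next c x) + ff x (prev c x) = ff x a + ff x b.
Proof.
rewrite in_cset => xc ax bx ab e.
have [nc pc _ _ [np nv pv]] := cyc_next cc xc.
rewrite -!in_cset e !inE (negbTE nv) /= in nc; rewrite -in_cset e !inE (negbTE pv) /= in pc.
case/orP: nc => /eqP n1; case/orP: pc => /eqP p1; rewrite n1 p1 ?eqxx // in np *.
by rewrite addrC.
Qed.

Lemma tri_ge : exf (T u) + (exf (T v) + exf (T w)) + (ff u v + ff u w + ff v w) <= exf [set: G].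
Proof.
have := branch_sum cG G3 cG cc cs; rewrite tri_big /= -!/(T _).
have [uC vC wC] := tri_in.
have e1 : ff u (next c u) + ff u (prev c u) = ff u v + ff u w.
  by apply: tri_next; rewrite // eq_sym.
have e2 : ff v (next c v) + ff v (prev c v) = ff v u + ff v w.
  apply: tri_next; rewrite // 1?eq_sym // c3.
  by apply/setP => x; rewrite !inE; case: (x == u); case: (x == v).
have e3 : ff w (next c w) + ff w (prev c w) = ff w u + ff w v.
  apply: tri_next; rewrite // c3.
  by apply/setP => x; rewrite !inE; case: (x == u); case: (x == v); case: (x == w).
rewrite e1 e2 e3 (ffC v u) (ffC w u) (ffC w v); lra.
Qed.

(** Here the splitting by [psi] is too weak, and the edge between the two roots is kept with its
    full weight. The terms [delta (deg w)] cancel between the third branch and its two triangle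
    edges; 348/25 = 2 * (14/5 - 1) + (283/25 - 1). *)
Lemma two_stars m : (4 <= m)%N -> (m <= #|T u|)%N -> (m <= #|T v|)%N ->
  star_at (T u) u -> star_at (T v) v ->
  fw m.+1 m.+1 + 2 * fw 3 m.+1 + 348 / 25 <= exf [set: G].
Proof.
move=> m4 mu mv su sv; have [uC vC wC] := tri_in.
have star_ge x : x \in cset c -> star_at (T x) x -> 14 / 5 <= exf (T x) + 1.
  move=> xC sx; have := star_at_kap cG G3 (conn_branch cG cc cs _) (branch_self cc cs _) sx.
  rewrite -in_cset => /(_ xC xC); have := star_sum_ge (leq_trans k4 (tri_size xC)).
  by rewrite /star_val kapE (proj1 sx); lra.
have hw := tri_kap4 wC; rewrite kapE in hw.
have d3 : (2 < deg w)%N.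
  by apply: (heavy_cyc_deg cG cc cs V_heavy); rewrite -in_cset.
have g x : (m <= #|T x|)%N -> star_at (T x) x -> fw 3 m.+1 + delta (deg w) / 2 <= ff x w.
  move=> mx [dx _]; apply: (@le_trans _ _ (fw m.+1 (deg w))); last first.
    by apply: fw_mono; rewrite ?dx ?ltnS ?leqnn ?(ltnW d3) ?mx ?(leq_trans _ m4).
  have m3 : (3 <= m.+1)%N := leqW (ltnW m4).
  by have := fw_super m3 d3; rewrite deltaE (fwC m.+1 3); lra.
have guv : fw m.+1 m.+1 <= ff u v.
  by rewrite /ff (proj1 su) (proj1 sv); apply: fw_mono; rewrite !ltnS ?mu ?mv (leq_trans _ m4).
have := tri_ge; have := star_ge u uC su; have := star_ge v vC sv.
have := g u mu su; have := g v mv sv; lra.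
Qed.

End Three.
End Tri.

Lemma balanced_prod a b x y : (a <= b)%N -> (x <= y <= x.+1)%N -> (a + b = x + y)%N ->
  (a = x /\ b = y) \/ (a * b < x * y)%N.
Proof.
move=> ab /andP[xy yx] e; case: (ltngtP a x) => [lt|gt|ax].
- by right; have -> : b = (x + y - a)%N; [lia|nia].
- by lia.
- by left; lia.
Qed.

(** For a fixed sum this increases with the inverse of the product, so balanced sizes are
    optimal. *)
Lemma hz_add a b : (0 < a)%N -> (0 < b)%N -> hz a + hz b =
  (3 * (a + b)%:R - 2) * (a * b)%:R^-1 + ((a + b)%:R * (a * b)%:R^-1) ^+ 2.
Proof.
move=> a0 b0; rewrite /hz natrM natrD.
have A : a%:R != 0 :> rat by rewrite pnatr_eq0 -lt0n.
have B : b%:R != 0 :> rat by rewrite pnatr_eq0 -lt0n.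
by field; rewrite A B.
Qed.

Lemma hz_balanced a b x y : (0 < a)%N -> (a <= b)%N -> (x <= y <= x.+1)%N ->
  (a + b = x + y)%N -> (a = x /\ b = y) \/ hz x + hz y < hz a + hz b.
Proof.
move=> a0 ab xy e; have [h|lt] := balanced_prod ab xy e; [by left|right].
have b0 : (0 < b)%N by lia.
have x0 : (0 < x)%N by case: x lt {xy e}.
have y0 : (0 < y)%N by lia.
rewrite !hz_add // -e; set S : rat := (a + b)%:R.
have S2 : 2 <= S by rewrite /S (ler_nat _ 2); lia.
have p1 : (x * y)%:R^-1 < (a * b)%:R^-1 :> rat.
  by rewrite ltf_pV2 ?ltr_nat // posrE ltr0n muln_gt0 ?x0 ?a0.
have p0 : 0 < (x * y)%:R^-1 :> rat by rewrite invr_gt0 ltr0n muln_gt0 x0.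
move: p1 p0 S2; move: (_%:R^-1) ((a * b)%:R^-1) S => p q S p1 p0 S2.
have h1 : (3 * S - 2) * p < (3 * S - 2) * q by rewrite ltr_pM2l //; lra.
have h2 : S * p <= S * q by rewrite ler_wpM2l //; lra.
have h3 : 0 <= S * p by apply: mulr_ge0; lra.
have h4 : (S * p) ^+ 2 <= (S * q) ^+ 2 by rewrite ler_sqr // nnegrE; lra.
lra.
Qed.

Lemma Z_balanced m a b : (4 <= a)%N -> (a <= b)%N -> (a + b = m)%N ->
  (a = m./2 /\ b = uphalf m) \/ Z_val m./2 + Z_val (uphalf m) < Z_val a + Z_val b.
Proof.
move=> a4 ab e; have m1 : (m = m./2 + uphalf m)%N by lia.
have m2 : (m./2 <= uphalf m <= (m./2).+1)%N by lia.
have q1 : (0 < a - 3)%N by lia.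
have q2 : (a - 3 <= b - 3)%N by lia.
have q3 : (m./2 - 3 <= uphalf m - 3 <= (m./2 - 3).+1)%N by lia.
have q4 : (a - 3 + (b - 3) = m./2 - 3 + (uphalf m - 3))%N by lia.
have [[h1 h2]|h] := hz_balanced q1 q2 q3 q4; first by left; lia.
by right; rewrite /Z_val; lra.
Qed.

Lemma Z_val_le s t : (4 <= s)%N -> (s <= t)%N -> Z_val t <= Z_val s.
Proof.
move=> s4 st; rewrite /Z_val lerD2l; apply: hz_le; lia.
Qed.

Lemma Z_val_ge s : 17 <= Z_val s.
Proof. by have := hz_ge0 (s - 3); rewrite /Z_val; lra. Qed.

Lemma Z_val6 : Z_val 6 = 163 / 9.
Proof. by rewrite /Z_val -[(6 - 3)%N]/3%N /hz; lra. Qed.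

Lemma Z_val7 : Z_val 7 = 285 / 16.
Proof. by rewrite /Z_val -[(7 - 3)%N]/4%N /hz; lra. Qed.

Lemma Z_val8 : Z_val 8 = 441 / 25.
Proof. by rewrite /Z_val -[(8 - 3)%N]/5%N /hz; lra. Qed.

Lemma star_val_ge6 s : (6 <= s)%N -> 1632 / 100 <= star_val s.
Proof.
rewrite leq_eqVlt => /orP[/eqP <-|s7]; first exact: star_val6.
by have := star_val_ge7 s7; lra.
Qed.

Lemma star_val6_le : star_val 6 <= 4084 / 250.
Proof. by rewrite /star_val -[(6 - 1)%N]/5%N deltaE fw17 fw37 fw33; lra. Qed.

(** Two of the branches are compared only through their sum, since the balancing argument bounds
    nothing else. *)
Lemma no_slack (r e x y z X Y Z : rat) :
  r + (x + (y + z)) <= e -> e <= r + (X + (Y + Z)) -> X <= x -> Y + Z <= y + z ->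
  (X < x -> False) /\ (Y + Z < y + z -> False).
Proof. by move=> h1 h2 h3 h4; split=> h; lra. Qed.

(** For k = 6 this excludes a smallest branch that is not a star when neither other branch is a star
    on six vertices. *)
Lemma three_big (e x y z X Y Z : rat) :
  1995 / 64 + (x + (y + z)) <= e -> e <= 1995 / 64 + (X + (Y + Z)) ->
  163 / 9 <= x -> 17 <= y -> 17 <= z ->
  Y <= 285 / 16 -> Z <= 441 / 25 -> X <= 4084 / 250 -> False.
Proof. lra. Qed.

Lemma num4_le (e X Y Z : rat) : e <= 1995 / 64 + (X + (Y + Z)) ->
  X = 725 / 64 -> Y = 969 / 64 -> Z <= 285 / 16 -> e <= 94 /\ e <= 151 / 2.
Proof. by move=> h1 h2 h3 h4; split; lra. Qed.

Lemma num4_nonP (e x y z X Y Z : rat) : 1995 / 64 + (x + (y + z)) <= e ->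
  e <= 1995 / 64 + (X + (Y + Z)) -> Y = 969 / 64 -> Z <= 285 / 16 ->
  X <= x -> 1693 / 100 <= y -> 1693 / 100 <= z -> False.
Proof. lra. Qed.

Lemma num4_big (e x y z X Y Z : rat) : 1995 / 64 + (x + (y + z)) <= e ->
  e <= 1995 / 64 + (X + (Y + Z)) -> X = 725 / 64 -> Y = 969 / 64 -> Z <= 285 / 16 ->
  1413 / 100 <= x -> 969 / 64 <= y -> 969 / 64 <= z -> False.
Proof. lra. Qed.

Lemma num5_le (e X Y Z : rat) : e <= 1995 / 64 + (X + (Y + Z)) ->
  X <= 1414 / 100 -> Y = 1728 / 125 - 1 + 37 / 9 -> Z <= 441 / 25 -> e <= 94.
Proof. lra. Qed.

Lemma num5_nonP (e x y z X Y Z : rat) : 1995 / 64 + (x + (y + z)) <= e ->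
  e <= 1995 / 64 + (X + (Y + Z)) -> Y = 1728 / 125 - 1 + 37 / 9 -> 17 <= Z ->
  X <= x -> Z <= y -> Z <= z -> False.
Proof. lra. Qed.

Lemma num5_big (e x y z X Y Z : rat) : 1995 / 64 + (x + (y + z)) <= e ->
  e <= 1995 / 64 + (X + (Y + Z)) -> X <= 1414 / 100 -> Y = 1728 / 125 - 1 + 37 / 9 ->
  Z <= 441 / 25 ->
  1693 / 100 <= x -> 1632 / 100 <= y -> 1632 / 100 <= z -> False.
Proof. lra. Qed.

Lemma star_val5_le : star_val 5 <= 1414 / 100.
Proof. by rewrite /star_val -[(5 - 1)%N]/4%N deltaE fw16 fw36 fw33; lra. Qed.

Lemma sum_sub a b d k n : (a + (b + d) = n)%N -> a = k -> (k <= d)%N -> (b <= n - 2 * k)%N.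
Proof. by move=> <- ->; lia. Qed.

(** * Shapes of the three branches in a minimal graph *)

Section Extremal.
Variable G : sgraph.
Implicit Types (A B C D F H K L N P R S T X Z : {set G}) (a b u v w x y z : G).
Hypotheses (cG : conn [set: G]) (G3 : (2 < #|G|)%N).
Variables (c : seq G) (k : nat).
Hypotheses (cc : cyc c) (eV : en [set: G] = #|G|) (k4 : (4 <= k)%N)
  (aV : apexk k [set: G]).

Let T v := branch [set: G] c v.
Let tkind v : v \in cset c ->
  [\/ star_at (T v) v, P_at (T v) v, Z_at (T v) v | 943 / 50 <= kap (T v) v].
Proof. exact: (tri_kind cG G3 cc eV k4 aV). Qed.

Let tsize v : v \in cset c -> (k <= #|T v|)%N.
Proof. exact: (tri_size cG cc eV aV). Qed.

Let texf u v w : u != v -> u != w -> v != w -> cset c = [set u; v; w] ->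
  1995 / 64 + (kap (T u) u + (kap (T v) v + kap (T w) w)) <= exf [set: G].
Proof. exact: (tri_exf cG G3 cc eV k4 aV). Qed.

Let tcard u v w : u != v -> u != w -> v != w -> cset c = [set u; v; w] ->
  (#|T u| + (#|T v| + #|T w|) = #|G|)%N.
Proof. exact: (tri_card cG cc eV). Qed.

Lemma tri_three a : (#|cset c| <= 3)%N -> a \in cset c -> exists b d,
  [/\ a != b, a != d, b != d, cset c = [set a; b; d] & (#|T b| <= #|T d|)%N].
Proof.
move=> c3 aC; have c2 : #|cset c :\ a| = 2%N.
  by have := cset3 cc; have := cardsD1 a (cset c); rewrite aC; lia.
move/eqP/cards2P: c2 => [b [d [bd e]]].
have /andP[ba _] : (b != a) && (b \in cset c) by rewrite -in_setD1 e !inE eqxx.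
have /andP[da _] : (d != a) && (d \in cset c) by rewrite -in_setD1 e !inE eqxx orbT.
have e3 : cset c = [set a; b; d] by rewrite -setUA -e setD1K.
rewrite eq_sym in ba; rewrite eq_sym in da.
have [bd_le|/ltnW db_le] := leqP #|T b| #|T d|; first by exists b, d.
by exists d, b; split; rewrite // 1?eq_sym // e3 setUAC.
Qed.

Let cTv v (vC : v \in cset c) : conn (T v) /\ v \in T v.
Proof.
rewrite in_cset in vC.
by split; [apply: (conn_branch cG cc (subsetT _) vC)|apply: (branch_self cc (subsetT _) vC)].
Qed.

Lemma star_kap v : v \in cset c -> star_at (T v) v -> star_val #|T v| <= kap (T v) v.
Proof. by move=> /cTv[cT vT]; apply: star_at_kap. Qed.

Lemma P_kap v : v \in cset c -> P_at (T v) v -> P_val #|T v| <= kap (T v) v.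
Proof. by move=> /cTv[cT vT]; apply: P_at_kap. Qed.

Lemma Z_kap v : v \in cset c -> Z_at (T v) v -> Z_val #|T v| <= kap (T v) v.
Proof.
move=> vC; have [cT vT] := cTv vC; apply: Z_at_kap => //.
exact: leq_trans k4 (tsize vC).
Qed.

Lemma Z_or_more v : v \in cset c -> ~ star_at (T v) v -> (6 <= #|T v|)%N ->
  Z_val #|T v| <= kap (T v) v /\ (Z_at (T v) v \/ Z_val #|T v| < kap (T v) v).
Proof.
move=> vC ns s6; have h : Z_val #|T v| <= 163 / 9.
  by rewrite -Z_val6; apply: Z_val_le.
case: (tkind vC) => [s|p|z|o].
- by case: ns.
- by have := P_kap vC p; have := P_val_ge6 s6; split; [|right]; lra.
- by split; [exact: Z_kap|left; exact: z].
- by split; [|right]; lra.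
Qed.

Lemma P_or_more v : v \in cset c -> ~ star_at (T v) v -> (5 <= #|T v|)%N ->
  [\/ P_at (T v) v /\ #|T v| = 5%N, Z_at (T v) v | 737 / 40 <= kap (T v) v].
Proof.
move=> vC ns s5; case: (tkind vC) => [s|p|z|o].
- by case: ns.
- case: (ltnP 5 #|T v|) => s6.
    by constructor 3; have := P_kap vC p; have := P_val_ge6 s6; lra.
  by constructor 1; split=> //; apply/eqP; rewrite eqn_leq s5 s6.
- by constructor 2.
- by constructor 3; lra.
Qed.

Hypothesis c3 : (#|cset c| <= 3)%N.
Variable a : G.
Hypotheses (aC : a \in cset c) (aT : #|T a| = k).

(** For at least seven vertices Z is strictly the cheapest shape, so each branch is a Z and only the
    sizes remain to be balanced. *)
Lemma extremal7 : (7 <= k)%N ->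
  exf [set: G] <= 1995 / 64 +
    (Z_val k + (Z_val (#|G| - k)./2 + Z_val (uphalf (#|G| - k)))) ->
  exists b d, [/\ [/\ a != b, a != d, b != d & cset c = [set a; b; d]],
    #|T b| = (#|G| - k)./2%N, #|T d| = uphalf (#|G| - k) &
    [/\ Z_at (T a) a, Z_at (T b) b & Z_at (T d) d]].
Proof.
move=> k7; have [b [d [ab ad bd e3 bdT]]] := tri_three c3 aC.
have [_ bC dC] := tri_in e3.
have sz := tcard ab ad bd e3; rewrite aT in sz.
have hZ v : v \in cset c -> Z_val #|T v| <= kap (T v) v /\
    (Z_at (T v) v \/ Z_val #|T v| < kap (T v) v).
  move=> vC; have s7 := leq_trans k7 (tsize vC).
  have h : Z_val #|T v| <= 285 / 16 by rewrite -Z_val7; apply: Z_val_le.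
  case: (tkind vC) => [s|p|z|o].
  - by have := star_kap vC s; have := star_val_ge7 s7; split; [|right]; lra.
  - by have := P_kap vC p; have := P_val_ge6 (ltnW s7); split; [|right]; lra.
  - by split; [exact: Z_kap|left; exact: z].
  - by split; [|right]; lra.
have [a1 a2] := hZ a aC; have [b1 b2] := hZ b bC; have [d1 d2] := hZ d dC.
have ge := texf ab ad bd e3; rewrite aT in a1 a2.
have b4 : (4 <= #|T b|)%N by apply: leq_trans k4 (tsize bC).
have sm : (#|T b| + #|T d| = #|G| - k)%N by clear - sz; lia.
have bal := Z_balanced b4 bdT sm => le.
have [eb ed] : #|T b| = (#|G| - k)./2%N /\ #|T d| = uphalf (#|G| - k).
  case: bal => [h|bal]; first exact: h.
  have hbd := le_trans (ltW bal) (lerD b1 d1).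
  by case: (no_slack ge le a1 hbd) => _ []; apply: lt_le_trans bal (lerD b1 d1).
exists b, d; split; [by split|exact: eb|exact: ed|rewrite eb in b1 b2; rewrite ed in d1 d2].
have [na nbd] := no_slack ge le a1 (lerD b1 d1); split.
- by case: a2 => [z|/na[]]; exact: z.
- by case: b2 => [z|h]; [exact: z|case: nbd; apply: ltr_leD h d1].
- by case: d2 => [z|h]; [exact: z|case: nbd; apply: ler_ltD b1 h].
Qed.

(** The bounds 94 and 151/2 lie just below [two_stars] with m = 5 and m = 4. *)
Lemma one_star u v : exf [set: G] <= 94 -> (5 <= k)%N \/ exf [set: G] <= 151 / 2 ->
  u \in cset c -> v \in cset c -> u != v -> star_at (T u) u -> ~ star_at (T v) v.
Proof.
move=> le h uC vC uv su sv.
have [b [d [ub ud bd e vbd]]] : exists b d, [/\ u != b, u != d, b != d,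
    cset c = [set u; b; d] & v = b].
  have [b [d [ub ud bd e _]]] := tri_three c3 uC.
  move: (vC); rewrite e !inE eq_sym (negbTE uv) /= => /orP[/eqP->|/eqP->].
    by exists b, d.
  by exists d, b; split; rewrite // 1?eq_sym // setUAC.
subst b; have two m := @two_stars G cG G3 c k cc eV k4 aV u v d uv ud bd e m.
case: h => [k5|h].
  have := two 5%N isT (leq_trans k5 (tsize uC)) (leq_trans k5 (tsize vC)) su sv.
  by rewrite fw66 fw36; lra.
have := two 4%N isT (leq_trans k4 (tsize uC)) (leq_trans k4 (tsize vC)) su sv.
by rewrite fw55 fw35; lra.
Qed.

Let star_dec v : star_at (T v) v \/ ~ star_at (T v) v.
Proof.
case: (boolP [&& deg v == #|T v|.+1 &
    [forall z in T v, (z != v) ==> (deg z == 1%N) && adj v z]]).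
  case/andP => /eqP dv /forall_inP h; left; split=> // z zT zv.
  by have /implyP/(_ zv)/andP[/eqP] := h z zT.
move/negP => h; right=> -[dv hz]; apply: h; rewrite dv eqxx /=.
by apply/forall_inP => z zT; apply/implyP => zv; have [-> ->] := hz z zT zv.
Qed.

(** On six vertices the star beats Z, but only one star is possible. The key point is that a star on
    exactly six vertices occurs, whether or not it is the given branch [a]; the other two branches
    are then balanced copies of Z. *)
Lemma extremal6 : k = 6%N -> (21 <= #|G|)%N ->
  exf [set: G] <= 1995 / 64 +
    (star_val 6 + (Z_val (#|G| - 6)./2 + Z_val (uphalf (#|G| - 6)))) ->
  exists u b d, [/\ [/\ u != b, u != d, b != d & cset c = [set u; b; d]],
    #|T u| = 6%N, #|T b| = (#|G| - 6)./2%N, #|T d| = uphalf (#|G| - 6) &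
    [/\ star_at (T u) u, Z_at (T b) b & Z_at (T d) d]].
Proof.
move=> k6 n21; have k5 : (5 <= k)%N by rewrite k6.
have m1 : (7 <= (#|G| - 6)./2)%N by lia.
have m2 : (8 <= uphalf (#|G| - 6))%N by lia.
have s6 v : v \in cset c -> (6 <= #|T v|)%N by move/tsize; rewrite k6.
have hb v : v \in cset c -> #|T v| <> 6%N \/ ~ star_at (T v) v -> 17 <= kap (T v) v.
  move=> vC nv; case: (star_dec v) nv => [sv [n6|ns]|nv _].
  - have s7 : (7 <= #|T v|)%N by rewrite ltn_neqAle s6 // andbT; apply/eqP/nesym.
    by have := star_kap vC sv; have := star_val_ge7 s7; lra.
  - by case: ns.
  - by have [h _] := Z_or_more vC nv (s6 v vC); have := Z_val_ge #|T v|; lra.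
move=> le.
have f1 : Z_val (#|G| - 6)./2 <= 285 / 16 by rewrite -Z_val7; apply: Z_val_le.
have f2 : Z_val (uphalf (#|G| - 6)) <= 441 / 25.
  by rewrite -Z_val8; apply: Z_val_le.
have f3 := star_val6_le.
have le94 : exf [set: G] <= 94 by lra.
have os u v := @one_star u v le94 (or_introl k5).
have [u [uC us su]] : exists u, [/\ u \in cset c, star_at (T u) u & #|T u| = 6%N].
  case: (star_dec a) => [sa|na]; first (exists a; split; [exact: aC|exact: sa|rewrite aT; exact: k6]).
  have [ha _] := Z_or_more aC na (s6 a aC); rewrite aT k6 Z_val6 in ha.
  have [b [d [ab ad bd e _]]] := tri_three c3 aC; have [_ bC dC] := tri_in e.
  have ge := texf ab ad bd e.
  case: (star_dec b) => [sb|nb].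
    case: (eqVneq #|T b| 6%N) => [b6|b6]; first (exists b; split; [exact: bC|exact: sb|exact: b6]).
    case: (star_dec d) => [sd|nd]; first by case: (os b d bC dC bd sb sd).
    have h1 := hb b bC (or_introl (elimN eqP b6)); have h2 := hb d dC (or_intror nd).
    exfalso; exact: (three_big ge le ha h1 h2 f1 f2 f3).
  case: (star_dec d) => [sd|nd].
    case: (eqVneq #|T d| 6%N) => [d6|d6]; first (exists d; split; [exact: dC|exact: sd|exact: d6]).
    have h2 := hb d dC (or_introl (elimN eqP d6)); have h1 := hb b bC (or_intror nb).
    exfalso; exact: (three_big ge le ha h1 h2 f1 f2 f3).
  have h1 := hb b bC (or_intror nb); have h2 := hb d dC (or_intror nd).
  exfalso; exact: (three_big ge le ha h1 h2 f1 f2 f3).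
have [b [d [ub ud bd e bdT]]] := tri_three c3 uC; have [_ bC dC] := tri_in e.
have ge := texf ub ud bd e; have sz := tcard ub ud bd e; rewrite su in sz.
have [b1 b2] := Z_or_more bC (os u b uC bC ub us) (s6 b bC).
have [d1 d2] := Z_or_more dC (os u d uC dC ud us) (s6 d dC).
have u1 := star_kap uC us; rewrite su in u1.
have b4 : (4 <= #|T b|)%N by apply: leq_trans k4 (tsize bC).
have sm : (#|T b| + #|T d| = #|G| - 6)%N by rewrite -sz addKn.
have bal := Z_balanced b4 bdT sm.
have [eb ed] : #|T b| = (#|G| - 6)./2%N /\ #|T d| = uphalf (#|G| - 6).
  case: bal => [h|bal]; first exact: h.
  have hbd := le_trans (ltW bal) (lerD b1 d1).
  by case: (no_slack ge le u1 hbd) => _ []; apply: lt_le_trans bal (lerD b1 d1).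
exists u, b, d; split; [split; [exact: ub|exact: ud|exact: bd|exact: e]|exact: su|exact: eb|exact: ed|].
rewrite eb in b1 b2; rewrite ed in d1 d2.
have [na nbd] := no_slack ge le u1 (lerD b1 d1); split.
- exact: us.
- by case: b2 => [z|h]; [exact: z|case: nbd; apply: ltr_leD h d1].
- by case: d2 => [z|h]; [exact: z|case: nbd; apply: ler_ltD b1 h].
Qed.

Lemma nonstar_kap v : v \in cset c -> ~ star_at (T v) v ->
  969 / 64 <= kap (T v) v /\
  (P_at (T v) v /\ #|T v| = 4%N \/ 1693 / 100 <= kap (T v) v).
Proof.
move=> vC ns; have s4 : (4 <= #|T v|)%N by apply: leq_trans k4 (tsize vC).
case: (tkind vC) => [s|p|z|o].
- by case: ns.
- have := P_kap vC p; have [s6|s6] := leqP 6 #|T v|.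
    by have := P_val_ge6 s6; split; [|right]; lra.
  have [e|e] : #|T v| = 4%N \/ #|T v| = 5%N by lia.
    rewrite e P_val4; split; first by lra.
    by left; split; [exact: p|].
  by rewrite e P_val5; split; [|right]; lra.
- by have := Z_kap vC z; have := Z_val_ge #|T v|; split; [|right]; lra.
- by split; [|right]; lra.
Qed.

Definition C_shape u b d := [/\ [/\ u != b, u != d, b != d & cset c = [set u; b; d]],
    #|T u| = k, #|T b| = k, #|T d| = (#|G| - 2 * k)%N &
    [/\ star_at (T u) u, P_at (T b) b & Z_at (T d) d]].

Lemma C_shape_of_P u b d : (7 <= #|G| - 2 * k)%N ->
  exf [set: G] <= 1995 / 64 + (star_val k + (P_val k + Z_val (#|G| - 2 * k))) ->
  u != b -> u != d -> b != d -> cset c = [set u; b; d] ->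
  star_at (T u) u -> #|T u| = k -> P_at (T b) b -> #|T b| = k ->
  ~ star_at (T d) d -> C_shape u b d.
Proof.
move=> m7; have f : Z_val (#|G| - 2 * k) <= 285 / 16 by rewrite -Z_val7; apply: Z_val_le.
move=> le ub ud bd e us su pb sb nd; have [uC bC dC] := tri_in e.
have ge := texf ub ud bd e; have sz := tcard ub ud bd e.
have sd : #|T d| = (#|G| - 2 * k)%N by rewrite -sz su sb addnA mul2n -addnn addKn.
have u1 := star_kap uC us; rewrite su in u1.
have b1 := P_kap bC pb; rewrite sb in b1.
have no (X : rat) : X <= kap (T d) d -> 737 / 40 <= X -> False.
  move=> h1 h2; move: f le ge u1 b1; move: (Z_val _) (star_val k) (P_val k) => x y z; lra.
split; [split; [exact: ub|exact: ud|exact: bd|exact: e]|exact: su|exact: sb|exact: sd|].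
split; [exact: us|exact: pb|].
case: (tkind dC) => [s|p|z|o].
- by case: nd.
- have d6 : (6 <= #|T d|)%N by rewrite sd; apply: ltnW.
  by case: (no _ (P_kap dC p) (P_val_ge6 d6)).
- exact: z.
- by case: (no _ o); lra.
Qed.

(** Without a star on four vertices the branches give at least 1413/100 and twice P_4; with one but
    without P on four vertices they give twice 1693/100 besides it. Both totals exceed the
    target. *)
Lemma extremal4 : k = 4%N -> (15 <= #|G|)%N ->
  exf [set: G] <= 1995 / 64 + (star_val k + (P_val k + Z_val (#|G| - 2 * k))) ->
  exists u b d, C_shape u b d.
Proof.
move=> k_4 n15; have m7 : (7 <= #|G| - 2 * k)%N by rewrite k_4; lia.
have f : Z_val (#|G| - 2 * k) <= 285 / 16 by rewrite -Z_val7; apply: Z_val_le.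
have s5 v : v \in cset c -> #|T v| <> k -> (5 <= #|T v|)%N.
  by move=> vC n; rewrite -k_4 ltn_neqAle tsize // andbT; apply/eqP/nesym.
have h v : v \in cset c -> star_at (T v) v -> #|T v| <> k -> 1413 / 100 <= kap (T v) v.
  by move=> vC sv n; apply: le_trans (star_val_ge (s5 v vC n)) (star_kap vC sv).
have f4 : star_val k = 725 / 64 by rewrite k_4; exact: star_val4.
have g4 : P_val k = 969 / 64 by rewrite k_4; exact: P_val4.
move=> le; have [le94 le75] := num4_le le f4 g4 f.
have os u v := @one_star u v le94 (or_intror le75).
have main u : u \in cset c -> star_at (T u) u -> #|T u| = k -> exists u b d, C_shape u b d.
  move=> uC us su; have [b [d [ub ud bd e _]]] := tri_three c3 uC.
  have [_ bC dC] := tri_in e.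
  have nb := os u b uC bC ub us; have nd := os u d uC dC ud us.
  have e' : cset c = [set u; d; b] by rewrite e setUAC.
  have db : d != b by rewrite eq_sym.
  have [_ b2] := nonstar_kap bC nb; have [_ d2] := nonstar_kap dC nd.
  have u1 := star_kap uC us; rewrite su in u1.
  have ge := texf ub ud bd e.
  case: b2 => [[pb sb]|b2].
    by exists u, b, d; exact: (C_shape_of_P m7 le ub ud bd e us su pb (etrans sb (esym k_4)) nd).
  case: d2 => [[pd sd]|d2].
    by exists u, d, b; exact: (C_shape_of_P m7 le ud ub db e' us su pd (etrans sd (esym k_4)) nb).
  by case: (num4_nonP ge le g4 f u1 b2 d2).
have star_case u : u \in cset c -> star_at (T u) u -> exists u b d, C_shape u b d.
  move=> uC us; case: (eqVneq #|T u| k) => [su|nu]; first exact: main uC us su.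
  have [b [d [ub ud bd e _]]] := tri_three c3 uC.
  have [_ bC dC] := tri_in e.
  have nb := os u b uC bC ub us; have nd := os u d uC dC ud us.
  have [b1 _] := nonstar_kap bC nb; have [d1 _] := nonstar_kap dC nd.
  by case: (num4_big (texf ub ud bd e) le f4 g4 f (h u uC us (elimN eqP nu)) b1 d1).
have [b [d [ab ad bd e _]]] := tri_three c3 aC; have [_ bC dC] := tri_in e.
case: (star_dec a) => [sa|na]; first exact: star_case aC sa.
case: (star_dec b) => [sb|nb]; first exact: star_case bC sb.
case: (star_dec d) => [sd|nd]; first exact: star_case dC sd.
have [a1 _] := nonstar_kap aC na; have [b1 _] := nonstar_kap bC nb.
have [d1 _] := nonstar_kap dC nd.
have {}a1 : 1413 / 100 <= kap (T a) a by apply: le_trans a1; lra.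
by case: (num4_big (texf ab ad bd e) le f4 g4 f a1 b1 d1).
Qed.

(** P on five vertices is below 17 and hence cheaper than every Z. If it is missing, both branches
    beside the star are at least as dear as Z on n - 2k vertices, the largest size available. *)
Lemma extremal5 : k = 5%N -> (18 <= #|G|)%N ->
  exf [set: G] <= 1995 / 64 + (star_val k + (P_val k + Z_val (#|G| - 2 * k))) ->
  exists u b d, C_shape u b d.
Proof.
move=> k_5 n15; have m8 : (8 <= #|G| - 2 * k)%N by rewrite k_5; lia.
have m7 : (7 <= #|G| - 2 * k)%N := ltnW m8.
have k5 : (5 <= k)%N by rewrite k_5.
have f : Z_val (#|G| - 2 * k) <= 441 / 25 by rewrite -Z_val8; apply: Z_val_le.
have s6 v : v \in cset c -> #|T v| <> k -> (6 <= #|T v|)%N.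
  by move=> vC n; rewrite -k_5 ltn_neqAle tsize // andbT; apply/eqP/nesym.
have h v : v \in cset c -> ~ (star_at (T v) v /\ #|T v| = k) -> 1632 / 100 <= kap (T v) v.
  move=> vC n; case: (star_dec v) => [sv|nv].
    have nk : #|T v| <> k by move=> e; apply: n; split.
    by apply: le_trans (star_val_ge6 (s6 v vC nk)) (star_kap vC sv).
  have [_ [[_ e]|h]] := nonstar_kap vC nv; last by apply: le_trans h; lra.
  have := tsize vC; rewrite e k_5 => q; discriminate q.
have f5 : star_val k <= 1414 / 100 by rewrite k_5; exact: star_val5_le.
have g5 : P_val k = 1728 / 125 - 1 + 37 / 9 by rewrite k_5; exact: P_val5.
have Z17 := Z_val_ge (#|G| - 2 * k).
move=> le; have le94 := num5_le le f5 g5 f.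
have os u v := @one_star u v le94 (or_introl k5).
have main u : u \in cset c -> star_at (T u) u -> #|T u| = k -> exists u b d, C_shape u b d.
  move=> uC us su; have [b [d [ub ud bd e _]]] := tri_three c3 uC.
  have [_ bC dC] := tri_in e.
  have nb := os u b uC bC ub us; have nd := os u d uC dC ud us.
  have e' : cset c = [set u; d; b] by rewrite e setUAC.
  have db : d != b by rewrite eq_sym.
  have u1 := star_kap uC us; rewrite su in u1.
  have ge := texf ub ud bd e; have sz := tcard ub ud bd e.
  have sb : (#|T b| <= #|G| - 2 * k)%N by apply: sum_sub sz su (tsize dC).
  have sd : (#|T d| <= #|G| - 2 * k)%N.
    by apply: sum_sub su (tsize bC); rewrite addnCA addnC -addnA.
  have b5 : (5 <= #|T b|)%N by apply: leq_trans k5 (tsize bC).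
  have d5 : (5 <= #|T d|)%N by apply: leq_trans k5 (tsize dC).
  have hZ v : v \in cset c -> (5 <= #|T v|)%N -> (#|T v| <= #|G| - 2 * k)%N ->
      ~ star_at (T v) v -> (P_at (T v) v /\ #|T v| = k) \/ Z_val (#|G| - 2 * k) <= kap (T v) v.
    move=> vC v5 vm nv; case: (P_or_more vC nv v5) => [[p ep]|z|o].
    - by left; split; [exact: p|rewrite ep k_5].
    - by right; apply: le_trans (Z_kap vC z); apply: Z_val_le; [apply: ltnW|].
    - by right; apply: le_trans f _; apply: le_trans o; lra.
  case: (hZ b bC b5 sb nb) => [[pb eb]|b2].
    by exists u, b, d; exact: (C_shape_of_P m7 le ub ud bd e us su pb eb nd).
  case: (hZ d dC d5 sd nd) => [[pd ed]|d2].
    by exists u, d, b; exact: (C_shape_of_P m7 le ud ub db e' us su pd ed nb).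
  by case: (num5_nonP ge le g5 Z17 u1 b2 d2).
have all u : u \in cset c -> (exists u b d, C_shape u b d) \/ 1632 / 100 <= kap (T u) u.
  move=> uC; case: (star_dec u) => [su|nu].
    case: (eqVneq #|T u| k) => [eu|neu]; first by left; exact: main uC su eu.
    by right; apply: h uC _ => -[_ eu]; rewrite eu eqxx in neu.
  by right; apply: (h u uC) => -[s1 _]; exact: nu s1.
have [b [d [ab ad bd e _]]] := tri_three c3 aC; have [_ bC dC] := tri_in e.
case: (star_dec a) => [sa|na]; first exact: main aC sa aT.
have [_ [[_ e4]|a1]] := nonstar_kap aC na.
  exfalso; move: k_5; rewrite -aT e4; discriminate.
case: (all b bC) => [b1|b1]; first exact: b1.
case: (all d dC) => [d1|d1]; first exact: d1.
by case: (num5_big (texf ab ad bd e) le f5 g5 f a1 b1 d1).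
Qed.

End Extremal.

Definition A_value k n : rat :=
  1995 / 64 + (Z_val k + (Z_val (n - k)./2 + Z_val (uphalf (n - k)))).
Definition B_value n : rat :=
  1995 / 64 + (star_val 6 + (Z_val (n - 6)./2 + Z_val (uphalf (n - 6)))).
Definition C_value k n : rat :=
  1995 / 64 + (star_val k + (P_val k + Z_val (n - 2 * k))).

Lemma Z_val9 : Z_val 9 = 631 / 36.
Proof. by rewrite /Z_val -[(9 - 3)%N]/6%N /hz; lra. Qed.

(** The sizes are at least 7, 8 and 9 because n >= 3k + 3, and [Z_val] decreases. *)
Lemma A_value_lt k n : (7 <= k)%N -> (3 * k + 3 <= n)%N -> A_value k n < 421 / 5.
Proof.
move=> k7 kn; have h1 : (8 <= (n - k)./2)%N by lia.
have h2 : (9 <= uphalf (n - k))%N by lia.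
have := @Z_val_le 7 k isT k7; have := @Z_val_le 8 _ isT h1; have := @Z_val_le 9 _ isT h2.
by rewrite Z_val7 Z_val8 Z_val9 /A_value; lra.
Qed.

Lemma B_value_lt n : (21 <= n)%N -> B_value n < 421 / 5.
Proof.
move=> kn; have h1 : (7 <= (n - 6)./2)%N by lia.
have h2 : (8 <= uphalf (n - 6))%N by lia.
have := @Z_val_le 7 _ isT h1; have := @Z_val_le 8 _ isT h2; have := star_val6_le.
by rewrite Z_val7 Z_val8 /B_value; lra.
Qed.

Lemma C_value5_lt n : (18 <= n)%N -> C_value 5 n < 80.
Proof.
move=> kn; have h1 : (8 <= n - 2 * 5)%N by lia.
have := @Z_val_le 8 _ isT h1; have := star_val5_le; have := P_val5.
by rewrite Z_val8 /C_value; lra.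
Qed.

Lemma C_value4_lt n : (15 <= n)%N -> C_value 4 n < 3773 / 50.
Proof.
move=> kn; have h1 : (7 <= n - 2 * 4)%N by lia.
have := @Z_val_le 7 _ isT h1; have := star_val4; have := P_val4.
by rewrite Z_val7 /C_value; lra.
Qed.

Section Main.
Let lt421 : 421 / 5 < 434 / 5 :> rat. Proof. lra. Qed.
Let lt80 : 80 < 434 / 5 :> rat. Proof. lra. Qed.
Let lt3773 : 3773 / 50 < 434 / 5 :> rat. Proof. lra. Qed.

Variable G : sgraph.
Implicit Types (F : {set G}).
Variable k : nat.
Hypotheses (cG : conn [set: G]) (k4 : (4 <= k)%N) (n3 : (3 * k + 3 <= #|G|)%N)
  (aV : apexk k [set: G]).

Let G3 : (2 < #|G|)%N. Proof. lia. Qed.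

Lemma triangle_case (X : rat) : exf [set: G] <= X -> X < 434 / 5 ->
  ((#|[set: G]| < en [set: G])%N -> X < exf [set: G]) ->
  exists c : seq G, [/\ cyc c, en [set: G] = #|G| & (#|cset c| <= 3)%N].
Proof.
move=> le lt bi; have k0 : (0 < k)%N := ltnW (ltnW (ltnW k4)).
have eV := apexk_nontree k0 cG aV.
have e : en [set: G] = #|G|.
  move: eV; rewrite leq_eqVlt => /orP[/eqP h|h]; first by rewrite -h; exact: cardsT.
  by have := bi h; rewrite ltNge le.
have [c cc _] := en_cycle (proj1 cG) eV; exists c; split; [exact: cc|exact: e|].
rewrite leqNgt; apply/negP => c4.
have := tri_long cG G3 cc e k4 aV c4; lra.
Qed.

Variable F0 : {set G}.
Hypotheses (tF : tset F0) (sF : (#|F0| + k = #|G|)%N).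

Definition tri_shape (c : seq G) u b d := [/\ cyc c, en [set: G] = #|G| &
  [/\ u != b, u != d, b != d & cset c = [set u; b; d]]].

Theorem extremal_A : (7 <= k)%N -> exf [set: G] <= A_value k #|G| -> exists (c : seq G) u b d,
  let T := branch [set: G] c in
  [/\ tri_shape c u b d,
    [/\ #|T u| = k, #|T b| = (#|G| - k)./2 & #|T d| = uphalf (#|G| - k)] &
    [/\ Z_at (T u) u, Z_at (T b) b & Z_at (T d) d]].
Proof.
move=> k7 le; have lt := A_value_lt k7 n3.
have a6 := apexk_le (ltnW k7) aV.
have lt' := lt_trans lt lt421.
have [c [cc eV c3]] := triangle_case le lt' (fun h => lt_le_trans lt (bicyclic6 cG G3 cG h a6)).
have [a aC aT] := tri_min cG G3 cc eV k4 aV tF sF.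
have [b [d [[ab ad bd e] sb sd [za zb zd]]]] :=
  extremal7 cG G3 cc eV k4 aV c3 aC aT k7 le.
by exists c, a, b, d; exact: And3 (And3 cc eV (And4 ab ad bd e)) (And3 aT sb sd) (And3 za zb zd).
Qed.

Theorem extremal_B : k = 6%N -> exf [set: G] <= B_value #|G| -> exists (c : seq G) u b d,
  let T := branch [set: G] c in
  [/\ tri_shape c u b d,
    [/\ #|T u| = 6, #|T b| = (#|G| - 6)./2 & #|T d| = uphalf (#|G| - 6)] &
    [/\ star_at (T u) u, Z_at (T b) b & Z_at (T d) d]].
Proof.
move=> k6 le; have n21 : (21 <= #|G|)%N by move: n3; rewrite k6.
have lt := B_value_lt n21; have a6 : apexk 6 [set: G] by rewrite -k6.
have lt' := lt_trans lt lt421.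
have [c [cc eV c3]] := triangle_case le lt' (fun h => lt_le_trans lt (bicyclic6 cG G3 cG h a6)).
have [a aC aT] := tri_min cG G3 cc eV k4 aV tF sF.
have [u [b [d [[ab ad bd e] su sb sd [za zb zd]]]]] :=
  extremal6 cG G3 cc eV k4 aV c3 aC aT k6 n21 le.
by exists c, u, b, d; exact: And3 (And3 cc eV (And4 ab ad bd e)) (And3 su sb sd) (And3 za zb zd).
Qed.

Theorem extremal_C : (k <= 5)%N -> exf [set: G] <= C_value k #|G| -> exists (c : seq G) u b d,
  let T := branch [set: G] c in
  [/\ tri_shape c u b d,
    [/\ #|T u| = k, #|T b| = k & #|T d| = #|G| - 2 * k]%N &
    [/\ star_at (T u) u, P_at (T b) b & Z_at (T d) d]].
Proof.
move=> k5 le; have [k_4|k_5] : k = 4%N \/ k = 5%N by clear - k5 k4; lia.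
  have n15 : (15 <= #|G|)%N by move: n3; rewrite k_4.
  have a4 : apexk 4 [set: G] by rewrite -k_4.
  have lt : C_value k #|G| < 3773 / 50 by rewrite k_4; exact: C_value4_lt.
  have lt' := lt_trans lt lt3773.
  have [c [cc eV c3]] := triangle_case le lt' (fun h => lt_le_trans lt (bicyclic4 cG n15 a4
    (eq_ind _ (fun m => m < _)%N h _ (cardsT _)))).
  have [a aC aT] := tri_min cG G3 cc eV k4 aV tF sF.
  have [u [b [d [[ab ad bd e] su sb sd [za zb zd]]]]] :=
    extremal4 cG G3 cc eV k4 aV c3 aC aT k_4 n15 le.
  by exists c, u, b, d; exact: And3 (And3 cc eV (And4 ab ad bd e)) (And3 su sb sd) (And3 za zb zd).
have n18 : (18 <= #|G|)%N by move: n3; rewrite k_5.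
have a5 : apexk 5 [set: G] by rewrite -k_5.
have lt : C_value k #|G| < 80 by rewrite k_5; exact: C_value5_lt.
have lt' := lt_trans lt lt80.
have [c [cc eV c3]] := triangle_case le lt' (fun h => lt_le_trans lt (bicyclic5 cG G3 cG h a5)).
have [a aC aT] := tri_min cG G3 cc eV k4 aV tF sF.
have [u [b [d [[ab ad bd e] su sb sd [za zb zd]]]]] :=
  extremal5 cG G3 cc eV k4 aV c3 aC aT k_5 n18 le.
by exists c, u, b, d; exact: And3 (And3 cc eV (And4 ab ad bd e)) (And3 su sb sd) (And3 za zb zd).
Qed.

End Main.

(** * The index as an excess *)

Section AZI.
Variable G : sgraph.
Implicit Types (u v x y : G).

Lemma set2_eq (T : finType) (a b x y : T) : a != b ->
  ([set x; y] == [set a; b]) = ((x, y) == (a, b)) || ((x, y) == (b, a)).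
Proof.
move=> ab; rewrite !xpair_eqE; apply/eqP/orP => [e|].
  have hx : x \in [set a; b] by rewrite -e in_set2 eqxx.
  have hy : y \in [set a; b] by rewrite -e in_set2 eqxx orbT.
  have ha : a \in [set x; y] by rewrite e in_set2 eqxx.
  have hb : b \in [set x; y] by rewrite e in_set2 eqxx orbT.
  move: hx hy ha hb; rewrite !in_set2 => /orP[]/eqP-> /orP[]/eqP->; rewrite ?eqxx ?orbT /=.
  - by rewrite orbb eq_sym (negbTE ab).
  - by left.
  - by right.
  - by rewrite orbb (negbTE ab).
by case=> /andP[/eqP-> /eqP->] //; rewrite setUC.
Qed.

Let term (e : {set G}) : rat :=
  ((\prod_(v in e) deg v)%N%:R / ((\sum_(v in e) deg v)%N%:R - 2%:R)) ^+ 3.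

Lemma term_edge u v : adj u v -> term [set u; v] = ff u v.
Proof.
move=> uv; have nuv := adj_neq uv.
by rewrite /term !big_setU1 ?in_set1 // !big_set1 /ff unlock hwE natrM natrD.
Qed.

(** Every edge of the statement, a set of two vertices, comes from exactly two ordered pairs. *)
Lemma AZI_exf : AZI G = #|G|%:R + exf [set: G].
Proof.
rewrite exfE /ex cardsT addrC subrK.
suff -> : W (@ff G) [set: G] [set: G] = AZI G * 2 by rewrite mulfK.
have -> : W (@ff G) [set: G] [set: G] =
    \sum_(p : G * G | adj p.1 p.2) term [set p.1; p.2].
  rewrite /W (eq_bigl xpredT); last by move=> x; rewrite in_setT.
  rewrite pair_big_dep /=; apply: eq_big => [p|[x y] /= ]; first by rewrite in_nb in_setT.
  by rewrite in_nb => /andP[_ /term_edge ->].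
rewrite (partition_big (fun p : G * G => [set p.1; p.2]) (mem (edges G))) /=; last first.
  by move=> p pp; apply/imsetP; exists p; rewrite ?inE.
rewrite /AZI mulr_suml; apply: eq_bigr => e /imsetP[[u v]]; rewrite inE /= => uv ->.
have nuv := adj_neq uv.
rewrite -/(term _) (eq_bigl (fun p => (p == (u, v)) || (p == (v, u)))); last first.
  move=> [x y] /=; rewrite set2_eq //; case: eqP => [[-> ->]|_] /=; first by rewrite uv.
  by case: eqP => [[-> ->]|_]; rewrite ?andbF // adj_sym uv.
rewrite (bigD1 (u, v)) ?eqxx //= (bigD1 (v, u)) /=; last first.
  by rewrite eqxx orbT xpair_eqE eq_sym (negbTE nuv).
rewrite big1 ?addr0; last by move=> p; case: eqP => //= _; case: eqP.
by rewrite [[set v; u]]setUC mulr_natr mulr2n.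
Qed.

End AZI.

(** * Candidates *)

Section ParentGraph.
Variables (G : sgraph) (par : G -> G).
Hypotheses (adjE : forall x y, adj x y = (par x == y) || (par y == x))
  (par2 : forall x, par (par x) != x).

(** Neighbours are the parent and the children, and [par2] keeps the parent from being a child as
    well. Consequently each vertex owns exactly one edge, the one to its parent. *)
Lemma par_sum (R : Type) (idx : R) (op : Monoid.com_law idx)
    (f : G -> G -> R) (x : G) :
  \big[op/idx]_(y in nb [set: G] x) f x y =
  op (f x (par x)) (\big[op/idx]_(y | par y == x) f x y).
Proof.
have px : par x \in nb setT x by rewrite in_nb in_setT adjE eqxx.
rewrite (bigD1 (par x) px).
congr (op _ _); apply: eq_bigl => y.
transitivity ((y \in nb setT x) && (y != par x)) => //.
rewrite in_nb in_setT adjE [y == _]eq_sym.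
case: (eqVneq (par x) y) => [<-|yx] /=; last by rewrite andbT.
by rewrite (negbTE (par2 x)).
Qed.

Lemma par_exchange (R : Type) (idx : R) (op : Monoid.com_law idx)
    (f : G -> G -> R) :
  \big[op/idx]_x \big[op/idx]_(y | par y == x) f x y = \big[op/idx]_y f (par y) y.
Proof.
rewrite (exchange_big_dep xpredT) //=; apply: eq_bigr => y _.
rewrite (eq_bigl (fun x => x == par y)); last by move=> x; rewrite eq_sym.
by rewrite big_pred1_eq.
Qed.

Lemma par_deg (x : G) : deg x = #|[set y | par y == x]|.+1.
Proof.
rewrite degE -sum1_card (par_sum _ (fun _ _ => 1%N)) /= add1n; congr _.+1.
by rewrite -sum1_card; apply: eq_bigl => y; rewrite inE.
Qed.

Lemma par_en : en [set: G] = #|G|.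
Proof.
rewrite /en; suff -> : e2 [set: G] = #|G|.*2 by rewrite doubleK.
rewrite /e2 (eq_bigl xpredT); last by move=> x; rewrite in_setT.
rewrite (eq_bigr (fun x => (1 + \sum_(y | par y == x) 1)%N)); last first.
  by move=> x _; rewrite -sum1_card (par_sum _ (fun _ _ => 1%N)).
by rewrite big_split /= (par_exchange _ (fun _ _ => 1%N)) -addnn sum1_card.
Qed.

Lemma par_exf : exf [set: G] =
  \sum_(x : G) fw (deg x) (deg (par x)) - #|G|%:R.
Proof.
rewrite exfE /ex cardsT; congr (_ - _).
rewrite /W (eq_bigl xpredT); last by move=> x; rewrite in_setT.
rewrite (eq_bigr _ (fun x _ => par_sum _ (@ff _) x)) big_split /= par_exchange.
rewrite (eq_bigr (fun y => ff y (par y)) (fun y _ => ffC (par y) y)).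
suff h (S : rat) : (S + S) / 2 = S by exact: h.
by lra.
Qed.

(** Iterating [par] brings every nonempty closed set to r, and the complement of a closed set is
    closed too. *)
Lemma par_conn r : (forall x, exists m, iter m par x = r) -> conn [set: G].
Proof.
move=> hr; have reach (A : {set G}) x : closed_in [set: G] A -> x \in A -> r \in A.
  move=> clA xA; have [m <-] := hr x; elim: m => // m IH.
  by apply: clA IH (in_setT _) _; rewrite adjE eqxx.
split; first by apply/set0Pn; exists r.
move=> A _ /set0Pn[x xA] clA; apply/setP => y; rewrite in_setT.
have rA := reach A x clA xA; apply/negPn/negP => yA.
have clC : closed_in [set: G] (~: A).
  move=> a b; rewrite !in_setC => aA _ ab; apply: contra aA => bA.
  by apply: clA bA (in_setT _) _; rewrite adj_sym.
have : r \in ~: A by apply: (reach _ y clC); rewrite in_setC.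
by rewrite in_setC rA.
Qed.

End ParentGraph.

Local Open Scope nat_scope.

Section Brooms.
Variables (d t : 'I_3 -> nat).

Let V : finType := {i : 'I_3 & 'I_(d i + t i).+1}.
(** Position 0 is the triangle vertex, positions 1 to [d i] form the path, and the remaining [t i]
    positions are the pendant vertices. *)
Let at_ (i : 'I_3) (j : nat) : V := @Tagged 'I_3 i (fun i => 'I_(d i + t i).+1) (inord j).

(* A triangle with, at its i-th vertex, a path of length d i carrying t i pendant
   vertices at its end, encoded by a parent function that turns around the
   triangle. For d i = 0, 1, 2 the attached trees are those of A, B and C. *)
Definition broom_par (x : V) : V :=
  if tagged x == 0%N :> nat then at_ (ordS (tag x)) 0
  else at_ (tag x) (if (tagged x <= d (tag x))%N then (tagged x).-1 else d (tag x)).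

Lemma at_eq i i' j j' : (j <= d i + t i)%N -> (j' <= d i' + t i')%N ->
  (at_ i j == at_ i' j') = (i == i') && (j == j').
Proof.
move=> hj hj'; rewrite -tag_eqE /tag_eq /=; case: eqVneq => [e|//] /=.
subst i'; rewrite tagged_asE -val_eqE /=.
by rewrite !inordK.
Qed.

Lemma at_E (x : V) : x = at_ (tag x) (tagged x).
Proof. by case: x => i j; rewrite /at_ /= inord_val. Qed.

Lemma at_bound (x : V) : (tagged x <= d (tag x) + t (tag x))%N.
Proof. by rewrite -ltnS. Qed.

Lemma par_at0 i : broom_par (at_ i 0) = at_ (ordS i) 0.
Proof. by rewrite /broom_par /= inordK. Qed.

Lemma par_atS i j : (0 < j <= d i + t i)%N ->
  broom_par (at_ i j) = at_ i (if (j <= d i)%N then j.-1 else d i).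
Proof.
by case/andP=> j0 hj; rewrite /broom_par /= inordK ?ltnS // -[_ == _]negbK -lt0n j0.
Qed.

Lemma ordS_neq (i : 'I_3) : ordS i != i.
Proof. by case: i => [[|[|[]]]]. Qed.

Lemma ordS2_neq (i : 'I_3) : ordS (ordS i) != i.
Proof. by case: i => [[|[|[]]]]. Qed.

Lemma step_bound i j : (0 < j <= d i + t i)%N ->
  ((if (j <= d i)%N then j.-1 else d i) <= d i + t i)%N.
Proof. by case: ifP; lia. Qed.

Lemma broom_par1 x : broom_par x != x.
Proof.
rewrite [x]at_E; move: (tag x) (tagged x : nat) (at_bound x) => i [|j] hj.
  by rewrite par_at0 at_eq // negb_and ordS_neq.
by rewrite par_atS // at_eq // ?step_bound // eqxx /=; case: ifP; lia.
Qed.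

Lemma broom_par2 x : broom_par (broom_par x) != x.
Proof.
rewrite [x]at_E; move: (tag x) (tagged x : nat) (at_bound x) => i [|j] hj.
  by rewrite !par_at0 at_eq // negb_and ordS2_neq.
rewrite par_atS //; set k := (if _ then _ else _).
have kj : (k < j.+1)%N by rewrite /k; case: ifP; lia.
case: (posnP k) => k0.
  by rewrite k0 par_at0 at_eq // negb_and ordS_neq.
rewrite par_atS ?at_eq ?k0 ?step_bound //=; try lia.
by rewrite eqxx /=; case: ifP; lia.
Qed.

Definition broom_adj : rel V := fun x y => (broom_par x == y) || (broom_par y == x).

Lemma broom_adj_sym : symmetric broom_adj.
Proof. by move=> x y; rewrite /broom_adj orbC. Qed.

Lemma broom_adj_irrefl : irreflexive broom_adj.
Proof. by move=> x; rewrite /broom_adj orbb (negbTE (broom_par1 x)). Qed.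

Definition broom := SGraph broom_adj_sym broom_adj_irrefl.

Lemma broom_big (R : Type) (idx : R) (op : Monoid.com_law idx) (f : V -> R) :
  \big[op/idx]_x f x = \big[op/idx]_(i < 3) op (f (at_ i 0))
    (op (\big[op/idx]_(j < d i) f (at_ i j.+1))
        (\big[op/idx]_(j < t i) f (at_ i (d i + j).+1))).
Proof.
have e := @sig_big_dep R idx op 'I_3 (fun i => 'I_(d i + t i).+1) xpredT (fun _ _ => true)
  (fun i j => f (@Tagged 'I_3 i (fun i => 'I_(d i + t i).+1) j)).
transitivity (\big[op/idx]_(p : V) f (@Tagged 'I_3 (tag p) _ (tagged p))).
  by apply: eq_bigr => -[].
rewrite -[LHS]e {e}.
apply: eq_bigr => i _; rewrite big_ord_recl big_split_ord /=; congr (op _ (op _ _)).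
- by congr (f (Tagged _ _)); apply: val_inj; rewrite /= inordK.
- by apply: eq_bigr => j _; congr (f (Tagged _ _)); apply: val_inj; rewrite /= inordK // ltnS; case: j => j /= hj; lia.
- by apply: eq_bigr => j _; congr (f (Tagged _ _)); apply: val_inj; rewrite /= inordK // ltnS; case: j => j /= hj; lia.
Qed.

Lemma card_broom : #|broom| = (\sum_(i < 3) (d i + t i).+1)%N.
Proof.
rewrite -sum1_card -[LHS]/(\sum_(x : V) 1)%N broom_big; apply: eq_bigr => i _.
by rewrite /= !sum_nat_const !card_ord !muln1 add1n.
Qed.

(** 1 for the parent, one more at a root for the preceding triangle vertex, and then the children
    along the path or at its end. *)
Definition broom_deg i j : nat :=
  (1 + (j == 0) + (if j < d i then 1 else if j == d i then t i else 0))%N.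

Lemma broom_adjE (x y : broom) : adj x y = (broom_par x == y) || (broom_par y == x).
Proof. by []. Qed.

Lemma broom_degE i j : (j <= d i + t i)%N -> deg (at_ i j : broom) = broom_deg i j.
Proof.
move=> hj; rewrite (@par_deg broom broom_par broom_adjE broom_par2) -sum1_card.
rewrite /broom_deg -addnA add1n; congr _.+1.
rewrite (eq_bigl (fun y : V => broom_par y == at_ i j)); last by move=> y; rewrite inE.
rewrite big_mkcond broom_big /=.
rewrite (eq_bigr (fun i' : 'I_3 => ((ordS i' == i) && (j == 0)) + (i' == i) *
   (if j < d i then 1 else if j == d i then t i else 0))); last first.
  move=> i' _; congr (_ + _)%N.
    by rewrite par_at0 at_eq // [0 == _]eq_sym; case: (_ && _).
  rewrite (eq_bigr (fun j' : 'I_(d i') => ((i' == i) && (j' == j :> nat)) : nat)); last first.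
    move=> j' _; rewrite par_atS; last by case: j' => j' /= h; lia.
    rewrite (_ : (j' < d i') = true) /=; last exact: ltn_ord.
    have jb : j' <= d i' + t i' by case: j' => j' /= h; lia.
    by rewrite at_eq //; case: (_ && _).
  rewrite [X in _ + X](eq_bigr (fun j' : 'I_(t i') => ((i' == i) && (d i' == j)) : nat)); last first.
    move=> j' _; rewrite par_atS; last by case: j' => j' /= h; lia.
    by rewrite ltnNge leq_addr /= at_eq ?leq_addr //.
  case: eqVneq => [->|_] /=; last by rewrite !big1.
  rewrite mul1n sum_nat_const card_ord; case: ltnP => [lt|ge].
    rewrite (bigD1 (Ordinal lt)) //= eqxx big1; last first.
      by move=> j' nj; apply/eqP; rewrite eqb0; apply: contraNneq nj => /= e; apply/eqP/val_inj.
    by rewrite gtn_eqF // muln0.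
  rewrite big1; last by move=> j' _; apply/eqP; rewrite eqb0; case: j' => j' /= h; lia.
  by rewrite eq_sym; case: eqP; rewrite ?muln1 ?muln0.
rewrite big_split /=; congr (_ + _).
  by case: i j {hj} => [[|[|[|//]]] h] [|j]; rewrite !big_ord_recl big_ord0.
rewrite (bigD1 i) //= eqxx mul1n big1 ?addn0 // => i' /negbTE ->.
by [].
Qed.

Definition broom_root (i : 'I_3) : broom := at_ i 0.

Lemma broom_rootP x : exists m, iter m broom_par x = broom_root ord0.
Proof.
have root i : exists m, iter m broom_par (broom_root i) = broom_root ord0.
  case: i => [[|[|[|//]]] h].
  - by exists 0; congr broom_root; apply: val_inj.
  - exists 2; rewrite /= !par_at0; congr (at_ _ _); exact: val_inj.
  - exists 1; rewrite /= !par_at0; congr (at_ _ _); exact: val_inj.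
rewrite [x]at_E; move: (tag x) (tagged x : nat) (at_bound x) => i j.
have [m] := ubnP j; elim: m j => // m IH [|j] lt hj; first exact: root.
have [|p hp] := IH _ _ (@step_bound i j.+1 hj).
  by case: ifP; lia.
by exists p.+1; rewrite iterSr par_atS.
Qed.

Lemma broom_conn : conn [set: broom].
Proof. exact: (par_conn broom_adjE broom_rootP). Qed.

Lemma broom_en : en [set: broom] = #|broom|.
Proof. exact: (par_en broom_adjE broom_par2). Qed.

Definition broom_cycle : seq broom := [seq broom_root i | i <- enum 'I_3].

Lemma broom_cycleE : broom_cycle =
  [:: at_ (inord 0) 0; at_ (inord 1) 0; at_ (inord 2) 0].
Proof.
rewrite /broom_cycle (_ : enum 'I_3 = [:: inord 0; inord 1; inord 2]) //.
by apply: (inj_map val_inj); rewrite val_enum_ord /= !inordK.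
Qed.

Lemma broom_cyc : cyc broom_cycle.
Proof.
have e (a b : nat) : a < 3 -> b < 3 -> ((inord a : 'I_3) == inord b) = (a == b).
  by move=> ha hb; rewrite -val_eqE /= !inordK.
have o a : a < 3 -> ordS (inord a : 'I_3) = inord (a.+1 %% 3).
  by move=> ha; apply: val_inj; rewrite /= !inordK // ltn_mod.
rewrite broom_cycleE; apply/and3P; split=> //.
  by rewrite /= /broom_adj !par_at0 !o // !eqxx.
by rewrite /= !inE !negb_or !at_eq // !e.
Qed.

End Brooms.

(** A tree misses some cycle vertex v and lies on one side of it: it misses either the branch at v
    or the branch at the next cycle vertex. *)
Lemma unicyclic_apexk (G : sgraph) (c : seq G) k : conn [set: G] -> cyc c ->
  en [set: G] = #|G| -> (forall v, v \in c -> k <= #|branch [set: G] c v|) ->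
  apexk k [set: G].
Proof.
move=> cG cc eV hk F _ tF.
have cs : cset c \subset [set: G] := subsetT _.
have /subsetPn[v vC vF] : ~~ (cset c \subset F).
  by apply/negP; apply: tset_acyclic.
have vc : v \in c by rewrite -in_cset.
have cTC := card_branch_hcomp cc cs vc; rewrite cardsT in cTC *.
have [nc _ _ _ [_ nv _]] := cyc_next cc vc.
case: (eqVneq (F :&: hcomp [set: G] c v) set0) => [e|n0].
  have FT : F \subset branch [set: G] c v.
    apply/subsetP => x xF; rewrite in_setD in_setT andbT.
    by apply/negP => xC; have := in_set0 x; rewrite -e in_setI xF xC.
  have kn := hk _ nc; have := subset_leq_card FT.
  have := branch_disj cG cc cs nc vc nv; rewrite disjoints_subset => /subset_leq_card.
  have := cardsC (branch [set: G] c v); lia.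
have : F :&: hcomp [set: G] c v = F.
  apply: (proj2 (proj1 tF)) => //; first exact: subsetIl.
  move=> x y; rewrite !in_setI => /andP[xF xC] yF xy; rewrite yF /=.
  apply: (hcomp_closed cc cs vc xC (in_setT y) _ xy).
  by apply: contraNneq vF => <-.
by move/setIidPl/subset_leq_card; have := hk v vc; lia.
Qed.

Section BroomApex.
Variables (d t : 'I_3 -> nat).
Let B := broom d t.
Let c : seq B := broom_cycle d t.
Let s i := (d i + t i).+1.

(** Only roots are joined across different indices, and the root of i is not in its [hcomp]; so
    removing the vertices of index i from [hcomp] leaves a closed part, which must be everything. *)
Lemma broom_fiber (i : 'I_3) : s i <= #|branch [set: B] c (broom_root d t i)|.
Proof.
have rc : broom_root d t i \in c by apply: map_f; rewrite mem_enum.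
have cc := broom_cyc d t; have cs : cset c \subset [set: B] := subsetT _.
set r := broom_root d t i in rc *.
pose Fib : {set B} := [set x : B | tag x == i].
have cF : #|Fib| = s i.
  rewrite cardsE -sum1_card big_mkcond /= (@broom_big d t nat 0 addn (fun x => if tag x == i then 1 else 0)).
  rewrite (bigD1 i) //= eqxx !sum_nat_const !card_ord !muln1 add1n big1 ?addn0 // => j /negbTE ->.
  by rewrite !sum_nat_const !muln0.
rewrite -cF; apply/subset_leq_card/subsetP => x xF; rewrite in_setD in_setT andbT.
apply/negP => xC.
have [nc _ _ _ [_ nv _]] := cyc_next cc rc.
have cC := conn_hcomp cc cs rc.
have : hcomp [set: B] c r :\: Fib = hcomp [set: B] c r; last first.
  by move/setP/(_ x); rewrite in_setD xF xC /=.
apply: (proj2 cC); first exact: subsetDl.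
  apply/set0Pn; exists (next c r); rewrite in_setD; apply/andP; split.
    rewrite inE; case/mapP: nc nv => j _ ->.
    by apply: contraNneq => e; rewrite /r -e.
  by apply: (subsetP (cyc_hcomp cc cs rc)); rewrite in_setD1 nv in_cset.
move=> a b; rewrite !in_setD => /andP[aF aC] bC ab; rewrite bC andbT.
have br : b != r by have := subsetP (hcomp_sub cc cs rc) b bC; rewrite in_setD1 => /andP[].
move: aF ab br; rewrite !inE => ai.
have key (p q : B) : broom_par p == q -> tag p != tag q ->
    p == broom_root d t (tag p) /\ q == broom_root d t (tag q).
  move=> /eqP <-; case: (eqVneq (tagged p : nat) 0) => [e _|ne]; last first.
    by rewrite /broom_par (negbTE ne) /= eqxx.
  have ep : p = broom_root d t (tag p) by rewrite {1}[p]at_E e.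
  have -> : broom_par p = broom_root d t (ordS (tag p)) by rewrite {1}ep par_at0.
  by rewrite -ep !eqxx.
move=> ab; apply: contraNN => /eqP bi; rewrite /r -bi.
case/orP: ab => ab.
  by have [] := key _ _ ab; rewrite ?bi.
by have [] := key _ _ ab; rewrite // bi eq_sym.
Qed.

(** The lower bounds of [broom_fiber] add up to the number of vertices, so all of them are
    equalities. *)
Lemma broom_branch i : #|branch [set: B] c (broom_root d t i)| = s i.
Proof.
have := uni_sum_card (broom_conn d t) (broom_cyc d t) (subsetT _).
rewrite cardsT => /(_ (broom_en d t)); rewrite card_broom.
have cu : uniq c by case/and3P: (broom_cyc d t).
rewrite (eq_bigl (fun x => x \in c)); last by move=> x; rewrite in_cset.
rewrite -big_uniq //= big_map big_enum /= => h.
have := leqif_sum (fun j (_ : xpredT j) => leqif_eq (broom_fiber j)).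
by case=> _; rewrite /s -h eqxx => /esym/forall_inP/(_ i isT)/eqP.
Qed.

Lemma broom_apex k : (forall i, k <= s i) -> (exists i, s i = k) -> apex_tree k B.
Proof.
move=> ks [i si]; have cB := broom_conn d t; have cc := broom_cyc d t.
have aB : apexk k [set: B].
  apply: (unicyclic_apexk cB cc (broom_en d t)) => v /mapP[j _ ->].
  by rewrite broom_branch.
have rc : broom_root d t i \in c by apply: map_f; rewrite mem_enum.
have eB : en [set: B] = #|[set: B]| by rewrite cardsT; apply: broom_en.
have [tC _] := uni_trees cB cc (subsetT _) rc eB.
split; first by apply/connected_conn.
  exists (branch [set: B] c (broom_root d t i)); rewrite broom_branch; split=> //.
  apply/tree_del; rewrite (_ : ~: _ = hcomp [set: B] c (broom_root d t i)) //.
  by apply/setP => x; rewrite in_setC in_setD in_setT andbT negbK.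
move=> X lt /tree_del tX; have := aB _ (subsetT _) tX.
by have := cardsC X; rewrite cardsT; lia.
Qed.

End BroomApex.

Local Open Scope ring_scope.

Section BroomExf.
Variables (d t : 'I_3 -> nat).
Let D i (j : nat) : nat := broom_deg d t i j.

Lemma broom_exf : exf [set: broom d t] = \sum_(i < 3)
  (fw (D i 0%N) (D (ordS i) 0%N) - 1 + (\sum_(j < d i) (fw (D i j.+1) (D i j) - 1) +
   (t i)%:R * (fw 1 (D i (d i)) - 1))).
Proof.
rewrite (par_exf (broom_adjE (t := t)) (@broom_par2 d t)).
have := @broom_big d t rat 0 +%R
  (fun x => fw (deg (x : broom d t)) (deg (broom_par x : broom d t))).
rewrite /= => ->; rewrite card_broom natr_sum -sumrB; apply: eq_bigr => i _.
rewrite par_at0 !broom_degE // -/(D _ _).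
rewrite (eq_bigr (fun j : 'I_(d i) => fw (D i j.+1) (D i j) - 1 + 1)); last first.
  move=> j _; have hj : (j.+1 <= d i + t i)%N by case: j => j /= h; lia.
  rewrite par_atS // (_ : (j < d i)%N = true) ?ltn_ord //= !broom_degE ?(ltnW hj) //.
  by rewrite subrK.
rewrite [X in _ + (_ + X) - _](eq_bigr (fun j : 'I_(t i) => fw 1 (D i (d i)))); last first.
  move=> j _; have hj : ((d i + j).+1 <= d i + t i)%N by case: j => j /= h; lia.
  rewrite par_atS // ltnNge leq_addr /= !broom_degE ?leq_addr //.
  congr (fw _ _); rewrite /broom_deg /=.
  by rewrite ltnNge leqW ?leq_addr //= gtn_eqF // ltnS leq_addr.
rewrite big_split /= !sumr_const !card_ord -[fw _ _ *+ _]mulr_natl -natr1 natrD.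
lra.
Qed.

End BroomExf.

Definition fun3 (a b c : nat) (i : 'I_3) : nat := nth 0%N [:: a; b; c] i.

Lemma fun3_sum (a b c : nat) (F : 'I_3 -> rat) :
  \sum_(i < 3) F i = F (inord 0) + (F (inord 1) + F (inord 2)).
Proof.
rewrite !big_ord_recl big_ord0 addr0; congr (F _ + (F _ + F _)); apply: val_inj;
by rewrite /= inordK.
Qed.

Lemma fun3_forall (P : 'I_3 -> Prop) : P (inord 0) -> P (inord 1) -> P (inord 2) -> forall i, P i.
Proof.
move=> p0 p1 p2 i; have -> : i = inord i by apply: val_inj; rewrite /= inordK.
by case: i => [[|[|[|//]]] h].
Qed.

Lemma ordS_inord i : (i < 3)%N -> ordS (inord i : 'I_3) = inord (i.+1 %% 3).
Proof. by move=> h; apply: val_inj; rewrite /= !inordK // ltn_mod. Qed.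

Section Values.
Variables d0 d1 d2 t0 t1 t2 : nat.
Let d := fun3 d0 d1 d2.
Let t := fun3 t0 t1 t2.

Definition root_deg (e u : nat) : nat := if e is 0%N then u.+2 else 3%N.

Definition arm (e u : nat) : rat := match e with
  | 0%N => u%:R * (fw 1 u.+2 - 1)
  | 1%N => fw 3 u.+1 - 1 + u%:R * (fw 1 u.+1 - 1)
  | _ => 14 + u%:R * (fw 1 u.+1 - 1) end.

Lemma broom_value : (d0 <= 2)%N -> (d1 <= 2)%N -> (d2 <= 2)%N ->
  (0 < t0)%N -> (0 < t1)%N -> (0 < t2)%N ->
  let r0 := root_deg d0 t0 in let r1 := root_deg d1 t1 in let r2 := root_deg d2 t2 in
  exf [set: broom d t] = (fw r0 r1 + fw r1 r2 + fw r2 r0 - 3) +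
    (arm d0 t0 + (arm d1 t1 + arm d2 t2)).
Proof.
move=> h0 h1 h2 p0 p1 p2 /=; rewrite broom_exf fun3_sum // !ordS_inord //=.
have root i : broom_deg d t i 0 = root_deg (d i) (t i).
  by rewrite /broom_deg /root_deg; case: (d i) => [|m] /=; rewrite ?addn0 ?addn1.
rewrite !root.
have armE i : (d i <= 2)%N -> (0 < t i)%N ->
    \sum_(j < d i) (fw (broom_deg d t i j.+1) (broom_deg d t i j) - 1) +
    (t i)%:R * (fw 1 (broom_deg d t i (d i)) - 1) = arm (d i) (t i).
  move=> le ti; rewrite /broom_deg; case: (d i) le => [|[|[|//]]] _ /=.
  - by rewrite big_ord0 add0r.
  - by rewrite big_ord_recl big_ord0 addr0 /= fwC.
  - rewrite !big_ord_recl big_ord0 addr0 /= /bump /=; congr (_ + _).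
    by rewrite fw2 // fwC fw2 //; lra.
have e i a b c : (i < 3)%N -> fun3 a b c (inord i) = nth 0%N [:: a; b; c] i.
  by move=> hi; rewrite /fun3 inordK.
rewrite !armE /d /t ?e //=; lra.
Qed.

Lemma broom_in_class k n : (k <= (d0 + t0).+1)%N -> (k <= (d1 + t1).+1)%N ->
  (k <= (d2 + t2).+1)%N -> (d0 + t0).+1 = k \/ (d1 + t1).+1 = k ->
  ((d0 + t0).+1 + ((d1 + t1).+1 + (d2 + t2).+1) = n)%N ->
  in_apex_class k n (broom d t).
Proof.
have e i a b c : (i < 3)%N -> fun3 a b c (inord i) = nth 0%N [:: a; b; c] i.
  by move=> hi; rewrite /fun3 inordK.
move=> k0 k1 k2 kk sn; split.
  apply: broom_apex; first by apply: fun3_forall; rewrite /d /t !e.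
  by case: kk => h; [exists (inord 0)|exists (inord 1)]; rewrite /d /t !e.
rewrite card_broom !big_ord_recl big_ord0 addn0 -sn.
by rewrite /d /t /fun3.
Qed.

End Values.

Lemma arm2 u : (0 < u)%N -> arm 2 u = Z_val (u + 3).
Proof. by move=> u0; rewrite /arm hz_fw // /Z_val addnK; lra. Qed.

Lemma arm2_sub s : (4 <= s)%N -> arm 2 (s - 3) = Z_val s.
Proof. by move=> s4; rewrite arm2; [congr Z_val; lia|lia]. Qed.

Lemma candidate_A k n : (7 <= k)%N -> (3 * k + 3 <= n)%N ->
  exists2 H, in_apex_class k n H & exf [set: H] = A_value k n.
Proof.
move=> k7 kn; pose a := (n - k)./2; pose b := uphalf (n - k).
have a8 : (8 <= a)%N by rewrite /a; lia.
have b9 : (9 <= b)%N by rewrite /b; lia.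
have ka : (k <= a)%N by rewrite /a; lia.
have kb : (k <= b)%N by rewrite /b; lia.
have ab : (k + (a + b) = n)%N by rewrite /a /b; lia.
(* A branch has d + t + 1 vertices, so path length 2 leaves s - 3 pendant vertices for size s. *)
exists (broom (fun3 2 2 2) (fun3 (k - 3) (a - 3) (b - 3))).
  apply: broom_in_class; lia.
have p0 : (0 < k - 3)%N by lia. have p1 : (0 < a - 3)%N by lia.
have p2 : (0 < b - 3)%N by lia.
have -> := @broom_value 2 2 2 _ _ _ isT isT isT p0 p1 p2.
rewrite !arm2_sub; [|lia|lia|lia].
by rewrite /root_deg /A_value -/a -/b fw33; lra.
Qed.

Lemma candidate_B n : (21 <= n)%N ->
  exists2 H, in_apex_class 6 n H & exf [set: H] = B_value n.
Proof.
move=> kn; pose a := (n - 6)./2; pose b := uphalf (n - 6).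
have a8 : (7 <= a)%N by rewrite /a; lia.
have b9 : (8 <= b)%N by rewrite /b; lia.
have ab : (6 + (a + b) = n)%N by rewrite /a /b; lia.
exists (broom (fun3 0 2 2) (fun3 5 (a - 3) (b - 3))).
  apply: broom_in_class; lia.
have p1 : (0 < a - 3)%N by lia. have p2 : (0 < b - 3)%N by lia.
have -> := @broom_value 0 2 2 5 _ _ isT isT isT isT p1 p2.
rewrite !arm2_sub; [|lia|lia].
rewrite /root_deg /arm /B_value -/a -/b /star_val -[(6 - 1)%N]/5%N deltaE (fwC 7 3) fw33.
lra.
Qed.

Lemma candidate_C k n : (4 <= k)%N -> (3 * k + 3 <= n)%N ->
  exists2 H, in_apex_class k n H & exf [set: H] = C_value k n.
Proof.
move=> k4 kn; pose b := (n - 2 * k)%N.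
have b7 : (7 <= b)%N by rewrite /b; lia.
have kb : (k <= b)%N by rewrite /b; lia.
have ab : (k + (k + b) = n)%N by rewrite /b; lia.
exists (broom (fun3 0 1 2) (fun3 (k - 1) (k - 2) (b - 3))).
  apply: broom_in_class; lia.
have p0 : (0 < k - 1)%N by lia. have p1 : (0 < k - 2)%N by lia.
have p2 : (0 < b - 3)%N by lia.
have e1 : (k - 1).+2 = k.+1 by lia. have e2 : (k - 2).+1 = (k - 1)%N by lia.
have -> := @broom_value 0 1 2 _ _ _ isT isT isT p0 p1 p2.
rewrite arm2_sub; last by lia.
rewrite /root_deg /arm e1 e2 /C_value -/b /star_val /P_val deltaE (fwC k.+1 3) fw33.
lra.
Qed.

Section Reduction.
Variables (k n : nat) (G : sgraph).
Hypothesis hG : in_apex_class k n G.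

Lemma class_conn : conn [set: G].
Proof. by case: hG => -[/connected_conn]. Qed.

Lemma class_card : #|G| = n.
Proof. by case: hG. Qed.

Lemma class_apexk : apexk k [set: G].
Proof.
case: hG => -[_ _ h] _ F _ tF; rewrite cardsT leqNgt; apply/negP => lt.
apply: (h (~: F)); last by apply/tree_del; rewrite setCK.
by have := cardsC F; lia.
Qed.

Lemma class_tree : exists2 F : {set G}, tset F & (#|F| + k = #|G|)%N.
Proof.
case: hG => -[_ [X [sX /tree_del tX]] _] _; exists (~: X) => //.
by rewrite -(cardsC X) sX addnC.
Qed.

Lemma class_AZI : AZI G = n%:R + exf [set: G].
Proof. by rewrite AZI_exf class_card. Qed.

End Reduction.

Lemma min_exf k n G (X : rat) : min_AZI k n G ->
  (exists2 H, in_apex_class k n H & exf [set: H] = X) -> exf [set: G] <= X.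
Proof.
move=> [hG hmin] [H hH <-]; have := hmin H hH.
by rewrite (class_AZI hG) (class_AZI hH) lerD2l.
Qed.

(** * Isomorphisms with the extremal graphs *)

Local Open Scope nat_scope.

Section Embeddings.
Variable G : sgraph.
Implicit Types (S T : {set G}) (u v w x y z : G).

Definition emb (H : sgraph) (r : H) S v := exists f : H -> G,
  [/\ injective f, f r = v, forall a, f a \in S,
      forall x, x \in S -> exists a, f a = x &
      forall a b, adj (f a) (f b) = adj a b].

Lemma triangle_iso (H1 H2 H3 : sgraph) (r1 : H1) (r2 : H2) (r3 : H3) S1 S2 S3 u v w :
  emb r1 S1 u -> emb r2 S2 v -> emb r3 S3 w ->
  [disjoint S1 & S2] -> [disjoint S1 & S3] -> [disjoint S2 & S3] ->
  (forall x, [|| x \in S1, x \in S2 | x \in S3]) ->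
  (forall x y, x \in S1 -> y \in S2 -> adj x y = (x == u) && (y == v)) ->
  (forall x y, x \in S1 -> y \in S3 -> adj x y = (x == u) && (y == w)) ->
  (forall x y, x \in S2 -> y \in S3 -> adj x y = (x == v) && (y == w)) ->
  iso G (triangle_attach r1 r2 r3).
Proof.
move=> [f1 [i1 e1 m1 s1 a1]] [f2 [i2 e2 m2 s2 a2]] [f3 [i3 e3 m3 s3 a3]].
move=> d12 d13 d23 cov c12 c13 c23.
pose F (p : triangle_attach r1 r2 r3) : G :=
  match p with inl (inl a) => f1 a | inl (inr a) => f2 a | inr a => f3 a end.
have no (A B : {set G}) x : [disjoint A & B] -> x \in A -> x \in B -> False.
  by move=> dAB xA xB; have := disjointFr dAB xA; rewrite xB.
have iF : injective F.
  move=> [[p|p]|p] [[q|q]|q] /= e.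
  - by rewrite (i1 _ _ e).
  - by case: (no _ _ _ d12 (m1 p)); rewrite e.
  - by case: (no _ _ _ d13 (m1 p)); rewrite e.
  - by case: (no _ _ _ d12 (m1 q)); rewrite -e.
  - by rewrite (i2 _ _ e).
  - by case: (no _ _ _ d23 (m2 p)); rewrite e.
  - by case: (no _ _ _ d13 (m1 q)); rewrite -e.
  - by case: (no _ _ _ d23 (m2 q)); rewrite -e.
  - by rewrite (i3 _ _ e).
have aF p q : adj (F p) (F q) = adj p q.
  case: p q => [[p|p]|p] [[q|q]|q] /=; rewrite ?a1 ?a2 ?a3 //.
  - by rewrite c12 // -e1 -e2 !inj_eq.
  - by rewrite c13 // -e1 -e3 !inj_eq.
  - by rewrite adj_sym c12 // -e1 -e2 !inj_eq // andbC.
  - by rewrite c23 // -e2 -e3 !inj_eq.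
  - by rewrite adj_sym c13 // -e1 -e3 !inj_eq // andbC.
  - by rewrite adj_sym c23 // -e2 -e3 !inj_eq // andbC.
(* [iso] wants a map out of G, so a right inverse of the glued embedding is chosen. *)
have [g Fg] : exists g : G -> triangle_attach r1 r2 r3, forall x, F (g x) = x.
  apply: (@fin_all_exists G (fun=> triangle_attach r1 r2 r3) (fun x p => F p = x)) => x; case/or3P: (cov x) => xS.
  - by have [p <-] := s1 x xS; exists (inl (inl p)).
  - by have [p <-] := s2 x xS; exists (inl (inr p)).
  - by have [p <-] := s3 x xS; exists (inr p).
exists g; split; last by move=> x y; rewrite -aF !Fg.
by exists F => // p; apply: iF; rewrite Fg.
Qed.

(** The root may be the center or a leaf, which serves both kinds of stars in B and C. *)
Lemma emb_star S z v (m : nat) : z \in S -> v \in S -> #|S| = m.+1 ->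
  (forall y, y \in S -> y != z -> adj z y) ->
  (forall x y, x \in S -> y \in S -> x != z -> y != z -> adj x y = false) ->
  exists2 r : star m, emb r S v & (r == None) = (v == z).
Proof.
move=> zS vS cS az nz; have cD : #|S :\ z| = m.
  by have := cardsD1 z S; rewrite zS cS; lia.
have inD (i : 'I_m) : enum_val (cast_ord (esym cD) i) \in S :\ z by apply: enum_valP.
pose f (x : star m) : G := if x is Some i then enum_val (cast_ord (esym cD) i) else z.
have fS (p : star m) : f p \in S.
  by case: p => [i|] //=; have := inD i; rewrite in_setD1 => /andP[].
have fz i : f (Some i) != z by have := inD i; rewrite in_setD1 => /andP[].
have fi : injective f.
  move=> [i|] [j|] //=.
  - by move/enum_val_inj/cast_ord_inj => ->.
  - by move=> e; have := fz i; rewrite /= e eqxx.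
  - by move=> e; have := fz j; rewrite /= -e eqxx.
have fsur x : x \in S -> exists p, f p = x.
  move=> xS; case: (eqVneq x z) => [->|xz]; first by exists None.
  have xD : x \in S :\ z by rewrite in_setD1 xz.
  exists (Some (cast_ord cD (enum_rank_in xD x))).
  by rewrite /= cast_ordK enum_rankK_in.
have fa p q : adj (f p) (f q) = adj p q.
  case: p q => [i|] [j|]; rewrite [in RHS]/adj /=.
  - exact: (nz _ _ (fS (Some i)) (fS (Some j)) (fz i) (fz j)).
  - by rewrite adj_sym; apply: (az _ (fS (Some i)) (fz i)).
  - exact: (az _ (fS (Some j)) (fz j)).
  - exact: adj_irrefl.
have [r fr] := fsur v vS; exists r; first by exists f.
by rewrite -fr -[z in RHS]/(f None) inj_eq.
Qed.

Lemma emb_del S v (vS : v \notin ~: S) : emb (Sub v vS : del_vertices (~: S)) S v.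
Proof.
exists (fun x : del_vertices (~: S) => val x); split.
- exact: val_inj.
- by rewrite SubK.
- by move=> p; have := valP p; rewrite /= in_setC negbK.
- by move=> x xS; have xN : x \notin ~: S by [rewrite in_setC negbK]; exists (Sub x xN); rewrite SubK.
- by [].
Qed.

Lemma deg_del S (p : del_vertices (~: S)) : deg p = #|nb S (val p)|.
Proof.
rewrite /deg -(card_imset _ val_inj); apply: eq_card => x; rewrite in_nb.
apply/imsetP/andP => [[q]|[xS px]].
  by rewrite inE => pq ->; have := valP q; rewrite /= in_setC negbK.
have xN : x \notin ~: S by rewrite in_setC negbK.
by exists (Sub x xN); rewrite ?inE ?SubK.
Qed.

Lemma card_del S (P : pred G) :
  #|[set p : del_vertices (~: S) | P (val p)]| = #|[set x in S | P x]|.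
Proof.
rewrite -(card_imset _ val_inj); apply: eq_card => x; rewrite inE.
apply/imsetP/andP => [[q]|[xS px]].
  by rewrite inE => pq ->; have := valP q; rewrite /= in_setC negbK.
have xN : x \notin ~: S by rewrite in_setC negbK.
by exists (Sub x xN); rewrite ?inE ?SubK.
Qed.

Lemma deg_star m (p : star m) : p != None -> pendant p.
Proof.
case: p => // i _; rewrite /pendant /deg; apply/eqP/cards1P; exists None.
by apply/setP => -[j|]; rewrite !inE.
Qed.

Hypotheses (cG : conn [set: G]) (G3 : 2 < #|G|).

Section Branch.
Variables (T : {set G}) (v : G).
Hypotheses (cT : conn T) (vT : v \in T) (tT : tset T).
Hypothesis clT : forall x y, x \in T -> x != v -> adj x y -> y \in T.

Lemma star_emb : star_at T v -> emb (star_center (#|T| - 1)) T v.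
Proof.
move=> [dv h]; have T0 : 0 < #|T| by apply/card_gt0P; exists v.
have h1 : #|T| = (#|T| - 1).+1 by lia.
have h2 y : y \in T -> y != v -> adj v y by move=> yT yv; case: (h y yT yv).
have h3 x y : x \in T -> y \in T -> x != v -> y != v -> adj x y = false.
  move=> xT yT xv yv; apply/negP => xy; have [dx vx] := h x xT xv.
  by move: yv; rewrite (deg1_nb dx xy (_ : adj x v)) ?eqxx // adjC.
by have [[i|] er] := emb_star vT vT h1 h2 h3; rewrite eqxx.
Qed.

Lemma P_emb : P_at T v -> exists2 r : star (#|T| - 1), emb r T v & pendant r.
Proof.
move=> [dv [z [nv dz h]]]; have T0 : 0 < #|T| by apply/card_gt0P; exists v.
have [zT vz] : z \in T /\ adj v z.
  by have : z \in nb T v by [rewrite nv set11]; rewrite in_nb => /andP[].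
have adjz x y : x \in T -> y \in T -> x != z -> y != z -> x != v -> adj x y = false.
  move=> xT yT xz yz xv; apply/negP => xy; have [dx zx] := h x xT xv xz.
  by move: yz; rewrite (deg1_nb dx xy (_ : adj x z)) ?eqxx // adjC.
have h1 : #|T| = (#|T| - 1).+1 by lia.
have h2 y : y \in T -> y != z -> adj z y.
  move=> yT yz; case: (eqVneq y v) => [->|yv]; first by rewrite adjC.
  by case: (h y yT yv yz).
have h3 x y : x \in T -> y \in T -> x != z -> y != z -> adj x y = false.
  move=> xT yT xz yz; case: (eqVneq x v) => [->|xv]; last exact: adjz.
  case: (eqVneq y v) => [->|yv]; first exact: adj_irrefl.
  by rewrite adjC; apply: (adjz y v yT vT yz (adj_neq vz) yv).
have [r er rz] := emb_star zT vT h1 h2 h3.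
exists r => //; apply: deg_star; rewrite rz.
exact: adj_neq.
Qed.

(** The copy of Z is the graph left after deleting everything outside T. Five vertices make the
    degree of the hub differ from 1 and 2, so that the vertices can be counted by degree. *)
Lemma Z_emb : 5 <= #|T| -> Z_at T v ->
  exists (H : sgraph) (r : H), is_rooted_Z #|T| r /\ emb r T v.
Proof.
move=> T5 [dv [z [x [[nv dz] [xT zx xv] dx h]]]].
have [zT vz] : z \in T /\ adj v z.
  by have : z \in nb T v by [rewrite nv set11]; rewrite in_nb => /andP[].
have zv : z != v by rewrite eq_sym adj_neq.
have xz : x != z by rewrite eq_sym adj_neq.
have vN : v \notin ~: T by rewrite in_setC negbK.
have zN : z \notin ~: T by rewrite in_setC negbK.
exists (del_vertices (~: T)), (Sub v vN); split; last exact: emb_del.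
have degi y : y \in T -> y != v -> #|nb T y| = deg y.
  move=> yT yv; apply: eq_card => w; rewrite in_nb inE.
  by case: (boolP (adj y w)) => [yw|]; rewrite ?andbF ?andbT // (clT yT yv yw).
have ev : #|nb T v| = 1 by rewrite nv cards1.
have degT y : y \in T -> #|nb T y| = if y == z then 2 else if y == x then #|T| - 2 else 1.
  move=> yT; case: (eqVneq y v) => [->|yv].
    by rewrite ev eq_sym (negbTE zv) eq_sym (negbTE xv).
  rewrite degi //; case: eqVneq => [->//|yz]; case: eqVneq => [->//|yx].
  by case: (h y yT yv yz yx).
have cnt k (S : {set G}) : S \subset T -> (forall y, y \in T -> (#|nb T y| == k) = (y \in S)) ->
    #|[set p : del_vertices (~: T) | deg p == k]| = #|S|.
  move=> ST hS; transitivity #|[set p : del_vertices (~: T) | val p \in S]|.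
    apply: eq_card => p; rewrite !inE deg_del hS //.
    by have := valP p; rewrite /= in_setC negbK.
  rewrite (card_del T (fun y => y \in S)); apply: eq_card => y; rewrite inE.
  by case: (boolP (y \in S)) => [/(subsetP ST) ->|]; rewrite ?andbF.
have card1s y : y \in T -> [set y] \subset T by move=> yT; rewrite sub1set.
have cT' : #|del_vertices (~: T)| = #|T|.
  rewrite -cardsT; transitivity #|[set p : del_vertices (~: T) | xpredT (val p)]|.
    by apply: eq_card => p; rewrite !inE.
  by rewrite (card_del T xpredT); apply: eq_card => y; rewrite inE andbT.
split; last first.
  split; first by rewrite /pendant deg_del SubK ev.
  exists (Sub z zN); split; first by rewrite /= /adj /= ?SubK.
  by rewrite deg_del SubK degT // eqxx.
right; split=> //; first by apply/tree_del; rewrite setCK.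
have c2 : #|T :\: [set z; x]| = #|T| - 2.
  rewrite cardsD (setIidPr _) ?cards2 1?eq_sym ?xz //.
  by rewrite subUset !sub1set zT.
have n1 : (#|T| - 2 == 1) = false by apply/eqP; clear - T5; lia.
have n2 : (#|T| - 2 == 2) = false by apply/eqP; clear - T5; lia.
split.
- rewrite (cnt 1 (T :\: [set z; x])) ?subsetDl // => y yT.
  rewrite degT // in_setD yT andbT in_set2.
  by case: (y == z); case: (y == x); rewrite ?n1.
- rewrite (cnt 2 [set z]) ?cards1 ?card1s // => y yT.
  by rewrite degT // in_set1; case: (y == z); case: (y == x); rewrite ?n2.
- rewrite (cnt (#|T| - 2) [set x]) ?cards1 ?card1s // => y yT.
  rewrite degT // in_set1; case: (eqVneq y z) => [->|_].
    by rewrite [z == x]eq_sym (negbTE xz) eq_sym n2.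
  by case: (eqVneq y x) => _; rewrite ?eqxx // eq_sym n1.
Qed.

End Branch.

Variables (c : seq G) (u b d : G).
Hypothesis shape : tri_shape c u b d.
Let T v := branch [set: G] c v.

Let cc : cyc c. Proof. by case: shape. Qed.
Let cs : cset c \subset [set: G]. Proof. exact: subsetT. Qed.
Let eV : en [set: G] = #|[set: G]|. Proof. by rewrite cardsT; case: shape. Qed.

Lemma shape_branch v : v \in cset c ->
  [/\ conn (T v), v \in T v, tset (T v) &
   forall x y, x \in T v -> x != v -> adj x y -> y \in T v].
Proof.
rewrite in_cset => vc; split.
- exact: conn_branch cG cc cs v vc.
- exact: branch_self cc cs v vc.
- by case: (uni_trees cG cc cs vc eV).
- by move=> x y xT xv xy; apply: (branch_closed cc cs vc xT xv (in_setT y) xy).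
Qed.

Lemma shape_cross v w : v \in cset c -> w \in cset c -> v != w ->
  [disjoint T v & T w] /\
  forall x y, x \in T v -> y \in T w -> adj x y = (x == v) && (y == w).
Proof.
move=> vC wC vw; have [[_ vT _ clv] [_ wT _ clw]] := (shape_branch vC, shape_branch wC).
have dis : [disjoint T v & T w].
  by apply: (branch_disj cG cc cs); rewrite -?in_cset.
split=> // x y xT yT; case: (eqVneq x v) => [->|xv] /=; last first.
  apply/negP => xy; have yv := clv x y xT xv xy.
  by have := disjointFr dis yv; rewrite yT.
case: (eqVneq y w) => [->|yw]; last first.
  apply/negP => xy; rewrite adjC in xy; have vw' := clw y v yT yw xy.
  by have := disjointFr dis vT; rewrite vw'.
have vc : v \in c by rewrite -in_cset.
have [nc pc an ap [np nv pv]] := cyc_next cc vc.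
case: shape => _ _ [ub ud bd e].
have c3 : #|cset c| = 3.
  by rewrite e setUC cardsU1 cards2 !inE negb_or ub eq_sym ud eq_sym bd.
(* On a triangle every other cycle vertex is the next or the previous one, so the two roots are
   adjacent. *)
have : w \in [set next c v; prev c v].
  have sub : [set next c v; prev c v] \subset cset c :\ v.
    by rewrite subUset !sub1set !in_setD1 nv pv !in_cset nc pc.
  have -> : [set next c v; prev c v] = cset c :\ v.
    apply/eqP; rewrite eqEcard sub cards2 np.
    by move: c3; rewrite (cardsD1 v) vC add1n => -[->].
  by rewrite in_setD1 eq_sym vw.
by rewrite in_set2 => /orP[] /eqP ->.
Qed.

Lemma shape_iso (H1 H2 H3 : sgraph) (r1 : H1) (r2 : H2) (r3 : H3) :
  emb r1 (T u) u -> emb r2 (T b) b -> emb r3 (T d) d ->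
  iso G (triangle_attach r1 r2 r3).
Proof.
move=> h1 h2 h3; case: (shape) => _ _ [ub ud bd e].
have [uC bC dC] : [/\ u \in cset c, b \in cset c & d \in cset c].
  by rewrite e !inE !eqxx !orbT.
have [d12 a12] := shape_cross uC bC ub; have [d13 a13] := shape_cross uC dC ud.
have [d23 a23] := shape_cross bC dC bd.
apply: (triangle_iso h1 h2 h3 d12 d13 d23) => // x.
have [v vc xT] := uni_cover cG cc cs eV (in_setT x).
rewrite -in_cset e !inE in vc.
by case/orP: vc xT => [/orP[]|] /eqP -> xT; rewrite /T xT ?orbT.
Qed.

Lemma shape_Z v : v \in cset c -> 5 <= #|T v| -> Z_at (T v) v ->
  exists (H : sgraph) (r : H), is_rooted_Z #|T v| r /\ emb r (T v) v.
Proof. by move=> vC; have [c1 v1 t1 cl1] := shape_branch vC; apply: Z_emb. Qed.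

End Embeddings.

Lemma tri_shape_swap (G : sgraph) (c : seq G) u b d : tri_shape c u b d -> tri_shape c u d b.
Proof. by case=> cc eV [ub ud bd e]; split=> //; split; rewrite // 1?eq_sym // e setUAC. Qed.

(* n./2 and uphalf n are the floor and the ceiling of n / 2. *)
Theorem theorem1p1 (k n : nat) (hk : 4 <= k) (hn : 3 * k + 3 <= n)
    (G0 : sgraph) (hG0 : min_AZI k n G0) :
  [/\ 7 <= k -> is_A k (n - k)./2 (uphalf (n - k)) G0,
      k = 6 -> is_B 6 (uphalf n - 3) (n./2 - 3) G0
    & 4 <= k <= 5 -> is_C k k (n - 2 * k) G0].
Proof.
have hG := proj1 hG0; have cG := class_conn hG; have cn := class_card hG.
have aV := class_apexk hG; have [F tF sF] := class_tree hG.
have n3 : 3 * k + 3 <= #|G0| by rewrite cn.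
have G3 : 2 < #|G0| by lia.
have mem (c : seq G0) u b d : tri_shape c u b d ->
    [/\ u \in cset c, b \in cset c & d \in cset c].
  by case=> _ _ [_ _ _ ->]; rewrite !inE !eqxx !orbT.
have Z (c : seq G0) u b d v s : tri_shape c u b d -> v \in cset c ->
    #|branch [set: G0] c v| = s -> 5 <= s -> Z_at (branch [set: G0] c v) v ->
    exists (H : sgraph) (r : H), is_rooted_Z s r /\ emb r (branch [set: G0] c v) v.
  by move=> sh vC <-; apply: (shape_Z cG sh vC).
have S (c : seq G0) u b d v s : tri_shape c u b d -> v \in cset c ->
    #|branch [set: G0] c v| = s -> star_at (branch [set: G0] c v) v ->
    emb (star_center (s - 1)) (branch [set: G0] c v) v.
  by move=> sh vC <- sv; have [_ vT _ _] := shape_branch cG sh vC; apply: star_emb.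
split.
- move=> k7; have ka : 5 <= (n - k)./2 by lia.
  have kb : 5 <= uphalf (n - k) by lia.
  have k5 : 5 <= k by lia.
  have le := min_exf hG0 (candidate_A k7 hn); rewrite -cn in le.
  have [c [u [b [d [sh [su sb sd] [zu zb zd]]]]]] := extremal_A cG hk n3 aV tF sF k7 le.
  rewrite cn in sb sd; have [uC bC dC] := mem _ _ _ _ sh.
  have [H1 [r1 [z1 e1]]] := Z _ _ _ _ _ _ sh uC su k5 zu.
  have [H2 [r2 [z2 e2]]] := Z _ _ _ _ _ _ sh bC sb ka zb.
  have [H3 [r3 [z3 e3]]] := Z _ _ _ _ _ _ sh dC sd kb zd.
  exists H1, H2, H3, r1, r2, r3; split; [exact: z1|exact: z2|exact: z3|].
  exact: (shape_iso cG sh e1 e2 e3).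
- move=> k6; have n21 : 21 <= n by rewrite k6 in hn.
  have ea : (n - 6)./2 = n./2 - 3 by lia.
  have eb : uphalf (n - 6) = uphalf n - 3 by lia.
  have ka : 5 <= n./2 - 3 by lia.
  have kb : 5 <= uphalf n - 3 by lia.
  have hG6 : min_AZI 6 n G0 by rewrite -k6.
  have le := min_exf hG6 (candidate_B n21); rewrite -cn in le.
  have [c [u [b [d [sh [su sb sd] [zu zb zd]]]]]] := extremal_B cG hk n3 aV tF sF k6 le.
  rewrite cn ea in sb; rewrite cn eb in sd; have [uC bC dC] := mem _ _ _ _ sh.
  have e1 := S _ _ _ _ _ _ sh uC su zu.
  have [H2 [r2 [z2 e2]]] := Z _ _ _ _ _ _ sh bC sb ka zb.
  have [H3 [r3 [z3 e3]]] := Z _ _ _ _ _ _ sh dC sd kb zd.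
  split; first by [].
  (* The statement lists the larger tree first, hence the exchange of the last two branches. *)
  exists H3, H2, r3, r2; split; [exact: z3|exact: z2|].
  exact: (shape_iso cG (tri_shape_swap sh) e1 e3 e2).
- case/andP=> _ k5; have kb : 5 <= n - 2 * k by lia.
  have le := min_exf hG0 (candidate_C hk hn); rewrite -cn in le.
  have [c [u [b [d [sh [su sb sd] [zu pb zd]]]]]] := extremal_C cG hk n3 aV tF sF k5 le.
  rewrite cn in sd; have [uC bC dC] := mem _ _ _ _ sh.
  have e1 := S _ _ _ _ _ _ sh uC su zu.
  have [_ bT _ _] := shape_branch cG sh bC.
  have [r2 e2 p2] := P_emb G3 bT pb.
  have [H3 [r3 [z3 e3]]] := Z _ _ _ _ _ _ sh dC sd kb zd.
  move: r2 e2 p2; rewrite sb => r2 e2 p2.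
  split; [exact: ltnW (ltnW hk)|exact: ltnW hk|].
  exists r2, H3, r3; split; [exact: p2|exact: z3|].
  exact: (shape_iso cG sh e1 e2 e3).
Qed.
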